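(* Let $M\subset G$ be a Levi subgroup (containing $T$), and let $\overline M\subset\overline G$ be the covering Levi subgroup. (i) Suppose the action of $\mathfrak Q^\dag$ on either $\widehat{\mathfrak Q_Z}$ or $\widehat{\mathfrak Q_{M_0}}$ is free. Then $\mathrm{Ind}_{\overline M^\dag}^{\overline M}(\tau\boxtimes\rho)$ is irreducible for every $\tau\boxtimes\rho\in\mathrm{Irr}_{\rm gen}(\overline M^\dag)$. (ii) Specialize to $M=T$. If the actions of $\mathfrak Q^\dag$ on $\widehat{\mathfrak Q_Z}$ and on $\widehat{\mathfrak Q_{T_0}}$ are both trivial, then for every $\pi\in\mathrm{Irr}_{\rm gen}(\overline T)$ one has $\pi|_{\overline T^\dag}\simeq(\tau\boxtimes\rho)^{\oplus e}$ for some $\tau\boxtimes\rho\in\mathrm{Irr}_{\rm gen}(\overline T^\dag)$ and some $e\in\mathbb N$. On the other hand, if $Z(\overline T)\subset Z(\overline{Z(G)})\cdot Z(\overline T_0)$, then for every $\tau\boxtimes\rho\in\mathrm{Irr}_{\rm gen}(\overline T^\dag)$ the representation $\mathrm{Ind}_{\overline T^\dag}^{\overline T}(\tau\boxtimes\rho)$ is an isotypic sum of one irreducible genuine representation of $\overline T$.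
   Context: Let $F$ be a $p$-adic field such that $F^\times$ contains the full group $\mu_n$ of $n$-th roots of unity; $(\cdot,\cdot)_n$ is the $n$-th Hilbert symbol. Let $\mathbf G$ be a connected split reductive group over $F$ with split maximal torus $\mathbf T$, root datum $(X,\Phi,\Delta;Y,\Phi^\vee,\Delta^\vee)$, root lattice $X^{sc}$ and coroot lattice $Y^{sc}$; $G,T$ denote $F$-points, $T=Y\otimes F^\times$, $y(a)=y\otimes a$. Let $\mu_n\hookrightarrow\overline G\twoheadrightarrow G$ be the $n$-fold Brylinski–Deligne cover attached to a bilinear form $D:Y\times Y\to\mathbb Z$ with $Q(y)=D(y,y)$ Weyl-invariant and a homomorphism $\eta:Y^{sc}\to F^\times$. Set $B_Q(y,z)=D(y,z)+D(z,y)$; the commutator on $T$ is $[y_1(a),y_2(b)]=(a,b)_n^{B_Q(y_1,y_2)}$. For $H\subset G$, $\overline H$ denotes its preimage in $\overline G$. A representation is genuine if $\mu_n$ acts through a fixed embedding $\mu_n\hookrightarrow\mathbb C^\times$; $\mathrm{Irr}_{\rm gen}(\cdot)$ is the set of isomorphism classes of irreducible admissible genuine representations. Standing assumptions: $Z(\mathbf G)$ is connected, i.e. $X/X^{sc}$ is free, and the sublattice $Y_c=\mathrm{Hom}(X/X^{sc},\mathbb Z)\subset Y$ (so that $Z(G)=Y_c\otimes F^\times$) is $Y_c=\mathbb Z e_c$ for some $e_c\in Y$. Let $G_0=G_{\rm der}$ be the derived subgroup. For a Levi subgroup $M$ put $M_0=M\cap G_0$ (so $T_0=T\cap G_0$)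 and $\overline M^\dag=\overline{Z(G)}\cdot\overline M_0$, a normal subgroup of $\overline M$ with finite abelian quotient. The groups $\overline{Z(G)}$ and $\overline M_0$ commute, and every element of $\mathrm{Irr}_{\rm gen}(\overline M^\dag)$ has the form $\tau\boxtimes\rho$ with $\tau\in\mathrm{Irr}_{\rm gen}(\overline{Z(G)})$, $\rho\in\mathrm{Irr}_{\rm gen}(\overline M_0)$ agreeing on $\overline{Z(G)}\cap\overline M_0$. Put $$\mathfrak Q^\dag=\overline T/\overline T^\dag\simeq\overline M/\overline M^\dag,\quad \mathfrak Q_Z=Z(\overline{Z(G)})/Z(\overline G),\quad \mathfrak Q_{M_0}=Z(\overline M_0)/(\overline M_0\cap Z(\overline M)).$$ $\widehat{\ \cdot\ }=\mathrm{Hom}(\cdot,\mathbb C^\times)$. The group $\mathfrak Q^\dag$ acts on $\widehat{\mathfrak Q_Z}$ and $\widehat{\mathfrak Q_{M_0}}$ (the action arising from conjugation by $\overline M$): $g$ sends a character $\chi_0$ to $\chi_0\cdot\chi_g$, where $\chi_g(h)=[g^{-1},h]\in\mu_n\subset\mathbb C^\times$. *)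

(* Defs.v *)
From HB Require Import structures.
From mathcomp Require Import all_boot all_order all_algebra all_fingroup all_field.
From mathcomp Require Import complex.
From mathcomp Require Import boolp classical_sets functions reals.

Set Implicit Arguments.
Unset Strict Implicit.
Unset Printing Implicit Defensive.

Import Order.TTheory GRing.Theory Num.Theory.

Local Open Scope classical_set_scope.
Local Open Scope ring_scope.

(** * Subgroups of an abstract group *)

Record subgroup (G : groupType) := Subgroup {
  carrier :> set G;
  subgroup1 : carrier 1%g;
  subgroupM : forall x y, carrier x -> carrier y ->
    carrier (x * y)%g;
  subgroupV : forall x, carrier x -> carrier (x^-1)%g }.

Section Subgroups.
Variable G : groupType.

Definition generated_set (S : set G) : set G :=
  [set x | forall H : subgroup G, S `<=` H -> carrier H x].

Lemma generated1 S : generated_set S 1%g.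
Proof. by move=> H _; exact: subgroup1. Qed.

Lemma generatedM S x y : generated_set S x -> generated_set S y ->
  generated_set S (x * y)%g.
Proof. by move=> Sx Sy H SH; apply: subgroupM; [exact: Sx|exact: Sy]. Qed.

Lemma generatedV S x : generated_set S x -> generated_set S (x^-1)%g.
Proof. by move=> Sx H SH; apply: subgroupV; exact: Sx. Qed.

Definition generated (S : set G) : subgroup G :=
  Subgroup (@generated1 S) (@generatedM S) (@generatedV S).

Definition center (A : set G) : set G :=
  [set x | A x /\ forall y, A y -> (x * y = y * x)%g].

Definition setmul (A B : set G) : set G :=
  [set x | exists a b, [/\ A a, B b & x = (a * b)%g]].

End Subgroups.

Section PreimageSubgroup.
Variables (E G : groupType) (p : E -> G).
Hypothesis pM : {morph p : x y / (x * y)%g}.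
Variable H : subgroup G.

Lemma morph_g1 : p 1%g = 1%g.
Proof. by apply: (mulgI (p 1%g)); rewrite -pM !mulg1. Qed.

Lemma preim1 : (p @^-1` H) 1%g.
Proof. by rewrite /preimage /= morph_g1; exact: subgroup1. Qed.

Lemma preimM x y : (p @^-1` H) x -> (p @^-1` H) y -> (p @^-1` H) (x * y)%g.
Proof. by rewrite /preimage /= pM; exact: subgroupM. Qed.

Lemma preimV x : (p @^-1` H) x -> (p @^-1` H) (x^-1)%g.
Proof.
rewrite /preimage /= => Hx; suff -> : p (x^-1)%g = ((p x)^-1)%g.
  exact: subgroupV.
by apply: (mulgI (p x)); rewrite -pM !mulgV morph_g1.
Qed.

Definition preim_subgroup : subgroup E := Subgroup preim1 preimM preimV.

End PreimageSubgroup.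

(** * Smooth representations *)

(* A group topology, given by a fundamental system of neighbourhoods of 1; the
   subgroups H below carry the subspace topology. *)
Record group_topology (G : groupType) := GroupTopology {
  nbhd1 : set (set G);
  nbhd1T : nbhd1 setT;
  nbhd1I : forall U V, nbhd1 U -> nbhd1 V -> nbhd1 (U `&` V);
  nbhd1J : forall U g, nbhd1 U -> nbhd1 [set x | U (g^-1 * x * g)%g] }.

(* Representations of H \subset G: the operators rep_act g are meaningful only
   for g in H. *)
Record rep (C : fieldType) (G : groupType) (H : set G) := Rep {
  rep_space :> lmodType C;
  rep_act : G -> rep_space -> rep_space;
  rep_linear : forall g, H g -> linear (rep_act g);
  rep_act1 : forall v, rep_act 1%g v = v;
  rep_actM : forall g h v, H g -> H h ->
    rep_act (g * h)%g v = rep_act g (rep_act h v) }.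

Arguments rep_act {C G H} r g v.
Arguments rep_linear {C G H} r g _.
Arguments rep_act1 {C G H} r v.
Arguments rep_actM {C G H} r g h v _ _.

Section Representations.
Variables (C : fieldType) (G : groupType) (top : group_topology G).

Definition irreducible (H : set G) (pi : rep C H) : Prop :=
  (exists v : pi, v <> 0) /\
  forall S : set pi,
    S 0 ->
    (forall (c : C) u v, S u -> S v -> S (c *: u + v)) ->
    (forall h v, H h -> S v -> S (rep_act pi h v)) ->
    (forall v, S v -> v = 0) \/ (forall v, S v).

Definition smooth (H : set G) (pi : rep C H) : Prop :=
  forall v : pi, exists2 N, nbhd1 top N &
    forall h, H h -> N h -> rep_act pi h v = v.

Definition admissible (H : set G) (pi : rep C H) : Prop :=
  smooth pi /\
  forall U : subgroup G, U `<=` H ->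
    (exists2 N, nbhd1 top N & H `&` N `<=` U) ->
    exists (d : nat) (b : 'I_d -> pi), forall v : pi,
      (forall u, carrier U u -> rep_act pi u v = v) ->
      exists c : 'I_d -> C, v = \sum_i c i *: b i.

Definition rep_iso (H : set G) (pi sigma : rep C H) : Prop :=
  exists phi : {linear pi -> sigma}, bijective phi /\
    forall h v, H h -> phi (rep_act pi h v) = rep_act sigma h (phi v).

Section Restriction.
Variables (K H : set G) (sKH : K `<=` H) (pi : rep C H).

Definition res : rep C K := Rep
  (fun g Kg => rep_linear pi g (sKH Kg)) (rep_act1 pi)
  (fun g h v Kg Kh => rep_actM pi g h v (sKH Kg) (sKH Kh)).

End Restriction.

Section Multiple.
Variables (H : set G) (e : nat) (pi : rep C H).

Definition multiple_act (g : G) (f : {ffun 'I_e -> pi}) : {ffun 'I_e -> pi} :=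
  [ffun i => rep_act pi g (f i)].

Lemma multiple_linear g : H g -> linear (multiple_act g).
Proof. by move=> Hg c f f'; apply/ffunP => i; rewrite !ffunE rep_linear. Qed.

Lemma multiple_act1 f : multiple_act 1%g f = f.
Proof. by apply/ffunP => i; rewrite ffunE rep_act1. Qed.

Lemma multiple_actM g h f : H g -> H h ->
  multiple_act (g * h)%g f = multiple_act g (multiple_act h f).
Proof. by move=> Hg Hh; apply/ffunP => i; rewrite !ffunE rep_actM. Qed.

Definition multiple : rep C H :=
  Rep multiple_linear multiple_act1 multiple_actM.

End Multiple.

(* t : V x U -> W exhibits W as the tensor product of V and U. *)
Definition is_tensor (V U W : lmodType C) (t : V -> U -> W) : Prop :=
  [/\ forall u, linear (fun v => t v u),
      forall v, linear (t v) &
      forall (Z : lmodType C) (b : V -> U -> Z),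
        (forall u, linear (fun v => b v u)) -> (forall v, linear (b v)) ->
        exists! f : {linear W -> Z}, forall v u, f (t v u) = b v u].

(* sigma realizes tau \boxtimes rho on A B, where A and B commute. *)
Definition is_boxtimes (A B : set G)
    (tau : rep C A) (rho : rep C B) (sigma : rep C (setmul A B)) : Prop :=
  exists2 t : tau -> rho -> sigma, is_tensor t &
    forall a b v u, A a -> B b ->
      rep_act sigma (a * b)%g (t v u) = t (rep_act tau a v) (rep_act rho b u).

(* Smooth induction.  The functions live on H; they are extended by 0 to G. *)
Section Induction.
Variables (K : set G) (H : subgroup G) (sigma : rep C K).

Definition ind_cond (f : G -> sigma) : Prop :=
  [/\ forall k g, K k -> carrier H g -> f (k * g)%g = rep_act sigma k (f g),
      forall g, ~ carrier H g -> f g = 0 &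
      exists2 N, nbhd1 top N &
        forall g u, carrier H g -> carrier H u -> N u -> f (g * u)%g = f g].

Definition ind_pred : {pred G -> sigma} := fun f => `[< ind_cond f >].

Lemma ind_submod_closed : submod_closed ind_pred.
Proof.
split=> [|c f f' /asboolP[f1 f2 [N nN f3]] /asboolP[f1' f2' [N' nN' f3']]].
  apply/asboolP; split=> [k g Kk _|//|].
    have := rep_linear sigma k Kk 1 0 0.
    rewrite scale1r addr0 => /eqP; rewrite scale1r -subr_eq0 opprD addNKr.
    by rewrite oppr_eq0 => /eqP.
  by exists setT => //; exact: nbhd1T.
have fE x : (c *: f + f') x = c *: f x + f' x by [].
apply/asboolP; split=> [k g Kk Hg|g nHg|].
- by rewrite !fE f1// f1'//; exact/esym/(rep_linear sigma k Kk c).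
- by rewrite fE f2// f2'// scaler0 addr0.
- exists (N `&` N'); first exact: nbhd1I.
  by move=> g u Hg Hu [Nu N'u]; rewrite !fE f3// f3'.
Qed.

HB.instance Definition _ :=
  GRing.isSubmodClosed.Build C (G -> sigma) ind_pred ind_submod_closed.

Record ind_space := IndSpace { ind_fun :> G -> sigma; _ : ind_fun \in ind_pred }.

HB.instance Definition _ := [isSub for ind_fun].
HB.instance Definition _ := [Choice of ind_space by <:].
HB.instance Definition _ := [SubChoice_isSubLmodule of ind_space by <:].

Lemma ind_translate (g : G) (f : ind_space) : carrier H g ->
  (fun x => f (x * g)%g) \in ind_pred.
Proof.
move=> Hg; case: f => f /= /asboolP[f1 f2 [N nN f3]]; apply/asboolP.
split=> [k x Kk Hx|x nHx|].
- by rewrite -mulgA (f1 k)//; exact: subgroupM.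
- apply: f2 => Hxg; apply: nHx; rewrite -(mulgK g x).
  by apply: subgroupM => //; exact: subgroupV.
- exists [set u | N (g^-1 * u * g)%g]; first exact: nbhd1J.
  move=> x u Hx Hu Nu.
  have -> : (x * u * g = x * g * (g^-1 * u * g))%g by rewrite !mulgA mulgK.
  apply: f3 => //; first exact: subgroupM.
  by do 2?apply: subgroupM => //; exact: subgroupV.
Qed.

(* (g f)(x) = f (x g) for g in H; [insubd] only supplies a value for the other,
   irrelevant, g. *)
Definition ind_act (g : G) (f : ind_space) : ind_space :=
  insubd f (fun x => f (x * g)%g).

Lemma ind_actE g f : carrier H g ->
  ind_act g f = (fun x => f (x * g)%g) :> (G -> sigma).
Proof. by move=> Hg; rewrite [LHS]insubdK //; exact: ind_translate. Qed.

Lemma ind_funP c (f f' : ind_space) :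
  c *: f + f' = c *: (f : G -> sigma) + (f' : G -> sigma) :> (G -> sigma).
Proof. exact: (linearP (val : ind_space -> (G -> sigma)) c f f'). Qed.

Lemma ind_linear g : carrier H g -> linear (ind_act g).
Proof.
move=> Hg c f f'; apply: val_inj.
by rewrite [LHS]ind_actE// [RHS]ind_funP ind_funP !ind_actE.
Qed.

Lemma ind_act1 f : ind_act 1%g f = f.
Proof.
apply: val_inj; rewrite [LHS]ind_actE; last exact: subgroup1.
by apply/funext => x; rewrite mulg1.
Qed.

Lemma ind_actM g h f : carrier H g -> carrier H h ->
  ind_act (g * h)%g f = ind_act g (ind_act h f).
Proof.
move=> Hg Hh; apply: val_inj; rewrite [LHS]ind_actE; last exact: subgroupM.
by rewrite [RHS]ind_actE//; apply/funext => x; rewrite ind_actE// mulgA.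
Qed.

Definition Ind : rep C H := Rep ind_linear ind_act1 ind_actM.

End Induction.

End Representations.

(** * p-adic fields and the Hilbert symbol *)

(* A complete discretely valued field of characteristic 0 with finite residue
   field.  [pval 0] is irrelevant; see [vge]. *)
Record padic_field (F : fieldType) := PadicField {
  pval : F -> int;
  unif : F;
  residues : seq F;
  vge : int -> F -> Prop := fun k x => x = 0 \/ k <= pval x;
  padic_char0 : forall p, p \notin [pchar F];
  unif_neq0 : unif != 0;
  pval_unif : pval unif = 1;
  pvalM : forall x y, x != 0 -> y != 0 -> pval (x * y) = pval x + pval y;
  pvalD : forall k x y, vge k x -> vge k y -> vge k (x + y);
  padic_complete : forall u : nat -> F,
    (forall k, exists N : nat, forall i j : nat, (N <= i)%N -> (N <= j)%N ->
      vge k (u i - u j)) ->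
    exists l, forall k, exists N : nat, forall i : nat, (N <= i)%N ->
      vge k (u i - l);
  residues_uniq : uniq residues;
  residues_int : forall x, x \in residues -> vge 0 x;
  residuesP : forall x, vge 0 x ->
    exists! y, y \in residues /\ vge 1 (x - y) }.

Section HilbertSymbol.
Variables (F : fieldType) (v : padic_field F).

Definition residue_card : nat := size (residues v).

Definition integral_elt (L : splittingFieldType F) (x : L) : Prop :=
  exists p : {poly F},
    [/\ p \is monic, forall i, vge v 0 p`_i & root (map_poly (in_alg L) p) x].

(* unif v remains a uniformizer of L *)
Definition unramified (L : splittingFieldType F) : Prop :=
  forall x : L, integral_elt x ->
    integral_elt x^-1 \/ integral_elt (x / (unif v)%:A).

Definition abelian_ext (L : splittingFieldType F) : Prop :=
  abelian 'Gal({: L} / 1%AS)%g.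

(* theta L a is the norm residue symbol (a, L/F), normalized by the arithmetic
   Frobenius.  By local class field theory these properties determine it for
   a != 0 and L abelian. *)
Definition is_norm_residue
    (theta : forall L : splittingFieldType F, F -> gal_of {: L}) : Prop :=
  [/\ forall (L : splittingFieldType F) a b, abelian_ext L -> a != 0 -> b != 0 ->
        theta L (a * b) = (theta L a * theta L b)%g,
      forall (L : splittingFieldType F) a (x : L), abelian_ext L -> x != 0 ->
        galNorm 1 {: L} x = a%:A -> theta L a = 1%g,
      forall (L L' : splittingFieldType F) (f : {lrmorphism L -> L'}) a x,
        abelian_ext L -> abelian_ext L' -> a != 0 ->
        f (theta L a x) = theta L' a (f x) &
      forall (L : splittingFieldType F) a (x : L), abelian_ext L -> unramified L ->
        a != 0 -> pval v a = 1 -> integral_elt x ->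
        integral_elt ((theta L a x - x ^+ residue_card) / (unif v)%:A)].

(* (a, b)_n = theta(a)(b^(1/n)) / b^(1/n) *)
Definition is_hilbert_symbol (n : nat) (hilb : F -> F -> F) : Prop :=
  [/\ forall a b, a != 0 -> b != 0 -> hilb a b ^+ n = 1,
      forall a b c, a != 0 -> b != 0 -> c != 0 ->
        hilb (a * b) c = hilb a c * hilb b c,
      forall a b c, a != 0 -> b != 0 -> c != 0 ->
        hilb a (b * c) = hilb a b * hilb a c &
      exists2 theta, is_norm_residue theta &
        forall (L : splittingFieldType F) a b (x : L), abelian_ext L ->
          a != 0 -> b != 0 -> x ^+ n = b%:A ->
          theta L a x = hilb a b *: x].

End HilbertSymbol.

(** * Root data *)

(* X and Y are both Z^r, in dual bases. *)
Definition pairing r (x y : 'rV[int]_r) : int := \sum_i x 0 i * y 0 i.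

Record root_datum (r : nat) := RootDatum {
  roots : seq 'rV[int]_r;
  coroot : 'rV[int]_r -> 'rV[int]_r;
  simple_roots : seq 'rV[int]_r;
  coroot_inj : {in roots &, injective coroot};
  root_corootE : forall a, a \in roots -> pairing a (coroot a) = 2;
  root_reflect : forall a b, a \in roots -> b \in roots ->
    b - pairing b (coroot a) *: a \in roots;
  coroot_reflect : forall a b, a \in roots -> b \in roots ->
    coroot b - pairing a (coroot b) *: coroot a \in map coroot roots;
  root_reduced : forall a (k : int), a \in roots -> k *: a \in roots ->
    k = 1 \/ k = -1;
  simple_root : {subset simple_roots <= roots};
  simple_uniq : uniq simple_roots;
  simple_free : forall c : 'rV[int]_r -> int,
    \sum_(a <- simple_roots) c a *: a = 0 -> forall a, a \in simple_roots -> c a = 0;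
  simple_base : forall b, b \in roots ->
    exists c : 'rV[int]_r -> nat,
      b = \sum_(a <- simple_roots) (c a)%:Z *: a \/
      b = - \sum_(a <- simple_roots) (c a)%:Z *: a }.

Section Lattices.
Variables (r : nat) (RD : root_datum r).

Definition root_lattice : set 'rV[int]_r :=
  [set x | exists c : 'rV[int]_r -> int, x = \sum_(a <- roots RD) c a *: a].

Definition coroot_lattice : set 'rV[int]_r :=
  [set y | exists c : 'rV[int]_r -> int,
    y = \sum_(a <- roots RD) c a *: coroot RD a].

(* X / X^sc has a Z-basis, given by the classes of the b i. *)
Definition connected_center : Prop :=
  exists (k : nat) (b : 'I_k -> 'rV[int]_r), forall x,
    exists! c : {ffun 'I_k -> int}, root_lattice (x - \sum_i c i *: b i).

(* Hom(X / X^sc, Z) as a sublattice of Y *)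
Definition central_cochar : set 'rV[int]_r :=
  [set y | forall x, root_lattice x -> pairing x y = 0].

(* cocharacters of the maximal torus of the derived group: the saturation of
   Y^sc in Y *)
Definition derived_cochar : set 'rV[int]_r :=
  [set y | exists2 k : int, k != 0 & coroot_lattice (k *: y)].

Definition bilin (D : 'M[int]_r) (y z : 'rV[int]_r) : int :=
  \sum_i \sum_j D i j * y 0 i * z 0 j.

Definition weyl_invariant (D : 'M[int]_r) : Prop :=
  forall a y, a \in roots RD ->
    let sy := y - pairing a y *: coroot RD a in bilin D sy sy = bilin D y y.

(* a homomorphism Y^sc -> F^*; its values off Y^sc are irrelevant *)
Definition is_coroot_hom (F : fieldType) (eta : 'rV[int]_r -> F) : Prop :=
  (forall y, coroot_lattice y -> eta y != 0) /\
  (forall y z, coroot_lattice y -> coroot_lattice z ->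
    eta (y + z) = eta y * eta z).

End Lattices.

(** * Split reductive groups *)

Section SplitTorus.
Variables (F : fieldType) (r : nat).

(* Y \otimes F^* = (F^* )^r *)
Definition in_torus (t : 'rV[F]_r) : Prop := forall i, t 0 i != 0.
Definition torus_mul (t u : 'rV[F]_r) : 'rV[F]_r := \row_i (t 0 i * u 0 i).
Definition cochar (y : 'rV[int]_r) (a : F) : 'rV[F]_r := \row_i (a ^ y 0 i).
Definition char_eval (x : 'rV[int]_r) (t : 'rV[F]_r) : F :=
  \prod_i t 0 i ^ x 0 i.

Definition weyl_elt (G : groupType) (e : 'rV[int]_r -> F -> G) a (u : F) : G :=
  (e a u * e (- a)%R (- u^-1)%R * e a u)%g.

Definition coroot_elt (G : groupType) (e : 'rV[int]_r -> F -> G) a (u : F) : G :=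
  (weyl_elt e a u * weyl_elt e a (- 1)%R)%g.

End SplitTorus.

(* The F-points of the pinned split reductive group with root datum RD, in the
   Chevalley-Steinberg description: the torus T = Y \otimes F^*, equal to its own
   centralizer, the root subgroups, and their relations.  By Steinberg's
   presentation, and since a normal subgroup meeting T and the root subgroups
   trivially is trivial, RD determines G up to isomorphism (the signs in the
   relations depend only on the choice of the parametrizations xroot). *)
Record split_reductive_group (F : fieldType) (r : nat) (RD : root_datum r) :=
  SplitReductiveGroup {
  points :> groupType;
  tor : 'rV[F]_r -> points;
  xroot : 'rV[int]_r -> F -> points;
  torM : forall t u, in_torus t -> in_torus u ->
    tor (torus_mul t u) = (tor t * tor u)%g;
  tor_inj : forall t, in_torus t -> tor t = 1%g -> t = const_mx 1;
  tor_centralizer : forall g, (forall t, in_torus t -> g * tor t = tor t * g)%g ->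
    exists2 t, in_torus t & g = tor t;
  xrootD : forall a u w, a \in roots RD ->
    xroot a (u + w) = (xroot a u * xroot a w)%g;
  xroot_inj : forall a u, a \in roots RD -> xroot a u = 1%g -> u = 0;
  tor_xroot : forall t a u, in_torus t -> a \in roots RD ->
    (tor t * xroot a u * (tor t)^-1)%g = xroot a (char_eval a t * u);
  xroot_commutator : forall a b, a \in roots RD -> b \in roots RD -> b != - a ->
    exists c : nat -> nat -> int, forall u w,
      (xroot a u * xroot b w * (xroot a u)^-1 * (xroot b w)^-1)%g =
      (\prod_(1 <= i < 4) \prod_(1 <= j < 4 | (a *+ i + b *+ j)%R \in roots RD)
         xroot (a *+ i + b *+ j)%R ((c i j)%:~R * u ^+ i * w ^+ j)%R)%g;
  xroot_coroot : forall a u, a \in roots RD -> u != 0 ->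
    coroot_elt xroot a u = tor (cochar (coroot RD a) u);
  weyl_xroot : forall a b, a \in roots RD -> b \in roots RD ->
    exists s : bool, forall u,
      (weyl_elt xroot a 1%R * xroot b u * (weyl_elt xroot a 1%R)^-1)%g =
      xroot (b - pairing b (coroot RD a) *: a) ((-1) ^+ s * u);
  points_generated : forall g, generated_set
    ([set x | exists2 t, in_torus t & x = tor t] `|`
     [set x | exists a u, a \in roots RD /\ x = xroot a u]) g }.

Section Subgroups_of_G.
Variables (F : fieldType) (r : nat) (RD : root_datum r).
Variable G : split_reductive_group F RD.

Definition torus_set : set G := [set x | exists2 t, in_torus t & x = tor G t].

Lemma tor1 : tor G (const_mx 1) = 1%g.
Proof.
have i1 : in_torus (const_mx 1 : 'rV[F]_r) by move=> i; rewrite mxE oner_eq0.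
have E : torus_mul (const_mx 1) (const_mx 1) = const_mx 1 :> 'rV[F]_r.
  by apply/rowP => i; rewrite !mxE mulr1.
by apply: (mulgI (tor G (const_mx 1))); rewrite -torM// E mulg1.
Qed.

Lemma torus1 : torus_set 1%g.
Proof. by exists (const_mx 1) => [i|]; rewrite ?tor1// mxE oner_eq0. Qed.

Lemma torusM x y : torus_set x -> torus_set y -> torus_set (x * y)%g.
Proof.
move=> [t ht ->] [u hu ->]; exists (torus_mul t u); last by rewrite torM.
by move=> i; rewrite mxE mulf_neq0.
Qed.

Lemma torusV x : torus_set x -> torus_set (x^-1)%g.
Proof.
move=> [t ht ->].
have hV : in_torus (\row_i (t 0 i)^-1) by move=> i; rewrite mxE invr_eq0.
exists (\row_i (t 0 i)^-1) => //; apply: (mulgI (tor G t)).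
rewrite mulgV -torM// -tor1; congr (tor G _).
by apply/rowP => i; rewrite !mxE mulfV.
Qed.

Definition torus : subgroup G := Subgroup torus1 torusM torusV.

(* F-points of the derived group; for non simply connected G_der this is larger
   than the abstract commutator subgroup of G. *)
Definition derived_group : subgroup G := generated
  ([set x | exists y u, [/\ derived_cochar RD y, u != 0 & x = tor G (cochar y u)]]
   `|` [set x | exists a u, a \in roots RD /\ x = xroot G a u]).

(* The Levi subgroups containing T are the centralizers of cocharacters. *)
Definition levi (lam : 'rV[int]_r) : subgroup G := generated
  (torus_set `|`
   [set x | exists a u,
     [/\ a \in roots RD, pairing a lam = 0 & x = xroot G a u]]).

End Subgroups_of_G.

(** * Brylinski-Deligne covers *)

Section Cover.
Variables (F : fieldType) (v : padic_field F) (n : nat) (hilb : F -> F -> F).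
Variables (r : nat) (RD : root_datum r) (G : split_reductive_group F RD).
Variables (D : 'M[int]_r) (eta : 'rV[int]_r -> F).

(* The n-fold cover incarnated by (D, eta): the central extension of G by mu_n
   with a section sec of the torus of cocycle (,)_n^D and with, over each simple
   coroot, bar h_a(u) = (eta(a^vee), u)_n sec(a^vee(u)).  Here xlift is the
   splitting over the root subgroups (unique, since F is divisible). *)
Record bd_cover := BDCover {
  cover :> groupType;
  iota : F -> cover;
  proj : cover -> G;
  sec : 'rV[F]_r -> cover;
  xlift : 'rV[int]_r -> F -> cover;
  iotaM : forall z w, z ^+ n = 1 -> w ^+ n = 1 ->
    iota (z * w) = (iota z * iota w)%g;
  iota_inj : forall z, z ^+ n = 1 -> iota z = 1%g -> z = 1;
  iota_central : forall z x, z ^+ n = 1 -> (iota z * x = x * iota z)%g;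
  projM : {morph proj : x y / (x * y)%g};
  proj_surj : forall g, exists x, proj x = g;
  proj_ker : forall x, proj x = 1%g <-> exists2 z, z ^+ n = 1 & x = iota z;
  proj_sec : forall t, in_torus t -> proj (sec t) = tor G t;
  secM : forall t u, in_torus t -> in_torus u ->
    (sec t * sec u)%g =
    (sec (torus_mul t u) *
       iota (\prod_i \prod_j hilb (t 0 i) (u 0 j) ^ D i j)%R)%g;
  proj_xlift : forall a u, a \in roots RD -> proj (xlift a u) = xroot G a u;
  xliftD : forall a u w, a \in roots RD ->
    xlift a (u + w) = (xlift a u * xlift a w)%g;
  coroot_xlift : forall a u, a \in simple_roots RD -> u != 0 ->
    coroot_elt xlift a u =
    (iota (hilb (eta (coroot RD a)) u) * sec (cochar (coroot RD a) u))%g }.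

Variable Gb : bd_cover.

Definition preim (H : subgroup G) : subgroup Gb := preim_subgroup (@projM Gb) H.

Definition congruence_set (m : nat) : subgroup Gb := generated
  ([set x | exists a u, [/\ a \in roots RD, vge v m.+1%:Z u & x = xlift Gb a u]]
   `|`
   [set x | exists t, [/\ in_torus t, forall i, vge v m.+1%:Z (t 0 i - 1) &
                          x = sec Gb t]]).

(* Finite intersections of conjugates of the congruence_set m: this is the
   coarsest group topology for which these subgroups are open, i.e. the locally
   profinite topology of the cover. *)
Definition cover_nbhd1 : set (set Gb) :=
  [set N | exists s : seq (Gb * nat),
    N = [set x | forall gm, gm \in s ->
           carrier (congruence_set gm.2) (gm.1^-1 * x * gm.1)%g]].

Lemma cover_nbhd1T : cover_nbhd1 setT.
Proof. by exists [::]; apply/seteqP; split. Qed.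

Lemma cover_nbhd1I U V : cover_nbhd1 U -> cover_nbhd1 V -> cover_nbhd1 (U `&` V).
Proof.
move=> [s ->] [s' ->]; exists (s ++ s'); apply/seteqP; split=> x /=.
  by move=> [xs xs'] gm; rewrite mem_cat => /orP[/xs|/xs'].
by move=> xs; split=> gm gms; apply: xs; rewrite mem_cat gms ?orbT.
Qed.

Lemma cover_nbhd1J U g : cover_nbhd1 U -> cover_nbhd1 [set x | U (g^-1 * x * g)%g].
Proof.
move=> [s ->]; exists [seq ((g * gm.1)%g, gm.2) | gm <- s].
apply/seteqP; split=> x /= xs gm.
  move=> /mapP[gm' gms ->] /=; rewrite invgM !mulgA.
  by have := xs _ gms; rewrite !mulgA.
move=> gms; have := xs _ (map_f _ gms).
by rewrite /= invgM !mulgA.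
Qed.

Definition cover_topology : group_topology Gb :=
  GroupTopology cover_nbhd1T cover_nbhd1I cover_nbhd1J.

Definition center_bar : set Gb := @proj Gb @^-1` center [set: G].
Definition torus_bar : subgroup Gb := preim (torus G).
Definition torus0_bar : set Gb := @proj Gb @^-1` (torus G `&` derived_group G).
Definition torus_dag : set Gb := setmul center_bar torus0_bar.

Section Levi.
Variable lam : 'rV[int]_r.
Definition levi_bar : subgroup Gb := preim (levi G lam).
Definition levi0_bar : set Gb := @proj Gb @^-1` (levi G lam `&` derived_group G).
Definition levi_dag : set Gb := setmul center_bar levi0_bar.
End Levi.

Lemma torus_dag_sub : torus_dag `<=` torus_bar.
Proof.
move=> x [z [t [zc [Tt _] ->]]].
suff Tz : torus_set (proj z) by rewrite /= /preimage /= projM; exact: torusM.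
by apply: tor_centralizer => u _; case: zc => _; apply.
Qed.

Section Genuine.
Variables (C : fieldType) (eps : F -> C).

Definition is_mu_embedding : Prop :=
  [/\ eps 1 = 1,
      forall z w, z ^+ n = 1 -> w ^+ n = 1 -> eps (z * w) = eps z * eps w &
      forall z w, z ^+ n = 1 -> w ^+ n = 1 -> eps z = eps w -> z = w].

Definition genuine (H : set Gb) (pi : rep C H) : Prop :=
  forall z (x : pi), z ^+ n = 1 -> rep_act pi (iota Gb z) x = eps z *: x.

Definition irr_gen (H : set Gb) (pi : rep C H) : Prop :=
  [/\ irreducible pi, admissible cover_topology pi & genuine pi].

(* chi_g(h) = [g^-1, h] = g^-1 h g h^-1, when this lies in mu_n *)
Definition chi (g h : Gb) : C :=
  eps (xget 1 [set z | z ^+ n = 1 /\ iota Gb z = (g^-1 * h * g * h^-1)%g]).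

(* Hom(A / B, C^* ), as functions on A; two of them are identified when they
   agree on A. *)
Definition quotient_char (A B : set Gb) (f : Gb -> C) : Prop :=
  (forall x y, A x -> A y -> f (x * y)%g = f x * f y) /\
  (forall x, B x -> f x = 1).

(* The action f |-> f chi_g of Q^dag = torus_bar / torus_dag on Hom(A / B, C^* ) *)
Definition free_action (A B : set Gb) : Prop :=
  forall g f, carrier torus_bar g -> quotient_char A B f ->
    (forall x, A x -> f x * chi g x = f x) -> torus_dag g.

Definition trivial_action (A B : set Gb) : Prop :=
  forall g f, carrier torus_bar g -> quotient_char A B f ->
    forall x, A x -> f x * chi g x = f x.

Definition free_on_QZ : Prop :=
  free_action (center center_bar) (center [set: Gb]).

Definition trivial_on_QZ : Prop :=
  trivial_action (center center_bar) (center [set: Gb]).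

Definition free_on_QM0 (lam : 'rV[int]_r) : Prop :=
  free_action (center (levi0_bar lam))
    (levi0_bar lam `&` center (levi_bar lam)).

Definition trivial_on_QT0 : Prop :=
  trivial_action (center torus0_bar) (torus0_bar `&` center torus_bar).

End Genuine.

End Cover.

Arguments center_bar {F n hilb r RD G D eta} Gb _.
Arguments torus0_bar {F n hilb r RD G D eta} Gb _.
Arguments torus_dag {F n hilb r RD G D eta} Gb _.
Arguments levi0_bar {F n hilb r RD G D eta} Gb lam _.
Arguments levi_dag {F n hilb r RD G D eta} Gb lam _.
Arguments torus_dag_sub {F n hilb r RD G D eta} Gb t _.

(* Main.v *)
From HB Require Import structures.
From mathcomp Require Import all_boot all_order all_algebra all_fingroup all_field.
From mathcomp Require Import complex ring zify.
From mathcomp Require Import boolp classical_sets reals.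
Require Import Defs.

Set Implicit Arguments.
Unset Strict Implicit.
Unset Printing Implicit Defensive.

Import Order.TTheory GRing.Theory Num.Theory.

Local Open Scope classical_set_scope.
Local Open Scope ring_scope.

(** Write Z for the preimage of the centre of G in the cover, M_0 and T_0 for
    the preimages of the intersections of the Levi subgroup and of T with the
    derived group, and K = Z M_0.  Everything rests on two facts: commutators of
    elements whose images in G commute lie in mu_n, so that a genuine
    representation turns them into scalars; and K is an open normal subgroup of
    finite index.

    Openness and finite index come from root data: some d >= 1 carries Y into
    Y_c + Y_0 ([central_derived_index]), so K contains the d-th powers of T, while d-th powers have finite index in the
    multiplicative group of F and contain a neighbourhood of 1
    ([power_classes_finite], [hensel_power]).  As G = T G_0, every coset of K is
    represented in the preimage of T.

    Irreducibility of the induced representation is Mackey's criterion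
    ([mackey_irreducible]).  By Schur's lemma the centre A of Z, or of M_0, acts
    on sigma by scalars, and conjugation by t multiplies these scalars by a
    character of A.  Freeness of the action, tested at the trivial character,
    says that this character is nontrivial when t is not in K; so A separates the
    conjugates of sigma, whose sum is the restriction of the induced
    representation to K.

    For the torus, all representations in sight are finite-dimensional, since
    n-th powers are central and have finite index.  The tool is the theorem of
    Stone and von Neumann ([isotypic]): over a group L with scalar commutators
    and L/Z(L) finite, a finite-dimensional representation on which Z(L) acts by
    a character is a multiple of any irreducible representation with that central
    character.  The proof averages linear maps over L/Z(L); orthogonality of the
    commutator characters shows that the resulting intertwiners separate vectors.
    If the actions are trivial, Z(K) lies in the centre of the preimage of T and
    acts on pi by scalars, so that pi restricted to K is a multiple of some
    sigma; applied once more, to the restriction of sigma to Z, the theorem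
    factors sigma as a tensor product ([tensor_factor]).  If conversely the
    centre of the preimage of T lies in Z(Z) Z(T_0), it acts by scalars on sigma,
    hence on the induced representation.

    The tensor factorization needs Z and T_0 to commute.  By Weyl invariance
    B_Q(-, a^v) = Q(a^v) a for a root a, so that B_Q(-, y) lies in the root
    lattice for y in Y_0, because X/X^sc is torsion-free, and roots are trivial on
    the centre.  That the commutator pairing is given by B_Q uses the
    skew-symmetry of the Hilbert symbol ([hilbert_skew]), which is where local
    class field theory enters: -b is a norm from F(b^(1/n)). *)

(** * Finite-dimensional vector spaces *)

Section LinearFacts.
Variables (R : pzRingType) (V W : lmodType R) (f : V -> W).
Hypothesis f_lin : linear f.

Lemma lin0 : f 0 = 0.
Proof.
have := f_lin 1 0 0; rewrite scale1r addr0 => /eqP.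
by rewrite scale1r -subr_eq0 opprD addNKr oppr_eq0 => /eqP.
Qed.

Lemma linD u v : f (u + v) = f u + f v.
Proof. by have := f_lin 1 u v; rewrite !scale1r. Qed.

Lemma linZ c u : f (c *: u) = c *: f u.
Proof. by have := f_lin c u 0; rewrite lin0 !addr0. Qed.

Lemma linN u : f (- u) = - f u.
Proof. by rewrite -scaleN1r linZ scaleN1r. Qed.

Lemma linB u v : f (u - v) = f u - f v.
Proof. by rewrite linD linN. Qed.

Lemma lin_sum (I : Type) (s : seq I) (P : pred I) (F : I -> V) :
  f (\sum_(i <- s | P i) F i) = \sum_(i <- s | P i) f (F i).
Proof. by apply: (big_morph f linD lin0). Qed.

Lemma lin_injP : (forall v, f v = 0 -> v = 0) -> injective f.
Proof.
by move=> h u v /eqP; rewrite -subr_eq0 -linB => /eqP/h/eqP; rewrite subr_eq0 => /eqP.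
Qed.

End LinearFacts.

Section FiniteDimension.
Variable C : fieldType.

Definition submodule_set (V : lmodType C) (S : set V) : Prop :=
  S 0 /\ forall (c : C) u v, S u -> S v -> S (c *: u + v).

Definition fin_dim (V : lmodType C) : Prop :=
  exists (m : nat) (f : V -> 'rV[C]_m), linear f /\ injective f.

Section LinearSubmodules.
Variables (V W : lmodType C) (f : V -> W).
Hypothesis f_lin : linear f.

Lemma submodule_image (S : set V) : submodule_set S ->
  submodule_set [set w | exists2 v, S v & w = f v].
Proof.
move=> [S0 SD]; split; first by exists 0; rewrite ?lin0.
by move=> c _ _ [u Su ->] [v Sv ->]; exists (c *: u + v); [exact: SD|rewrite f_lin].
Qed.

Lemma submodule_kernel : submodule_set [set v | f v = 0].
Proof.
split; first exact: lin0.
by move=> c u v /= fu fv; rewrite f_lin fu fv scaler0 addr0.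
Qed.

End LinearSubmodules.

Lemma submodule_sum (V : lmodType C) (S : set V) (I : Type) (s : seq I)
    (P : pred I) (F : I -> V) :
  submodule_set S -> (forall i, P i -> S (F i)) -> S (\sum_(i <- s | P i) F i).
Proof.
move=> [S0 SD] SF; elim/big_ind : _ => // u v Su Sv.
by rewrite -[u]scale1r; exact: SD.
Qed.

Lemma submoduleZ (V : lmodType C) (S : set V) c v :
  submodule_set S -> S v -> S (c *: v).
Proof. by move=> [S0 SD] Sv; rewrite -[X in S X]addr0; exact: SD. Qed.

Lemma submoduleD (V : lmodType C) (S : set V) u v :
  submodule_set S -> S u -> S v -> S (u + v).
Proof. by move=> [S0 SD] Su Sv; rewrite -[u]scale1r; exact: SD. Qed.

(** The subspace of maximal dimension among those contained in S; it gives a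
    dimension to invariant subspaces, which are only sets. *)
Lemma submodule_vspace (vT : vectType C) (S : set vT) : submodule_set S ->
  exists U : {vspace vT}, forall v, S v <-> v \in U.
Proof.
move=> Ssub; have [S0 _] := Ssub.
pose P k := `[< exists2 U : {vspace vT}, (forall v, v \in U -> S v) & \dim U = k >].
have exP : exists k, P k.
  exists 0%N; apply/asboolP; exists 0%VS; rewrite ?dimv0// => v.
  by rewrite memv0 => /eqP ->.
have ubP k : P k -> (k <= \dim {:vT})%N.
  by move=> /asboolP[U _ <-]; apply: dimvS; exact: subvf.
case: (ex_maxnP exP ubP) => k /asboolP[U US dimU] kmax.
exists U => v; split=> [Sv|]; last exact: US.
apply: contrapT => /negP vU.
have : (\dim (U + <[v]>) <= k)%N.
  apply: kmax; apply/asboolP; exists (U + <[v]>)%VS => // w.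
  move=> /memv_addP[u uU [_ /vlineP[c ->] ->]].
  by apply: submoduleD => //; [exact: US|exact: submoduleZ].
rewrite -dimU => h; move: vU.
have /eqP -> : (U == U + <[v]>)%VS by rewrite eqEdim addvSl.
by rewrite (subvP (addvSr U _))// memv_line.
Qed.

Lemma fin_dim_vect (V : lmodType C) (vT : vectType C) (f : V -> vT) :
  linear f -> injective f -> fin_dim V.
Proof.
move=> f_lin f_inj; pose x := vbasis {: vT}.
exists (\dim {: vT}), (fun v => \row_i coord x i (f v)); split.
  by move=> c u v; apply/rowP => i; rewrite !mxE f_lin linearP.
move=> u v uv; apply: f_inj; rewrite [LHS](coord_vbasis (memvf _)).
rewrite [RHS](coord_vbasis (memvf _)); apply: eq_bigr => i _; congr (_ *: _).
by have := congr1 (fun y : 'rV_ _ => y 0 i) uv; rewrite !mxE.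
Qed.

Lemma fin_dim_span (V : lmodType C) : fin_dim V ->
  exists (d : nat) (b : 'I_d -> V), forall v, exists c : 'I_d -> C,
    v = \sum_i c i *: b i.
Proof.
move=> [m [f [f_lin f_inj]]].
have [|U hU] := @submodule_vspace _ [set w | exists2 v, setT v & w = f v].
  exact: submodule_image.
have bU (i : 'I_(\dim U)) : exists v, f v = (vbasis U)`_i.
  have /hU[v _ ->] : (vbasis U)`_i \in U; last by exists v.
  by apply: vbasis_mem; rewrite mem_nth ?size_tuple.
have [b hb] := choice bU.
exists (\dim U), b => v; exists (fun i => coord (vbasis U) i (f v)).
apply: f_inj; rewrite lin_sum// [LHS](@coord_vbasis _ _ _ U).
  by apply: eq_bigr => i _; rewrite linZ// hb.
by apply/hU; exists v.
Qed.

Lemma span_fin_dim (V : lmodType C) (d : nat) (b : 'I_d -> V) :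
  (forall v, exists c : 'I_d -> C, v = \sum_i c i *: b i) -> fin_dim V.
Proof.
move=> hb.
pose g (c : 'rV[C]_d) := \sum_i c 0 i *: b i.
have g_lin : linear g.
  move=> a u v; rewrite /g scaler_sumr -big_split; apply: eq_bigr => i _.
  by rewrite !mxE scalerDl scalerA.
have [U hU] := submodule_vspace (submodule_kernel g_lin).
have gsurj v : exists c, g c = v.
  have [c ->] := hb v; exists (\row_i c i).
  by apply: eq_bigr => i _; rewrite mxE.
have [h hK] := choice gsurj.
(* the section h of g is linear up to the kernel U, which is projected away *)
pose p x := x - projv U x.
have p_lin : linear p by move=> c x y; rewrite /p linearP/= scalerBr opprD addrACA.
have p0 x : x \in U -> p x = 0 by move=> /projv_id xU; rewrite /p xU subrr.
have ph_lin : linear (p \o h).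
  move=> c u v /=; apply/eqP; rewrite -subr_eq0 -p_lin -(linB p_lin); apply/eqP.
  by apply: p0; apply/hU => /=; rewrite linB// g_lin !hK subrr.
exists d, (p \o h); split => //; apply: (lin_injP ph_lin) => v /eqP /=.
rewrite subr_eq0 => /eqP hv; have : h v \in U by rewrite hv memv_proj.
by move/hU => /=; rewrite hK.
Qed.

End FiniteDimension.

(** * Eigenvectors *)

Section Eigenvectors.
Variables (C : closedFieldType) (V : lmodType C) (T : V -> V).
Hypothesis T_lin : linear T.
Variable v : V.

Let ev (N : nat) (p : {poly C}) := \sum_(k < N) p`_k *: iter k T v.

Let ev_widen N (p : {poly C}) : (size p <= N)%N -> ev N p = ev (size p) p.
Proof.
move=> pN; rewrite /ev (big_ord_widen N (fun k => p`_k *: iter k T v) pN).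
rewrite [LHS](bigID (fun k : 'I_N => (k < size p)%N)) /=.
rewrite [X in _ + X]big1 ?addr0// => k; rewrite -leqNgt => /(nth_default 0) ->.
by rewrite scale0r.
Qed.

Let ev_XsubC (q : {poly C}) a :
  ev (size q).+1 (q * ('X - a%:P)) = T (ev (size q) q) - a *: ev (size q) q.
Proof.
pose N := size q; have qN : q`_N = 0 by rewrite nth_default.
transitivity (\sum_(k < N.+1) (q * 'X)`_k *: iter k T v -
              \sum_(k < N.+1) (a * q`_k) *: iter k T v).
  rewrite -sumrB; apply: eq_bigr => k _.
  by rewrite -scalerBl mulrBr coefB coefMC [q`_k * a]mulrC.
congr (_ - _); last first.
  rewrite big_ord_recr /= qN mulr0 scale0r addr0 scaler_sumr.
  by apply: eq_bigr => k _; rewrite scalerA.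
rewrite big_ord_recl /= coefMX eqxx scale0r add0r /ev lin_sum//.
by apply: eq_bigr => k _; rewrite coefMX linZ.
Qed.

(** A linear relation among the iterates of v is a polynomial p with p(T)v = 0;
    splitting off a root from such a p of minimal degree leaves an
    eigenvector. *)
Lemma eigenvector_of_span (d : nat) (b : 'I_d -> V) : v <> 0 ->
  (forall k, exists c : 'I_d -> C, iter k T v = \sum_i c i *: b i) ->
  exists (a : C) (w : V), w <> 0 /\ T w = a *: w.
Proof.
move=> v0 hb; have [c hc] := choice hb.
pose P n := `[< exists p : {poly C}, [/\ p != 0, size p = n & ev n p = 0] >].
have exP : exists n, P n.
  pose M : 'M[C]_(d.+1, d) := \matrix_(k, i) c k i.
  have : kermx M != 0.
    by rewrite kermx_eq0 /row_free neq_ltn ltnS rank_leq_col.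
  case/rowV0Pn => u /sub_kermxP uM u0.
  pose p := \poly_(k < d.+1) u 0 (inord k).
  have p0 : p != 0.
    apply: contra u0 => /eqP p0; apply/eqP/rowP => k.
    have := congr1 (fun q : {poly C} => q`_k) p0.
    by rewrite coef_poly ltn_ord inord_val coef0 mxE.
  exists (size p); apply/asboolP; exists p; split=> //.
  rewrite -(@ev_widen d.+1) ?size_poly// /ev.
  transitivity (\sum_i (u *m M) 0 i *: b i).
    under eq_bigr => k _ do rewrite coef_poly ltn_ord inord_val hc scaler_sumr.
    rewrite exchange_big; apply: eq_bigr => i _ /=; rewrite mxE scaler_suml.
    by apply: eq_bigr => k _; rewrite mxE scalerA.
  by rewrite uM big1// => i _; rewrite mxE scale0r.
case: (ex_minnP exP) => n /asboolP[p [p0 sp evp]] nmin.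
have sp1 : size p != 1%N.
  apply/negP => /eqP sp1; move: evp; rewrite -sp sp1 /ev big_ord1 /= => /eqP.
  rewrite scaler_eq0 => /orP[/eqP h|/eqP//]; move: p0.
  by rewrite -lead_coef_eq0 lead_coefE sp1 h eqxx.
have [a /factor_theorem[q pE]] := closed_rootP p sp1.
have q0 : q != 0 by apply: contraNneq p0 => q0; rewrite pE q0 mul0r.
have spq : size p = (size q).+1.
  by rewrite pE size_Mmonic ?monicXsubC// size_XsubC addn2.
exists a, (ev (size q) q); split.
  move=> evq; have := nmin (size q); rewrite -sp spq ltnn => h.
  suff : false by []. apply: h. by apply/asboolP; exists q.
by apply/eqP; rewrite -subr_eq0 -ev_XsubC -pE -spq sp evp.
Qed.

End Eigenvectors.

(** * Schur's lemma *)

Section RepBasics.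
Variables (C : fieldType) (G : groupType) (L : subgroup G) (pi : rep C L).

Lemma rep_act0 g : carrier L g -> rep_act pi g 0 = 0.
Proof. by move=> Lg; apply: lin0; exact: rep_linear. Qed.

Lemma rep_actZ g c v : carrier L g -> rep_act pi g (c *: v) = c *: rep_act pi g v.
Proof. by move=> Lg; apply: linZ; exact: rep_linear. Qed.

Lemma rep_actVK g v : carrier L g -> rep_act pi (g^-1)%g (rep_act pi g v) = v.
Proof.
by move=> Lg; rewrite -rep_actM ?mulVg ?rep_act1//; exact: subgroupV.
Qed.

Lemma rep_actKV g v : carrier L g -> rep_act pi g (rep_act pi (g^-1)%g v) = v.
Proof.
by move=> Lg; rewrite -rep_actM ?mulgV ?rep_act1//; exact: subgroupV.
Qed.

Definition invariant (S : set pi) : Prop :=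
  forall h v, carrier L h -> S v -> S (rep_act pi h v).

Lemma irreducible_full (S : set pi) : irreducible pi -> submodule_set S ->
  invariant S -> (exists2 v, S v & v <> 0) -> forall v, S v.
Proof.
move=> [_ irr] [S0 SD] Sinv [v Sv v0].
by have [h|//] := irr S S0 SD Sinv; case: v0; exact: h.
Qed.

Lemma irreducible_eigen (T : pi -> pi) a w : irreducible pi -> linear T ->
  (forall h v, carrier L h -> T (rep_act pi h v) = rep_act pi h (T v)) ->
  w <> 0 -> T w = a *: w -> forall v, T v = a *: v.
Proof.
move=> irr T_lin TL w0 Tw.
apply: (irreducible_full (S := [set v | T v = a *: v]) irr) => /=.
- split; first by rewrite /= lin0// scaler0.
  move=> c u v /= Tu Tv.
  by rewrite T_lin Tu Tv scalerDr !scalerA mulrC.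
- by move=> h v Lh /= Tv; rewrite TL// Tv rep_actZ.
- by exists w.
Qed.

End RepBasics.

Section Schur.
Variables (C : closedFieldType) (G : groupType) (L : subgroup G).
Variables (pi : rep C L) (T : pi -> pi).
Hypothesis irr : irreducible pi.
Hypothesis T_lin : linear T.
Hypothesis TL : forall h v, carrier L h -> T (rep_act pi h v) = rep_act pi h (T v).

(** Schur's lemma for admissible representations: an intertwining operator
    preserves the finite-dimensional space of vectors fixed by the (open)
    stabilizer of a vector. *)
Lemma schur_admissible (top : group_topology G) :
  admissible top pi -> exists a, forall v, T v = a *: v.
Proof.
move=> [sm adm]; have [[v v0] _] := irr; have [N nN Nv] := sm v.
pose U := [set h | carrier L h /\ rep_act pi h v = v].
have U1 : U 1%g by split; [exact: subgroup1|rewrite rep_act1].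
have UM x y : U x -> U y -> U (x * y)%g.
  by move=> [Lx xv] [Ly yv]; split; [exact: subgroupM|rewrite rep_actM// yv].
have UV x : U x -> U (x^-1)%g.
  move=> [Lx xv]; split; first exact: subgroupV.
  by rewrite -[v in LHS]xv rep_actVK.
have [|| d [b hb]] := adm (Subgroup U1 UM UV); first by move=> x [].
  by exists N => // x [Lx Nx]; split=> //; exact: Nv.
have [|a [w [w0 Tw]]] := @eigenvector_of_span _ _ T T_lin v d b v0.
  move=> k; apply: hb => u [Lu uv].
  by elim: k => [//|k IH]; rewrite !iterS -TL// IH.
by exists a; exact: (irreducible_eigen irr T_lin TL w0 Tw).
Qed.

Lemma schur_fin_dim : fin_dim pi -> exists a, forall v, T v = a *: v.
Proof.
move=> /fin_dim_span[d [b hb]]; have [[v v0] _] := irr.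
have [//|a [w [w0 Tw]]] := @eigenvector_of_span _ _ T T_lin v d b v0.
by exists a; exact: (irreducible_eigen irr T_lin TL w0 Tw).
Qed.

End Schur.

Lemma center_scalar (C : closedFieldType) (G : groupType) (L : subgroup G)
    (pi : rep C L) (top : group_topology G) (z : G) :
  irreducible pi -> admissible top pi -> center L z ->
  exists a, forall v, rep_act pi z v = a *: v.
Proof.
move=> irr adm [Lz zL]; apply: (schur_admissible irr _ _ adm).
  exact: rep_linear.
by move=> h v Lh; rewrite -!rep_actM// zL.
Qed.

(** * Irreducible subrepresentations *)

Section SubRep.
Variables (C : fieldType) (G : groupType) (L : subgroup G) (pi : rep C L).
Hypothesis pi_fd : fin_dim pi.

(** An invariant subspace of minimal dimension, realized as a representation
    on a subspace of coordinate vectors. *)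
Lemma irreducible_sub : (exists v : pi, v <> 0) ->
  exists (W : rep C L) (j : W -> pi),
    [/\ irreducible W, fin_dim W, linear j, injective j &
        forall h w, carrier L h -> j (rep_act W h w) = rep_act pi h (j w)].
Proof.
move=> [v0 v00]; have [m [f [f_lin f_inj]]] := pi_fd.
have f0 : f 0 = 0 by rewrite lin0.
pose im (U : {vspace _}) := forall x, x \in U -> exists v, f v = x.
pose inv (U : {vspace 'rV[C]_m}) :=
  forall h v, carrier L h -> f v \in U -> f (rep_act pi h v) \in U.
pose P k := `[< exists U : {vspace 'rV[C]_m},
  [/\ im U, inv U, U != 0%VS & \dim U = k] >].
have vs (S : set pi) : submodule_set S -> invariant S ->
    exists U : {vspace 'rV[C]_m}, [/\ im U, inv U & forall v, S v <-> f v \in U].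
  move=> Ssub Sinv; have [U hU] := submodule_vspace (submodule_image f_lin Ssub).
  have SU v : S v <-> f v \in U.
    split=> [Sv|/hU[w Sw /f_inj ->]//]; by apply/hU; exists v.
  exists U; split=> //; first by move=> x /hU[v _ ->]; exists v.
  by move=> h v Lh /SU Sv; apply/SU; exact: Sinv.
have exP : exists k, P k.
  have [||U [imU invU SU]] := vs setT; [by split|by []|].
  exists (\dim U); apply/asboolP; exists U; split=> //.
  apply/negP => /eqP U0; have /SU : setT v0 by [].
  by rewrite U0 memv0 -f0 => /eqP/f_inj.
case: (ex_minnP exP) => k /asboolP[U [imU invU U0 dimU]] kmin.
have jP (w : subvs_of U) : exists v, f v = vsval w by apply: imU; exact: subvsP.
have [j fj] := choice jP.
have jE w : j (vsproj U (f (j w))) = j w.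
  by congr j; rewrite fj vsvalK.
have j_lin : linear j.
  by move=> c u v; apply: f_inj; rewrite f_lin !fj linearP.
have j_inj : injective j.
  by move=> u v /(congr1 f); rewrite !fj => /val_inj.
have jproj v : f v \in U -> j (vsproj U (f v)) = v.
  by move=> Uv; apply: f_inj; rewrite fj vsprojK.
pose act g w := vsproj U (f (rep_act pi g (j w))).
have jact h w : carrier L h -> j (act h w) = rep_act pi h (j w).
  by move=> Lh; rewrite /act jproj//; apply: invU => //; rewrite fj subvsP.
have act_lin g : carrier L g -> linear (act g).
  by move=> Lg c u v; rewrite /act j_lin rep_linear// f_lin linearP.
have act1 w : act 1%g w = w by rewrite /act rep_act1 fj vsvalK.
have actM g h w : carrier L g -> carrier L h -> act (g * h)%g w = act g (act h w).
  by move=> Lg Lh; rewrite {1 2}/act jact// rep_actM.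
exists (Rep act_lin act1 actM), j; split=> //.
- split.
    exists (vsproj U (vpick U)) => /(congr1 vsval).
    by rewrite vsprojK ?memv_pick// linear0 => /eqP; rewrite vpick0 (negPf U0).
  move=> S S0 SD Sinv.
  have [||U' [imU' invU' SU']] := vs [set v | exists2 w, S w & v = j w].
  + exact: (submodule_image j_lin (conj S0 SD)).
  + by move=> h _ Lh [w Sw ->]; exists (act h w); rewrite ?jact//; exact: Sinv.
  have U'U : (U' <= U)%VS.
    apply/subvP => x xU'; have [v vx] := imU' x xU'; move: xU'; rewrite -vx.
    by move=> /SU'[w _ ->]; rewrite fj subvsP.
  have [U'0|U'0] := eqVneq U' 0%VS; [left|right] => w => [Sw|].
    have /SU' : exists2 w', S w' & j w = j w' by exists w.
    rewrite U'0 memv0 -f0 => /eqP/f_inj jw0.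
    by apply: j_inj; rewrite jw0 lin0.
  have : (k <= \dim U')%N by apply: kmin; apply/asboolP; exists U'.
  rewrite -dimU => dU'; have U'E : U' = U.
    by apply/eqP; rewrite eqEdim U'U.
  have /SU'[w' Sw' /j_inj ->//] : f (j w) \in U' by rewrite U'E fj subvsP.
- exists m, (f \o j); split; first by move=> c u v /=; rewrite j_lin f_lin.
  exact: inj_comp.
Qed.

End SubRep.

(** * Averaging over the cosets of a subgroup of finite index *)

(** Labels, rather than a count of cosets, so that the property restricts to
    subgroups of L and can be read off from coordinates. *)
Definition fin_index (G : groupType) (L Z : set G) : Prop :=
  exists (I : finType) (cl : G -> I), forall x y, L x -> L y -> cl x = cl y ->
    Z (x^-1 * y)%g.

Definition transversal (G : groupType) (L Z : set G) (I : finType) (s : I -> G) :=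
  (forall i, L (s i)) /\ forall x, L x -> exists! i, Z ((s i)^-1 * x)%g.

Section Cosets.
Variables (G : groupType) (L Z : subgroup G).

Lemma subgroupVE x : carrier L (x^-1)%g -> carrier L x.
Proof. by move=> /subgroupV; rewrite invgK. Qed.

Lemma fin_index_transversal : fin_index L Z ->
  (forall x, carrier Z x -> carrier L x) ->
  exists (I : finType) (s : I -> G), transversal L Z s.
Proof.
move=> [I [cl hcl]] ZL.
(* r x is a representative depending only on the coset of x *)
pose coset x := [set y | carrier L y /\ carrier Z (x^-1 * y)%g].
pose r x := xget 1%g (coset x).
have coset_refl x : carrier L x -> coset x x.
  by move=> Lx; split; rewrite // mulVg; exact: subgroup1.
have rP x : carrier L x -> coset x (r x).
  by move=> Lx; rewrite /r; case: xgetP => [y -> //|/(_ x)/(_ (coset_refl x Lx))].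
have r_eq x y : carrier L x -> carrier Z (x^-1 * y)%g -> r x = r y.
  move=> Lx Zxy; rewrite /r; congr xget; apply/seteqP; split=> z [Lz Zz]; split=> //.
    have -> : (y^-1 * z = (x^-1 * y)^-1 * (x^-1 * z))%g.
      by rewrite invgM invgK !mulgA mulgK.
    by apply: subgroupM => //; exact: subgroupV.
  have -> : (x^-1 * z = (x^-1 * y) * (y^-1 * z))%g by rewrite !mulgA mulgK.
  exact: subgroupM.
pose t i := xget 1%g [set x | carrier L x /\ cl x = i].
have Lt i : carrier L (t i).
  by rewrite /t; case: xgetP => [x _ []//|_]; exact: subgroup1.
pose l := [seq r (t i) | i <- enum I].
have lP x : x \in l -> exists2 y, carrier L y & x = r y.
  by move=> /mapP[i _ ->]; exists (t i).
have rl x : carrier L x -> r x \in l.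
  move=> Lx; have [Lt' clt] : carrier L (t (cl x)) /\ cl (t (cl x)) = cl x.
    by rewrite /t; case: xgetP => [y -> //|/(_ x)/(_ (conj Lx erefl))].
  apply/mapP; exists (cl x); rewrite ?mem_enum//.
  by apply: r_eq => //; exact: hcl.
exists (seq_sub l : finType), (fun i : seq_sub l => ssval i); split.
  by move=> i; have [y Ly ->] := lP _ (ssvalP i); case: (rP y Ly).
move=> x Lx; exists (SeqSub (rl x Lx)); split=> /=.
  have [Lr Zr] := rP x Lx; have -> : ((r x)^-1 * x = (x^-1 * r x)^-1)%g.
    by rewrite invgM invgK.
  exact: subgroupV.
move=> i; have [y Ly iE] := lP _ (ssvalP i); rewrite iE => Zi; apply: val_inj => /=.
have [Lry Zry] := rP y Ly.
by rewrite iE (r_eq y (r y))//; apply/esym; exact: r_eq.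
Qed.

Variables (I : finType) (s : I -> G).
Hypothesis tr : transversal L Z s.

Lemma coset_sum_translate (V : nmodType) (F : G -> V) y :
  (forall g z, carrier L g -> carrier Z z -> F (g * z)%g = F g) ->
  carrier L y -> \sum_i F (y * s i)%g = \sum_i F (s i).
Proof.
move=> FZ Ly; have [Ls sP] := tr.
have Lys i : carrier L (y * s i)%g by exact: subgroupM.
have [p hp] := choice (fun i => sP _ (Lys i)).
have p_inj : injective p.
  move=> i j pij; have [Zi _] := hp i; have [Zj _] := hp j.
  have [k [_ kmin]] := sP (s i) (Ls i).
  have ki : k = i by apply: kmin; rewrite mulVg; exact: subgroup1.
  rewrite -ki; apply: kmin.
  have -> : ((s j)^-1 * s i =
      ((s (p j))^-1 * (y * s j))^-1 * ((s (p i))^-1 * (y * s i)))%g.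
    by rewrite pij !invgM !invgK !mulgA mulgK mulgKV.
  by apply: subgroupM => //; exact: subgroupV.
rewrite [RHS](reindex_inj p_inj) /=; apply: eq_bigr => i _.
have [Zi _] := hp i; rewrite -[RHS](FZ _ _ _ Zi)//.
by rewrite mulgA mulgV mul1g.
Qed.

End Cosets.

(** * Isotypic decomposition of Heisenberg-type representations *)

Section Isotypic.
Variables (C : numClosedFieldType) (G : groupType) (L Z : subgroup G).
Variables (I : finType) (s : I -> G).
Hypothesis tr : transversal L Z s.
Variables V W : rep C L.
Variable c : G -> G -> C.
Hypothesis ZL : forall z, carrier Z z -> carrier L z.
Hypothesis cV : forall x y v, carrier L x -> carrier L y ->
  rep_act V x (rep_act V y v) = c x y *: rep_act V y (rep_act V x v).
Hypothesis cM : forall x y g, carrier L x -> carrier L y -> carrier L g ->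
  c (x * y)%g g = c x g * c y g.
Hypothesis cZ : forall x z, carrier L x -> carrier Z z ->
  c z x = 1 /\ c x z = 1.
Hypothesis c_nondeg : forall g, carrier L g ->
  (forall x, carrier L x -> c x g = 1) -> carrier Z g.
Hypothesis VW_central : forall z, carrier Z z -> exists a,
  (forall v, rep_act V z v = a *: v) /\ (forall w, rep_act W z w = a *: w).

Let conj_map (phi : V -> W) v g := rep_act W g (phi (rep_act V (g^-1)%g v)).

Let conj_mapZ phi v g z : linear phi -> carrier L g -> carrier Z z ->
  conj_map phi v (g * z)%g = conj_map phi v g.
Proof.
move=> phi_lin Lg Zz; have Lz := ZL Zz; rewrite /conj_map.
have [a [Va Wa]] := VW_central Zz.
rewrite rep_actM// Wa -(linZ phi_lin) -Va invgM.
rewrite [rep_act V (_ * _)%g _]rep_actM; [|exact: subgroupV..].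
by rewrite rep_actKV.
Qed.

Let avg phi v := \sum_i conj_map phi v (s i).

Definition intertwiner (f : V -> W) := linear f /\
  forall h v, carrier L h -> f (rep_act V h v) = rep_act W h (f v).

Lemma avg_intertwiner phi : linear phi -> intertwiner (avg phi).
Proof.
move=> phi_lin; have [Ls _] := tr; split=> [a u v|h v Lh].
  rewrite /avg scaler_sumr -big_split; apply: eq_bigr => i _ /=.
  rewrite /conj_map (rep_linear V); last exact: subgroupV.
  by rewrite phi_lin (rep_linear W).
rewrite /avg -(coset_sum_translate tr _ Lh); last first.
  by move=> *; exact: conj_mapZ.
rewrite (lin_sum (rep_linear W h Lh)); apply: eq_bigr => i _.
rewrite /conj_map rep_actM// invgM [rep_act V (_ * _)%g _]rep_actM.
- by rewrite rep_actVK.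
- exact: subgroupV.
- exact: subgroupV.
Qed.

(** Translating by some x with c(x, g) <> 1 multiplies the sum by c(x, g). *)
Lemma commutator_sum0 g : carrier L g -> ~ carrier Z g ->
  \sum_i c (s i) g = 0.
Proof.
move=> Lg nZg; have [Ls _] := tr.
have [x Lx cx] : exists2 x, carrier L x & c x g <> 1.
  apply: contrapT => h; apply: nZg; apply: c_nondeg => // x Lx.
  by apply: contrapT => cx; apply: h; exists x.
have : c x g * (\sum_i c (s i) g) = \sum_i c (s i) g.
  rewrite mulr_sumr -(coset_sum_translate (F := c^~ g) tr _ Lx) /=.
    by apply: eq_bigr => i _; rewrite cM.
  by move=> h z Lh Zz; rewrite cM ?(proj1 (cZ Lg Zz)) ?mulr1//; exact: ZL.
move/eqP; rewrite -subr_eq0 -{2}[\sum_i _]mul1r -mulrBl mulf_eq0 subr_eq0.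
by case/orP => /eqP.
Qed.

(** If every intertwiner kills v then it kills all the V(x^-1)v, and
    sum_x avg(phi \o V(x))(V(x^-1) v) is a multiple of phi v by orthogonality
    of the commutator characters. *)
Lemma intertwiners_separate (phi : V -> W) v : linear phi ->
  (forall f, intertwiner f -> f v = 0) -> phi v = 0.
Proof.
move=> phi_lin v0; have [Ls sP] := tr.
have LV x : carrier L x -> carrier L (x^-1)%g by exact: subgroupV.
have key x : carrier L x ->
    \sum_i c x (s i)^-1%g *: conj_map phi v (s i) = 0.
  move=> Lx; pose phix u := phi (rep_act V x u).
  have phix_lin : linear phix.
    by move=> a u w; rewrite /phix (rep_linear V)// phi_lin.
  have avg_hom := avg_intertwiner phix_lin.
  transitivity (avg phix (rep_act V (x^-1)%g v)); last first.
    by rewrite (proj2 avg_hom) ?(v0 _ avg_hom) ?rep_act0//; exact: LV.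
  apply: eq_bigr => i _; rewrite /conj_map /phix cV//; last exact: LV.
  by rewrite rep_actKV// (linZ phi_lin) rep_actZ.
have : \sum_j \sum_i c (s j) (s i)^-1%g *: conj_map phi v (s i) = 0.
  by apply: big1 => j _; exact: key.
have [i1 [Zi1 i1min]] := sP 1%g (subgroup1 L).
rewrite mulg1 in Zi1.
rewrite exchange_big (bigD1 i1) //= [X in _ + X]big1 ?addr0; last first.
  move=> i ii1; rewrite -scaler_suml commutator_sum0 ?scale0r//; first exact: LV.
  by move=> Zi; move/eqP: ii1; apply; apply/esym/i1min; rewrite mulg1.
have -> : conj_map phi v (s i1) = phi v.
  rewrite -[s i1]mul1g (conj_mapZ _ phi_lin (subgroup1 L) (subgroupVE Zi1)).
  by rewrite /conj_map invg1 !rep_act1.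
rewrite -scaler_suml (eq_bigr (fun=> 1)); last first.
  by move=> i _; have [] := cZ (Ls i) Zi1.
rewrite sumr_const => /eqP; rewrite scaler_eq0 pnatr_eq0 => /orP[|/eqP//].
by move=> /eqP/card0_eq/(_ i1).
Qed.

Hypothesis V_fd : fin_dim V.
Hypothesis W_irr : irreducible W.

Let surj k (f : V -> {ffun 'I_k -> W}) :=
  [/\ linear f, forall h v, carrier L h -> f (rep_act V h v) = multiple_act h (f v)
    & forall w, exists v, f v = w].

Let surj_bound : exists m : nat, forall k (f : V -> {ffun 'I_k -> W}),
  surj f -> (k <= m)%N.
Proof.
have [m [g [g_lin g_inj]]] := V_fd; exists m => k f [f_lin _ f_surj].
have [[w w0] _] := W_irr.
have [b hb] := choice (fun i => f_surj [ffun j => if j == i then w else 0]).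
pose M : 'M[C]_(k, m) := \matrix_(i, j) g (b i) 0 j.
suff : row_free M by move=> /eqP <-; exact: rank_leq_col.
rewrite -kermx_eq0; apply/rowV0P => u /sub_kermxP uM.
have gu : g (\sum_i u 0 i *: b i) = 0.
  rewrite (lin_sum g_lin) -[RHS]uM; apply/rowP => j; rewrite mxE summxE.
  by apply: eq_bigr => i _; rewrite linZ// !mxE.
have : f (\sum_i u 0 i *: b i) = 0.
  by rewrite -(lin0 f_lin); congr f; apply: g_inj; rewrite gu lin0.
rewrite lin_sum// => fu; apply/rowP => j; rewrite mxE.
have := congr1 (fun h : {ffun 'I_k -> W} => h j) fu.
rewrite sum_ffunE (bigD1 j)//= big1 ?addr0; last first.
  by move=> i ij; rewrite linZ// hb !ffunE eq_sym (negPf ij) scaler0.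
rewrite linZ// hb !ffunE eqxx => /eqP; rewrite scaler_eq0 => /orP[/eqP//|/eqP//].
Qed.

(** A surjective intertwiner V -> W^k with k maximal is injective: another
    intertwiner, nonzero on the kernel, would map the kernel onto the
    irreducible W. *)
Lemma isotypic : exists e, rep_iso V (multiple e W).
Proof.
have [m hm] := surj_bound.
pose P k := `[< exists f : V -> {ffun 'I_k -> W}, surj f >].
have exP : exists k, P k.
  exists 0%N; apply/asboolP; exists (fun=> 0); split.
  - by move=> a u v; apply/ffunP => -[].
  - by move=> h v _; apply/ffunP => -[].
  - by move=> w; exists 0; apply/ffunP => -[].
have ubP k : P k -> (k <= m)%N by move=> /asboolP[f]; exact: hm.
case: (ex_maxnP exP ubP) => k /asboolP[f [f_lin f_hom f_surj]] kmax; exists k.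
have f_inj : injective f.
  apply: lin_injP => // v fv; apply: contrapT => v0.
  have [phi phi_lin phiv] : exists2 phi : V -> W, linear phi & phi v <> 0.
    have [d [g [g_lin g_inj]]] := V_fd; have [[w w0] _] := W_irr.
    have [j gvj] : exists j, g v 0 j <> 0.
      apply: contrapT => h; apply: v0; apply: g_inj; rewrite (lin0 g_lin).
      by apply/rowP => j; rewrite mxE; apply: contrapT => gvj; apply: h; exists j.
    exists (fun u => g u 0 j *: w) => [a u u'|/eqP].
      by rewrite g_lin !mxE scalerDl scalerA.
    by rewrite scaler_eq0 => /orP[] /eqP.
  have [Phi [Phi_lin Phi_hom] Phiv] : exists2 Phi, intertwiner Phi & Phi v <> 0.
    apply: contrapT => h; apply: phiv; apply: intertwiners_separate => // f' hf'.
    by apply: contrapT => f'v; apply: h; exists f'.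
  have Phi_onto w : exists2 u, f u = 0 & w = Phi u.
    move: w; apply: (irreducible_full W_irr (S := [set w | exists2 u, f u = 0 & w = Phi u])).
    - by apply: submodule_image => //; exact: submodule_kernel.
    - move=> h _ Lh [u fu ->]; exists (rep_act V h u); rewrite ?Phi_hom// f_hom// fu.
      by apply/ffunP => i; rewrite !ffunE rep_act0.
    - by exists (Phi v) => //; exists v.
  pose f1 u : {ffun 'I_k.+1 -> W} :=
    [ffun i => if unlift ord0 i is Some j then f u j else Phi u].
  suff : (k.+1 <= k)%N by rewrite ltnn.
  apply: kmax; apply/asboolP; exists f1; split.
  - move=> a u w; apply/ffunP => i; rewrite !ffunE; case: unliftP => [j|] _.
      by rewrite f_lin !ffunE.
    by rewrite Phi_lin.
  - move=> h u Lh; apply/ffunP => i; rewrite !ffunE; case: unliftP => [j|] _.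
      by rewrite f_hom// ffunE.
    by rewrite Phi_hom.
  - move=> w; have [u fu] := f_surj [ffun j => w (lift ord0 j)].
    have [u' fu' Phiu'] := Phi_onto (w ord0 - Phi u).
    exists (u + u'); apply/ffunP => i; rewrite ffunE; case: unliftP => [j|] ->.
      by rewrite linD// fu' addr0 fu ffunE.
    by rewrite linD// -Phiu' addrC subrK.
have [g gK] := choice f_surj.
pose f' : {linear V -> {ffun 'I_k -> W}} := HB.pack f (GRing.isLinear.Build _ _ _ _ f f_lin).
exists f'; split; first by exists g => // v; apply: f_inj; rewrite gK.
exact: f_hom.
Qed.

End Isotypic.

(** * Admissibility of finite-dimensional representations *)

Section FiniteDimensionalReps.
Variables (C : closedFieldType) (G : groupType) (L : subgroup G).
Variables (top : group_topology G).

Lemma admissible_fin_dim (pi : rep C L) :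
  smooth top pi -> fin_dim pi -> admissible top pi.
Proof.
move=> sm /fin_dim_span[d [b hb]]; split=> // U _ _.
by exists d, b => v _; exact: hb.
Qed.

Lemma smooth_sub (pi W : rep C L) (j : W -> pi) : injective j ->
  (forall h w, carrier L h -> j (rep_act W h w) = rep_act pi h (j w)) ->
  smooth top pi -> smooth top W.
Proof.
move=> j_inj j_hom sm w; have [N nN Nw] := sm (j w); exists N => // h Lh Nh.
by apply: j_inj; rewrite j_hom// Nw.
Qed.

(** The translates of a nonzero vector by representatives of L/Z span. *)
Lemma irreducible_fin_dim (Z : subgroup G) (pi : rep C L) :
  irreducible pi -> fin_index L Z -> (forall x, carrier Z x -> carrier L x) ->
  (forall z, carrier Z z -> exists a, forall v, rep_act pi z v = a *: v) ->
  fin_dim pi.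
Proof.
move=> irr fin ZL Zsc; have [I [s [Ls sP]]] := fin_index_transversal fin ZL.
have [[v v0] _] := irr.
pose b i := rep_act pi (s i) v.
pose S := [set u | exists c : I -> C, u = \sum_i c i *: b i].
have Ssub : submodule_set S.
  split; first by exists (fun=> 0); rewrite big1// => i _; rewrite scale0r.
  move=> a _ _ [c ->] [c' ->]; exists (fun i => a * c i + c' i).
  rewrite scaler_sumr -big_split; apply: eq_bigr => i _.
  by rewrite scalerA scalerDl.
have Sb i : S (b i).
  exists (fun j => (j == i)%:R); rewrite (bigD1 i)//= eqxx scale1r big1 ?addr0//.
  by move=> j /negPf ->; rewrite scale0r.
have Sact h : carrier L h -> S (rep_act pi h v).
  move=> Lh; have [i [Zi _]] := sP h Lh; have [a ha] := Zsc _ Zi.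
  have -> : h = (s i * ((s i)^-1 * h))%g by rewrite mulgA mulgV mul1g.
  rewrite rep_actM ?ha ?rep_actZ//; last exact: ZL.
  exact: (submoduleZ a Ssub (Sb i)).
have SP : forall u, S u.
  apply: (irreducible_full irr) => //; last first.
    by exists v => //; rewrite -[v](rep_act1 pi); apply: Sact; exact: subgroup1.
  move=> h _ Lh [c ->]; rewrite (lin_sum (rep_linear pi h Lh)).
  apply: submodule_sum => // i _; rewrite rep_actZ// -rep_actM//.
  by apply: submoduleZ => //; apply: Sact; exact: subgroupM.
apply: (span_fin_dim (b := fun k : 'I_#|I| => b (enum_val k))) => u.
have [c ->] := SP u; exists (fun k => c (enum_val k)).
exact: (big_enum_val (fun i => c i *: b i)).
Qed.

End FiniteDimensionalReps.

(** * Induction from a normal subgroup of finite index *)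

Section Induction.
Variables (C : closedFieldType) (G : groupType) (top : group_topology G).
Variables (K H : subgroup G) (sigma : rep C K).
Hypothesis KH : forall x, carrier K x -> carrier H x.

Let Ind := Ind top H sigma.

Lemma ind_equivariant (f : Ind) k g : carrier K k -> carrier H g ->
  f (k * g)%g = rep_act sigma k (f g).
Proof. by case: f => f /= /asboolP[+ _ _]; exact. Qed.

Lemma ind_supp (f : Ind) g : ~ carrier H g -> f g = 0.
Proof. by case: f => f /= /asboolP[_ + _]; exact. Qed.

Lemma ind_extP (f f' : Ind) : (forall g, carrier H g -> f g = f' g) -> f = f'.
Proof.
move=> ff'; apply: val_inj; apply/funext => g /=.
by have [/ff'//|nHg] := pselect (carrier H g); rewrite !ind_supp.
Qed.

Lemma rep_act_indE h (f : Ind) x : carrier H h ->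
  rep_act Ind h f x = f (x * h)%g.
Proof. by move=> Hh; rewrite /= ind_actE. Qed.

Lemma ind_evD c (f f' : Ind) x : (c *: f + f' : Ind) x = c *: f x + f' x.
Proof. exact: (congr1 (fun g : G -> sigma => g x) (ind_funP c f f')). Qed.

Lemma ind_ev0 x : (0 : Ind) x = 0.
Proof. exact: (lin0 (f := fun f : Ind => f x) (fun c f f' => ind_evD c f f' x)). Qed.

Lemma ind_evZ c (f : Ind) x : (c *: f : Ind) x = c *: f x.
Proof. by rewrite -[c *: f]addr0 ind_evD ind_ev0 addr0. Qed.

Lemma ind_central_scalar z a : carrier K z ->
  (forall x, carrier H x -> x * z = z * x)%g ->
  (forall w, rep_act sigma z w = a *: w) ->
  forall f : Ind, rep_act Ind z f = a *: f.
Proof.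
move=> Kz zH za f; apply: ind_extP => x Hx; rewrite rep_act_indE; last exact: KH.
by rewrite zH// ind_equivariant// za ind_evZ.
Qed.

Lemma ind_smooth : smooth top Ind.
Proof.
move=> f; have [N nN fN] : exists2 N, nbhd1 top N &
    forall g u, carrier H g -> carrier H u -> N u -> f (g * u)%g = f g.
  by case: f => f /= /asboolP[].
exists N => // h Hh Nh; apply: ind_extP => x Hx.
by rewrite rep_act_indE// fN.
Qed.

Lemma fin_dim_ind : fin_index H K -> (forall x k, carrier H x -> carrier K k ->
    carrier K (x * k * x^-1)%g) -> fin_dim sigma -> fin_dim Ind.
Proof.
move=> fin nKH [m [f [f_lin f_inj]]].
have [I [s [Hs sP]]] := fin_index_transversal fin KH.
pose ev (F : Ind) : {ffun I -> 'rV[C]_m} := [ffun i => f (F (s i))].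
apply: (fin_dim_vect (f := ev)).
  by move=> a F F'; apply/ffunP => i; rewrite !ffunE ind_evD f_lin.
move=> F F' FF'; apply: ind_extP => x Hx; have [i [Ki _]] := sP x Hx.
have -> : (x = s i * ((s i)^-1 * x) * (s i)^-1 * s i)%g.
  by rewrite mulgA mulgV mul1g mulgKV.
have Kx := nKH _ _ (Hs i) Ki; rewrite !ind_equivariant//; congr rep_act.
by apply: f_inj; have := congr1 (fun h : {ffun I -> _} => h i) FF'; rewrite !ffunE.
Qed.

Section OpenSubgroup.
Hypothesis K_open : exists2 N, nbhd1 top N & forall x, carrier H x -> N x -> carrier K x.
Hypothesis sigma_smooth : smooth top sigma.

(** The extension by zero of an equivariant function on K is smooth because K is
    open in H; without it the induced representation could vanish. *)
Lemma ind_extend (v : sigma) : exists f : Ind,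
  (forall k, carrier K k -> f k = rep_act sigma k v) /\
  (forall x, ~ carrier K x -> f x = 0).
Proof.
pose f x := if pselect (carrier K x) then rep_act sigma x v else 0.
have fK k : carrier K k -> f k = rep_act sigma k v.
  by rewrite /f; case: pselect.
have fnK k : ~ carrier K k -> f k = 0 by rewrite /f; case: pselect.
have [N nN NK] := K_open; have [N' nN' N'v] := sigma_smooth v.
have KM k g : carrier K k -> carrier K (k * g)%g -> carrier K g.
  by move=> Kk Kkg; rewrite -(mulKg k g); apply: subgroupM => //; exact: subgroupV.
have KM' k g : carrier K k -> carrier K (g * k)%g -> carrier K g.
  by move=> Kk Kkg; rewrite -(mulgK k g); apply: subgroupM => //; exact: subgroupV.
have fP : f \in ind_pred top (K := K) H (sigma := sigma).
  apply/asboolP; split.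
  - move=> k g Kk Hg; have [Kg|nKg] := pselect (carrier K g).
      have Kkg : carrier K (k * g)%g by exact: subgroupM.
      by rewrite !fK// rep_actM.
    by rewrite !fnK ?rep_act0// => /(KM _ _ Kk).
  - by move=> g nHg; rewrite fnK// => /KH.
  - exists (N `&` N'); first exact: nbhd1I.
    move=> g u Hg Hu [Nu N'u]; have Ku := NK u Hu Nu.
    have [Kg|nKg] := pselect (carrier K g).
      have Kgu : carrier K (g * u)%g by exact: subgroupM.
      by rewrite !fK// rep_actM// N'v.
    by rewrite !fnK// => /(KM' _ _ Ku).
by exists (IndSpace fP); split.
Qed.

End OpenSubgroup.

End Induction.

Section Mackey.
Variables (C : closedFieldType) (G : groupType) (top : group_topology G).
Variables (K H : subgroup G) (sigma : rep C K).
Hypothesis KH : forall x, carrier K x -> carrier H x.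
Hypothesis nKH : forall x k, carrier H x -> carrier K k ->
  carrier K (x * k * x^-1)%g.
Hypothesis fin : fin_index H K.
Hypothesis K_open : exists2 N, nbhd1 top N & forall x, carrier H x -> N x -> carrier K x.
Hypothesis sigma_smooth : smooth top sigma.
Hypothesis sigma_irr : irreducible sigma.
Variable A : set G.
Hypothesis AK : forall h, A h -> carrier K h.
Hypothesis nAH : forall x h, carrier H x -> A h -> A (x * h * x^-1)%g.
Variable w : G -> C.
Hypothesis Aw : forall h v, A h -> rep_act sigma h v = w h *: v.
Hypothesis A_sep : forall g, carrier H g -> ~ carrier K g ->
  exists k t h, [/\ carrier K k, g = (k * t)%g, A h & w (t * h * t^-1)%g <> w h].

Let Ind := Ind top H sigma.

Let wJ k h : carrier K k -> A h -> w (k * h * k^-1)%g = w h.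
Proof.
move=> Kk Ah; have [[v v0] _] := sigma_irr.
have Akh := nAH (KH Kk) Ah; have KV := subgroupV Kk.
have : rep_act sigma (k * h * k^-1)%g v = w h *: v.
  have Kh := AK Ah; have Kkh := subgroupM Kk Kh; rewrite !rep_actM//.
  by rewrite (Aw _ Ah) rep_actZ// rep_actKV.
rewrite (Aw _ Akh) => /eqP; rewrite -subr_eq0 -scalerBl scaler_eq0 subr_eq0.
by case/orP => /eqP.
Qed.

Let act_A h (f : Ind) x : A h -> carrier H x ->
  rep_act Ind h f x = w (x * h * x^-1)%g *: f x.
Proof.
move=> Ah Hx; rewrite rep_act_indE; last by apply/KH/AK.
have -> : f (x * h)%g = f (x * h * x^-1 * x)%g by rewrite mulgKV.
have Ax := nAH Hx Ah; have Kx := AK Ax.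
by rewrite ind_equivariant// Aw.
Qed.

(** The restriction of Ind to K is the sum of the conjugates of sigma by the
    cosets of K.  On the conjugate by g, an element h of A acts by the scalar
    w(g h g^-1), so that the conjugates are told apart by A; an invariant
    subspace contains the components of its elements, and is everything. *)
Lemma mackey_irreducible : irreducible Ind.
Proof.
have [I [cl hcl]] := fin.
have clK x y : carrier H x -> carrier H y -> cl x = cl y ->
    exists2 k, carrier K k & y = (k * x)%g.
  move=> Hx Hy /(hcl x y Hx Hy) Kxy; exists (x * (x^-1 * y) * x^-1)%g.
    exact: nKH.
  by rewrite mulgKV mulgA mulgV mul1g.
have ext := ind_extend KH K_open sigma_smooth.
split.
  have [[v v0] _] := sigma_irr; have [f [fK _]] := ext v.
  exists f => f0; apply: v0; rewrite -[v](rep_act1 sigma) -fK ?f0 ?ind_ev0//.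
  exact: subgroup1.
move=> S S0 SD Sinv; have [|S_ne0] := pselect (forall v, S v -> v = 0); first by left.
right; have Ssub : submodule_set S by split.
have H1 : carrier H 1%g by exact: subgroup1.
have K1 : carrier K 1%g by exact: subgroup1.
(* the components of f at the cosets labelled by l, other than K, are removed *)
have kill (l : seq I) : exists2 f : Ind, S f & f 1%g <> 0 /\
    forall g, carrier H g -> cl g \in l -> ~ carrier K g -> f g = 0.
  elim: l => [|i l [f Sf [f1 fl]]].
    have [f [Sf f0]] : exists f, S f /\ f <> 0.
      apply: contrapT => h; apply: S_ne0 => f Sf.
      by apply: contrapT => f0; apply: h; exists f.
    have [g Hg fg] : exists2 g, carrier H g & f g <> 0.
      apply: contrapT => h; apply: f0; apply: ind_extP => g Hg; rewrite ind_ev0.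
      by apply: contrapT => fg; apply: h; exists g.
    exists (rep_act Ind g f); first exact: Sinv.
    by rewrite rep_act_indE// mul1g; split.
  have [[g0 [Hg0 [clg0 nKg0]]]|h] :=
      pselect (exists g0, carrier H g0 /\ cl g0 = i /\ ~ carrier K g0); last first.
    exists f => //; split=> // g Hg; rewrite in_cons => /orP[/eqP gi nKg|]; last exact: fl.
    by case: h; exists g.
  have [k0 [t [h [Kk0 g0E Ah wth]]]] := A_sep Hg0 nKg0.
  have Ht : carrier H t.
    by rewrite -(mulKg k0 t) -g0E; apply: subgroupM => //; exact/subgroupV/KH.
  have wh : w (g0 * h * g0^-1)%g <> w h.
    have -> : (g0 * h * g0^-1 = k0 * (t * h * t^-1) * k0^-1)%g.
      by rewrite g0E invgM !mulgA.
    by rewrite wJ//; exact: nAH.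
  exists (- w (g0 * h * g0^-1)%g *: f + rep_act Ind h f).
    by apply: SD => //; apply: Sinv => //; apply/KH/AK.
  rewrite ind_evD act_A// invg1 mulg1 mul1g -scalerDl; split.
    move=> /eqP; rewrite scaler_eq0 => /orP[|/eqP//].
    by rewrite addrC subr_eq0 => /eqP wE; apply: wh.
  move=> g Hg gil nKg; rewrite ind_evD act_A// -scalerDl.
  move: gil; rewrite in_cons => /orP[/eqP gi|/fl ->]; rewrite ?scaler0//.
  have [|k Kk ->] := clK g0 g Hg0 Hg; first by rewrite gi.
  have -> : (k * g0 * h * (k * g0)^-1 = k * (g0 * h * g0^-1) * k^-1)%g.
    by rewrite invgM !mulgA.
  by rewrite (wJ Kk (nAH Hg0 Ah)) addNr scale0r.
have delta v : exists f : Ind, [/\ S f, f 1%g = v &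
    forall g, carrier H g -> ~ carrier K g -> f g = 0].
  move: v; apply: (irreducible_full sigma_irr).
  - split; first by exists 0; split=> // *; exact: ind_ev0.
    move=> c u v [f [Sf <- f0]] [f' [Sf' <- f0']]; exists (c *: f + f').
    split=> [||g Hg nKg]; [exact: SD|by rewrite ind_evD|].
    by rewrite ind_evD f0// f0'// scaler0 addr0.
  - move=> k v Kk [f [Sf <- f0]]; exists (rep_act Ind k f).
    have Hk := KH Kk; split; first exact: Sinv.
      by rewrite rep_act_indE// mul1g -ind_equivariant// mulg1.
    move=> g Hg nKg; rewrite rep_act_indE// f0//; first exact: subgroupM.
    move=> Kgk; apply: nKg; rewrite -(mulgK k g).
    by apply: subgroupM => //; exact: subgroupV.
  - have [f Sf [f1 fl]] := kill (enum I); exists (f 1%g) => //.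
    by exists f; split=> // g Hg nKg; apply: fl; rewrite ?mem_enum.
suff cover (l : seq I) (F : Ind) :
    (forall g, carrier H g -> cl g \notin l -> F g = 0) -> S F.
  by move=> F; apply: (cover (enum I)) => g _; rewrite mem_enum.
elim: l F => [|i l IH] F Fl.
  by have -> : F = 0 by apply: ind_extP => g Hg; rewrite ind_ev0 Fl.
have [[g0 [Hg0 [clg0 Fg0]]]|h] :=
    pselect (exists g0, carrier H g0 /\ cl g0 = i /\ F g0 <> 0); last first.
  apply: IH => g Hg gl; have [gi|gi] := eqVneq (cl g) i.
    by apply: contrapT => Fg; apply: h; exists g.
  by apply: Fl => //; rewrite in_cons negb_or gi.
have [f [Sf f1 f0]] := delta (F g0); have HV := subgroupV Hg0.
pose F0 := rep_act Ind (g0^-1)%g f.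
have SF0 : S F0 by exact: Sinv.
have F0K k : carrier K k -> F0 (k * g0)%g = F (k * g0)%g.
  move=> Kk; rewrite rep_act_indE// mulgK [RHS]ind_equivariant// -f1.
  by rewrite -ind_equivariant// mulg1.
have F0nK g : carrier H g -> ~ carrier K (g * g0^-1)%g -> F0 g = 0.
  by move=> Hg nK; rewrite rep_act_indE// f0//; exact: subgroupM.
suff : S (F - F0) by move=> SFF0; rewrite -(subrK F0 F); exact: submoduleD.
apply: IH => g Hg gl; rewrite -scaleN1r addrC ind_evD.
have [Kg|nKg] := pselect (carrier K (g * g0^-1)%g).
  by rewrite -(mulgKV g0 g) F0K// scaleN1r addNr.
rewrite F0nK// scaler0 add0r; have [gi|gi] := eqVneq (cl g) i; last first.
  by apply: Fl => //; rewrite in_cons negb_or gi.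
have [|k Kk gE] := clK g0 g Hg0 Hg; first by rewrite gi.
by case: nKg; rewrite gE mulgK.
Qed.

End Mackey.

(** * Representations of a product of commuting subgroups *)

Lemma linear_ext (R : pzRingType) (U V : lmodType R) (f g : {linear U -> V}) :
  (forall u, f u = g u) -> f = g.
Proof.
case: f g => [f cf] [g cg] /= /funext fg; move: cf cg; rewrite {}fg => cf cg.
congr GRing.Linear.Pack; case: cf cg => [[a] [b]] [[a'] [b']].
by rewrite (Prop_irrelevance a a') (Prop_irrelevance b b').
Qed.

Section TensorFactor.
Variables (C : closedFieldType) (G : groupType) (A B : subgroup G).
Variables (tau : rep C A) (sigma : rep C (setmul A B)) (m : nat).
Hypothesis AB : forall a b, carrier A a -> carrier B b -> (a * b = b * a)%g.
Hypothesis tau_irr : irreducible tau.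
Hypothesis tau_fd : fin_dim tau.
Hypothesis sigma_irr : irreducible sigma.
Variable phi : sigma -> {ffun 'I_m -> tau}.
Hypothesis phi_lin : linear phi.
Hypothesis phi_bij : bijective phi.
Hypothesis phi_hom : forall a w, carrier A a ->
  phi (rep_act sigma a w) = multiple_act a (phi w).

Let KA a : carrier A a -> setmul A B a.
Proof. by exists a, 1%g; split; rewrite ?mulg1//; exact: subgroup1. Qed.

Let KB b : carrier B b -> setmul A B b.
Proof. by exists 1%g, b; split; rewrite ?mul1g//; exact: subgroup1. Qed.

(** sigma restricted to A is tau^m, that is the tensor product of tau with C^m;
    by Schur's lemma B acts through the factor C^m. *)
Lemma tensor_factor : exists rho : rep C B,
  [/\ fin_dim rho, irreducible rho, is_boxtimes tau rho sigma &
      exists j : rho -> sigma, [/\ linear j, injective j &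
        forall b u, carrier B b -> j (rep_act rho b u) = rep_act sigma b (j u)]].
Proof.
have [psi phiK psiK] := phi_bij.
have psi_lin : linear psi.
  by move=> c f g; apply: (can_inj phiK); rewrite phi_lin !psiK.
have [[v0 v00] _] := tau_irr; have [d [g [g_lin g_inj]]] := tau_fd.
have sl k : setmul A B k -> linear (rep_act sigma k) by exact: rep_linear.
pose t (v : tau) (u : 'rV[C]_m) := psi [ffun i => u 0 i *: v].
have phit v u : phi (t v u) = [ffun i => u 0 i *: v] by rewrite psiK.
have t_linl u : linear (t ^~ u).
  move=> c v w; rewrite /t -psi_lin; congr psi; apply/ffunP => i.
  by rewrite !ffunE scalerDr !scalerA mulrC.
have t_linr v : linear (t v).
  move=> c u w; rewrite /t -psi_lin; congr psi; apply/ffunP => i.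
  by rewrite !ffunE !mxE scalerDl scalerA.
have t_inj v : v <> 0 -> injective (t v).
  move=> /eqP v_0; apply: lin_injP => // u /(congr1 phi); rewrite phit (lin0 phi_lin) => u0.
  apply/rowP => i; rewrite mxE; have := congr1 (fun f : {ffun _ -> tau} => f i) u0.
  by rewrite !ffunE => /eqP; rewrite scaler_eq0 (negPf v_0) orbF => /eqP.
have t_hom a v u : carrier A a -> rep_act sigma a (t v u) = t (rep_act tau a v) u.
  move=> Aa; apply: (can_inj phiK); rewrite phi_hom// !phit; apply/ffunP => i.
  by rewrite !ffunE rep_actZ.
have decomp w : w = \sum_i t (phi w i) (delta_mx 0 i).
  apply: (can_inj phiK); rewrite (lin_sum phi_lin); apply/ffunP => k.
  rewrite sum_ffunE (bigD1 k)//= phit ffunE mxE !eqxx scale1r big1 ?addr0// => i ik.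
  by rewrite phit ffunE mxE (eq_sym k) (negPf ik) scale0r.
have Mex b : exists M : 'M[C]_m, carrier B b ->
    forall v u, rep_act sigma b (t v u) = t v (u *m M).
  have [Bb|nBb] := pselect (carrier B b); last by exists 0.
  have [|M hM] := @choice _ _ (fun (p : 'I_m * 'I_m) c => forall v,
      phi (rep_act sigma b (t v (delta_mx 0 p.1))) p.2 = c *: v).
    move=> [i j] /=; apply: (schur_fin_dim tau_irr) => //.
      by move=> c v w; rewrite t_linl (sl b (KB Bb)) phi_lin !ffunE.
    move=> a v Aa; have Ka := KA Aa; have Kb := KB Bb.
    by rewrite -t_hom// -(rep_actM sigma)// -AB// (rep_actM sigma)// phi_hom// ffunE.
  exists (\matrix_(i, j) M (i, j)) => _ v u.
  rewrite [u in LHS]row_sum_delta (lin_sum (t_linr v)) (lin_sum (sl b (KB Bb))).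
  apply: (can_inj phiK); rewrite (lin_sum phi_lin) phit; apply/ffunP => j.
  rewrite sum_ffunE ffunE mxE scaler_suml; apply: eq_bigr => i _.
  rewrite (linZ (t_linr v)) (linZ (sl b (KB Bb))) (linZ phi_lin) ffunE.
  by rewrite (hM (i, j)) mxE scalerA.
have [M hM] := choice Mex.
have M1 (u : 'rV[C]_m) : u *m M 1%g = u.
  apply: (t_inj v0 v00); rewrite -hM ?rep_act1//; exact: subgroup1.
have MM b b' (u : 'rV[C]_m) : carrier B b -> carrier B b' -> u *m M (b * b')%g = u *m M b' *m M b.
  move=> Bb Bb'; apply: (t_inj v0 v00); rewrite -!hM//; last exact: subgroupM.
  by rewrite (rep_actM sigma) ?hM//; exact: KB.
have M_lin b : carrier B b -> linear (fun u : 'rV[C]_m => u *m M b).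
  by move=> _ c u w; rewrite mulmxDl scalemxAl.
pose rho : rep C B := @Rep C G B 'rV[C]_m (fun b u => u *m M b) M_lin M1
  (fun b b' u Bb Bb' => MM b b' u Bb Bb').
exists rho; split.
- by exists m, id; split.
- split.
    have [[w w0] _] := sigma_irr; exists (const_mx 1 : rho) => one0; apply: w0.
    rewrite (decomp w) big1// => i _; have := congr1 (fun u : 'rV[C]_m => u 0 i) one0.
    by rewrite !mxE => /eqP; rewrite oner_eq0.
  move=> S S0 SD Sinv; have [|Sne] := pselect (forall u, S u -> u = 0); first by left.
  right => u; have Ssub : submodule_set S by split.
  (* the submodule of sigma generated by the tensors with second factor in S *)
  pose S' := [set w : sigma | forall Q : set sigma, submodule_set Q ->
    (forall v u, S u -> Q (t v u)) -> Q w].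
  have S'P : forall w, S' w.
    have [_ irr] := sigma_irr; have [||||//] := irr S'.
    - by move=> Q [Q0 _].
    - by move=> c w w' hw hw' Q Qsub hQ; case: (Qsub) => _; apply; [exact: hw|exact: hw'].
    - move=> k w Kk hw Q Qsub hQ.
      apply: (hw [set w | Q (rep_act sigma k w)]).
        split; first by rewrite /= (lin0 (sl k Kk)); case: Qsub.
        by move=> c x y /= Qx Qy; rewrite (sl k Kk); case: Qsub => _; apply.
      move=> v x Sx /=; have [a [b [Aa Bb ->]]] := Kk.
      have Ka := KA Aa; have Kb := KB Bb; rewrite (rep_actM sigma)// hM//.
      by rewrite t_hom//; apply: hQ; exact: (Sinv b).
    - move=> S'0; exfalso; apply: Sne => x Sx; apply: (t_inj v0 v00).
      by rewrite (lin0 (t_linr v0)); apply: S'0 => Q _; exact.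
  (* the coordinate j, nonzero at v0, maps the generated submodule back to S *)
  have [j gv0j] : exists j, g v0 0 j <> 0.
    apply: contrapT => h; apply: v00; apply: g_inj; rewrite (lin0 g_lin).
    by apply/rowP => j; rewrite mxE; apply: contrapT => gvj; apply: h; exists j.
  have : S (g v0 0 j *: u).
    have := S'P (t v0 u) [set w | S (\row_i g (phi w i) 0 j)].
    have -> : [set w | S (\row_i g (phi w i) 0 j)] (t v0 u) = S (g v0 0 j *: u).
      rewrite /=; congr S; apply/rowP => i.
      by rewrite !mxE phit ffunE (linZ g_lin) mxE mulrC.
    apply.
      split => /=.
        suff -> : \row_i g (phi 0 i) 0 j = 0 :> 'rV[C]_m by [].
        by apply/rowP => i; rewrite !mxE (lin0 phi_lin) ffunE (lin0 g_lin) mxE.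
      move=> c w w' Sw Sw'; have -> : \row_i g (phi (c *: w + w') i) 0 j =
          c *: (\row_i g (phi w i) 0 j) + \row_i g (phi w' i) 0 j.
        by apply/rowP => i; rewrite !mxE phi_lin !ffunE g_lin !mxE.
      exact: SD.
    move=> v x Sx /=; have -> : \row_i g (phi (t v x) i) 0 j = g v 0 j *: x.
      by apply/rowP => i; rewrite !mxE phit ffunE (linZ g_lin) mxE mulrC.
    exact: (submoduleZ _ Ssub).
  move=> /(submoduleZ (g v0 0 j)^-1 Ssub); rewrite scalerA mulVf ?scale1r//.
  exact/eqP.
- exists t => [|a b v u Aa Bb].
    split=> // Z b b_linl b_linr.
    pose f w := \sum_i b (phi w i) (delta_mx 0 i).
    have f_lin : linear f.
      move=> c w w'; rewrite /f scaler_sumr -big_split; apply: eq_bigr => i _ /=.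
      by rewrite phi_lin !ffunE b_linl.
    pose f' : {linear sigma -> Z} := HB.pack f (GRing.isLinear.Build _ _ _ _ f f_lin).
    have f'E v u : f' (t v u) = b v u.
      rewrite [u in RHS]row_sum_delta (lin_sum (b_linr v)); apply: eq_bigr => i _.
      by rewrite phit ffunE (linZ (b_linr v)) (linZ (b_linl _)).
    exists f'; split=> // h hE; apply: linear_ext => w.
    rewrite [in RHS](decomp w) linear_sum; apply: eq_bigr => i _.
    by rewrite hE.
  have Ka := KA Aa; have Kb := KB Bb.
  by rewrite (rep_actM sigma)// hM// t_hom.
- exists (t v0); split=> //; first exact: t_inj.
  by move=> b u Bb; rewrite hM.
Qed.

End TensorFactor.

(** * Powers in a p-adic field *)

Section PadicPowers.
Variables (F : fieldType) (v : padic_field F).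

Local Notation vge := (vge v).
Local Notation pval := (pval v).

Lemma vgeE k x : x != 0 -> vge k x <-> k <= pval x.
Proof. by move=> /eqP x0; split=> [[//|]|]; [|right]. Qed.

Lemma vge0 k : vge k 0. Proof. by left. Qed.

Lemma pval1 : pval 1 = 0.
Proof.
have := pvalM v (oner_neq0 F) (oner_neq0 F); rewrite mulr1 => /eqP.
by rewrite -subr_eq0 opprD addNKr oppr_eq0 => /eqP.
Qed.

Lemma vge1 : vge 0 1. Proof. by right; rewrite pval1. Qed.

Lemma vgeM k l x y : vge k x -> vge l y -> vge (k + l) (x * y).
Proof.
have [->|x0] := eqVneq x 0; first by rewrite mul0r => *; exact: vge0.
have [->|y0] := eqVneq y 0; first by rewrite mulr0 => *; exact: vge0.
move=> /(vgeE _ x0) kx /(vgeE _ y0) ly; right; rewrite pvalM//; exact: lerD.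
Qed.

Lemma pvalN x : x != 0 -> pval (- x) = pval x.
Proof.
move=> x0; have N1 : (-1 : F) != 0 by rewrite oppr_eq0 oner_neq0.
have : pval (-1) + pval (-1) = 0 by rewrite -pvalM// mulrNN mulr1 pval1.
move=> /eqP; rewrite -mulr2n mulrn_eq0 /= => /eqP pN1.
by rewrite -mulN1r pvalM// pN1 add0r.
Qed.

Lemma vgeN k x : vge k x -> vge k (- x).
Proof.
have [->|x0] := eqVneq x 0; first by rewrite oppr0.
by move=> /(vgeE _ x0) kx; right; rewrite pvalN.
Qed.

Lemma vgeB k x y : vge k x -> vge k y -> vge k (x - y).
Proof. by move=> kx /vgeN ky; exact: pvalD. Qed.

Lemma vge_le k l x : l <= k -> vge k x -> vge l x.
Proof. by move=> lk [->|kx]; [left|right; exact: le_trans kx]. Qed.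

Lemma vge_nat m : vge 0 m%:R.
Proof.
elim: m => [|m IH]; first exact: vge0.
by rewrite -natr1; apply: pvalD => //; exact: vge1.
Qed.

Lemma vgeX x m : vge 0 x -> vge 0 (x ^+ m).
Proof.
move=> x0; elim: m => [|m IH]; first exact: vge1.
by rewrite exprS -[0]addr0; exact: vgeM.
Qed.

Lemma vge_inf x : (forall k : nat, vge k%:Z x) -> x = 0.
Proof.
move=> h; apply/eqP; apply: contrapT => /negP x0.
have /(vgeE _ x0) := h `|pval x|.+1.
rewrite leNgt => /negP; apply; apply: le_lt_trans (ler_norm _) _.
by rewrite -abszE ltz_nat.
Qed.

Lemma pvalV x : x != 0 -> pval x^-1 = - pval x.
Proof.
move=> x0; have : pval (x * x^-1) = 0 by rewrite divff// pval1.
by rewrite pvalM ?invr_neq0// => /eqP; rewrite addrC addr_eq0 => /eqP.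
Qed.

Lemma pvalXz x (k : int) : x != 0 -> pval (x ^ k) = k * pval x.
Proof.
move=> x0; have pX (m : nat) : pval (x ^+ m) = m%:Z * pval x.
  elim: m => [|m IH]; first by rewrite expr0 pval1 mul0r.
  by rewrite exprS pvalM ?expf_neq0// IH -add1n PoszD mulrDl mul1r.
case: k => m; first by rewrite -exprnP pX.
by rewrite NegzE -exprnN pvalV ?expf_neq0// pX mulNr.
Qed.

Lemma taylor_power d y e : vge 0 y -> vge 0 e -> exists2 R, vge 0 R &
  (y + e) ^+ d.+1 = y ^+ d.+1 + d.+1%:R * y ^+ d * e + e ^+ 2 * R.
Proof.
move=> y0 e0; have v00 : (0 : int) = 0 + 0 by [].
elim: d => [|d [R R0 IH]].
  by exists 0; [exact: vge0|rewrite !expr1 expr0 mulr1 mul1r mulr0 addr0].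
exists (d.+1%:R * y ^+ d + (y + e) * R).
  apply: pvalD.
    by rewrite v00; apply: vgeM; [exact: vge_nat|exact: vgeX].
  by rewrite v00; apply: vgeM => //; exact: pvalD.
rewrite exprS IH -[in d.+2%:R]natr1 !exprS; ring.
Qed.

Lemma padic_natr_neq0 d : (0 < d)%N -> d%:R != 0 :> F.
Proof.
move=> d0; have /pcharf0P -> : [pchar F] =i pred0; last by rewrite -lt0n.
by move=> p; rewrite (negPf (padic_char0 v p)).
Qed.

Lemma subrX_vge k d x y : 0 <= k -> vge 0 x -> vge 0 y -> vge k (x - y) ->
  vge k (x ^+ d - y ^+ d).
Proof.
move=> k0 x0 y0 xy; rewrite subrXX -[k]addr0; apply: vgeM => //.
elim/big_ind : _ => [|a b a0 b0|i _]; [exact: vge0|exact: pvalD|].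
by rewrite -[0]addr0; apply: vgeM; exact: vgeX.
Qed.

(** Newton's iteration y + (w - y^d)/d from y = 1, whose error w - y^d gains at
    least one digit at each step once it is divisible by d^2 p. *)
Lemma hensel_power d : (0 < d)%N -> exists M : nat, forall w : F,
  vge M%:Z (w - 1) -> exists y, y ^+ d = w.
Proof.
move=> d0; have dn0 := padic_natr_neq0 d0; have d1 := prednK d0.
pose e := `|pval d%:R|%N.
have eE : pval d%:R = e%:Z.
  by have /(vgeE _ dn0) := vge_nat d; rewrite /e => /gez0_abs.
exists (2 * e).+1 => w hw.
pose next y := y + (w - y ^+ d) / d%:R.
pose y j := iter j next 1.
have int1 x : vge 1 (x - 1) -> vge 0 x.
  move=> hx; rewrite -(subrK 1 x); apply: pvalD; last exact: vge1.
  exact: vge_le hx.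
have divd k x : vge (k + e%:Z) x -> vge k (x / d%:R).
  move=> [->|kx]; first by rewrite mul0r; exact: vge0.
  have [->|x0] := eqVneq x 0; first by rewrite mul0r; exact: vge0.
  by right; rewrite pvalM ?invr_neq0// pvalV// eE; lia.
have step j : vge 1 (y j - 1) /\ vge ((2 * e).+1 + j)%:Z (w - y j ^+ d).
  elim: j => [|j [y1 yw]].
    by rewrite subrr expr1n addn0; split=> //; exact: vge0.
  pose x := y j; have x0 := int1 _ y1; rewrite -/x in y1 yw x0.
  pose h := (w - x ^+ d) / d%:R; have yE : y j.+1 = x + h by [].
  have hh : vge (e.+1 + j)%:Z h.
    by apply: divd; apply: vge_le yw; lia.
  have h0 : vge 0 h by apply: vge_le hh; lia.
  split.
    rewrite yE addrAC; apply: pvalD => //; apply: vge_le hh; lia.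
  have [R R0] := taylor_power d.-1 x0 h0; rewrite d1 -yE => ->.
  have -> : w - (x ^+ d + d%:R * x ^+ d.-1 * h + h ^+ 2 * R) =
      (w - x ^+ d) * (1 ^+ d.-1 - x ^+ d.-1) - h * h * R.
    by rewrite expr1n /h; field.
  apply: vgeB.
    have : vge (((2 * e).+1 + j)%:Z + 1)%R ((w - x ^+ d) * (1 ^+ d.-1 - x ^+ d.-1)).
      apply: vgeM => //; apply: subrX_vge => //; first exact: vge1.
      by rewrite -opprB; exact: vgeN.
    by apply: vge_le; lia.
  have := vgeM (vgeM hh hh) R0; apply: vge_le; lia.
have yint j : vge 0 (y j) by apply: int1; case: (step j).
have [|l hl] := @padic_complete _ v y.
  move=> k; have mono m j : vge j%:Z (y (j + m)%N - y j).
    elim: m => [|m IH]; first by rewrite addn0 subrr; exact: vge0.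
    rewrite addnS -(subrK (y (j + m)%N) (y (j + m).+1)) -addrA; apply: pvalD => //.
    rewrite /y iterS -/(y _) /next addrC addKr; apply: divd.
    by apply: vge_le (step (j + m)%N).2; lia.
  exists `|k|%N => i j ki kj; apply: (@vge_le `|k|%N%:Z); first by lia.
  rewrite -(subrKA (y `|k|%N)); apply: pvalD.
    by rewrite -(subnKC ki).
  by rewrite -opprB; apply: vgeN; rewrite -(subnKC kj).
have lint : vge 0 l.
  have [N hN] := hl 0; rewrite -(subrK (y N) l); apply: pvalD => //.
  by rewrite -opprB; apply: vgeN; exact: hN.
exists l; apply/eqP; rewrite -subr_eq0; apply/eqP/vge_inf => k.
have [N hN] := hl k; pose j := maxn N k.
rewrite -(subrKA (y j ^+ d)); apply: pvalD.
  apply: subrX_vge => //; rewrite -opprB; apply: vgeN.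
  by apply: hN; exact: leq_maxl.
rewrite -opprB; apply: vgeN; apply: vge_le (step j).2.
by rewrite /j; lia.
Qed.

Lemma integral_approx (M : nat) : exists s : seq F, forall x, vge 0 x ->
  exists2 a, a \in s & vge M%:Z (x - a).
Proof.
elim: M => [|M [s hs]].
  by exists [:: 0] => x x0; exists 0; rewrite ?mem_head ?subr0.
exists [seq a + unif v * b | a <- residues v, b <- s] => x x0.
have [a [[ra xa] _]] := residuesP x0.
have u0 := unif_neq0 v.
have xu : vge 0 ((x - a) / unif v).
  have [->|xa0] := eqVneq (x - a) 0; first by rewrite mul0r; exact: vge0.
  right; rewrite pvalM ?invr_neq0// pvalV// pval_unif.
  by move/(vgeE _ xa0): xa; lia.
have [b bs xb] := hs _ xu.
exists (a + unif v * b); first exact: allpairs_f.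
have -> : x - (a + unif v * b) = unif v * ((x - a) / unif v - b) by field.
have : vge (1 + M%:Z)%R (unif v * ((x - a) / unif v - b)).
  by apply: vgeM => //; right; rewrite pval_unif.
by apply: vge_le; lia.
Qed.

(** An element is labelled by its valuation modulo d and by a residue modulo p^M
    of its unit part; equal labels put the quotient of the unit parts in
    1 + p^M, which consists of d-th powers. *)
Lemma power_classes_finite d : (0 < d)%N ->
  exists (I : finType) (cl : F -> I), forall x y, x != 0 -> y != 0 ->
    cl x = cl y -> exists2 w, w != 0 & y = x * w ^+ d.
Proof.
move=> d0; have [M hM] := hensel_power d0; have [s hs] := integral_approx M.
have u0 := unif_neq0 v; have d'0 : d%:Z != 0 by lia.
pose unit x := x / unif v ^ pval x.
pose idx (x : F) : 'I_(size s).+1 :=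
  inord (find (fun a => `[< vge M%:Z (unit x - a) >]) s).
pose cl x : 'I_d.-1.+1 * 'I_(size s).+1 :=
  (inord `|(pval x %% d%:Z)%Z|, idx x).
exists ('I_d.-1.+1 * 'I_(size s).+1)%type, cl => x y x0 y0 [].
move=> /(congr1 val); rewrite /= !inordK; last 2 first.
- rewrite prednK//; have := ltz_pmod (pval x) (d := d%:Z).
  by have := modz_ge0 (pval x) d'0; lia.
- rewrite prednK//; have := ltz_pmod (pval y) (d := d%:Z).
  by have := modz_ge0 (pval y) d'0; lia.
move=> vxy /(congr1 val); rewrite /= !inordK ?ltnS ?find_size// => ixy.
have unit_neq0 z : z != 0 -> unit z != 0.
  by move=> z0; rewrite mulf_neq0// invr_neq0// expfz_neq0.
have pval_unit z : z != 0 -> pval (unit z) = 0.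
  move=> z0; rewrite pvalM ?invr_neq0 ?expfz_neq0// pvalV ?expfz_neq0//.
  by rewrite pvalXz// pval_unif mulr1 subrr.
have unit_int z : z != 0 -> vge 0 (unit z) by move=> z0; right; rewrite pval_unit.
have approx z : z != 0 ->
    vge M%:Z (unit z - nth 0 s (find (fun a => `[< vge M%:Z (unit z - a) >]) s)).
  move=> z0; apply/asboolP.
  apply: (nth_find 0 (a := fun a => `[< vge M%:Z (unit z - a) >])).
  by have [a sa ha] := hs _ (unit_int z z0); apply/hasP; exists a => //; apply/asboolP.
have := approx x x0; rewrite ixy; have := approx y y0; set a := nth 0 s _ => ay ax.
have hxy : vge M%:Z (unit y - unit x).
  by rewrite -(subrKA a); apply: pvalD => //; rewrite -opprB; exact: vgeN.
have [|w hw] := hM (unit y / unit x).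
  have -> : unit y / unit x - 1 = (unit y - unit x) * (unit x)^-1.
    by rewrite mulrBl divff// unit_neq0.
  rewrite -[M%:Z]addr0; apply: vgeM => //.
  by right; rewrite pvalV ?unit_neq0// pval_unit.
have w0 : w != 0.
  apply/eqP => w0; have : unit y / unit x != 0.
    by rewrite mulf_neq0 ?invr_neq0 ?unit_neq0.
  by rewrite -hw w0 expr0n -leqn0 leqNgt d0 eqxx.
have [q hq] : exists q, pval y = pval x + q * d%:Z.
  exists ((pval y %/ d%:Z)%Z - (pval x %/ d%:Z)%Z).
  have := divz_eq (pval x) d%:Z; have := divz_eq (pval y) d%:Z.
  have := modz_ge0 (pval x) d'0; have := modz_ge0 (pval y) d'0; nia.
exists (w * unif v ^ q); first by rewrite mulf_neq0// expfz_neq0.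
rewrite exprMn hw [(_ ^ q) ^+ d]exprnP exprz_exp.
have xE z : z = unit z * unif v ^ pval z by rewrite /unit mulfVK// expfz_neq0.
have xu : x / unit x = unif v ^ pval x.
  by rewrite /unit invf_div mulrCA divff// mulr1.
by rewrite [LHS]xE hq expfzDr// -xu; ring.
Qed.

End PadicPowers.

(** * Skew-symmetry of the Hilbert symbol *)

(** A nonconstant divisor of least degree is irreducible. *)
Lemma irreducible_factor (F : fieldType) (p : {poly F}) : (1 < size p)%N ->
  exists2 q, irreducible_poly q & q %| p.
Proof.
move=> sp; have p0 : p != 0 by rewrite -size_poly_gt0 ltnW.
pose P k := `[< exists2 q : {poly F}, (1 < size q)%N && (q %| p) & size q = k >].
have exP : exists k, P k.
  by exists (size p); apply/asboolP; exists p; rewrite ?sp ?dvdpp.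
case: (ex_minnP exP) => k /asboolP[q /andP[sq qp] <-] kmin.
have q0 : q != 0 by rewrite -size_poly_gt0 ltnW.
exists q => //; split=> // d sd dq; rewrite -dvdp_size_eqp// eqn_leq dvdp_leq//=.
apply: kmin; apply/asboolP; exists d => //; rewrite (dvdp_trans dq qp) andbT.
have d0 : d != 0 by apply: contraNneq q0 => d0; rewrite -dvd0p -d0.
by rewrite ltn_neqAle eq_sym sd size_poly_gt0.
Qed.

Lemma prod_opp_roots (F : fieldType) (k : nat) (u : F) : (0 < k)%N ->
  k.-primitive_root u -> \prod_(i < k) - u ^+ i = -1.
Proof.
move=> k0 pu; have := congr1 (horner^~ 0) (factor_Xn_sub_1 pu).
rewrite /= hornerD hornerN hornerXn hornerC expr0n eqn0Ngt k0 sub0r => <-.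
rewrite horner_prod big_mkord; apply: eq_bigr => i _.
by rewrite hornerXsubC sub0r.
Qed.

Section Kummer.
Variables (F : fieldType) (n : nat) (zeta b : F).
Hypothesis n_gt0 : (0 < n)%N.
Hypothesis zetaP : n.-primitive_root zeta.
Hypothesis b0 : b != 0.

(** F(z), for a root z of an irreducible factor of X^n - b, contains the other
    roots zeta^i z and so splits X^n - b. *)
Lemma kummer_extension : exists (L : splittingFieldType F) (z : L),
  z ^+ n = b%:A /\ <<1; z>>%VS = fullv.
Proof.
have [|q qirr qdvd] := @irreducible_factor F ('X^n - b%:P).
  by rewrite size_XnsubC.
have [L _ [z zq zL]] := irredp_FAdjoin qirr.
have zn : z ^+ n = b%:A.
  have : root (map_poly (in_alg L) ('X^n - b%:P)) z.
    by move: qdvd; rewrite -(dvdp_map (in_alg L)) => /dvdpP[r ->]; rewrite rootM zq orbT.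
  rewrite rmorphB /= map_polyXn map_polyC /= rootE !hornerE subr_eq0.
  by move/eqP.
pose w := zeta%:A : L.
have wP : n.-primitive_root w by rewrite (fmorph_primitive_root (in_alg L)).
have bA0 : b%:A != 0 :> L by rewrite scaler_eq0 negb_or b0 oner_neq0.
have z0 : z != 0 by apply: contraNneq bA0 => z0; rewrite -zn z0 expr0n eqn0Ngt n_gt0.
pose rs := [seq w ^+ i * z | i <- seq.iota 0 n].
have Lsplit : SplittingField.axiom L.
  exists ('X^n - (b%:A)%:P).
    by rewrite rpredB ?polyOverXn// polyOverC rpredZ// rpred1.
  exists rs; last first.
    apply/eqP; rewrite eqEsubv subvf -zL; apply/FadjoinP; split.
      exact: subv_adjoin_seq.
    apply: seqv_sub_adjoin; apply/mapP; exists 0%N; first by rewrite mem_iota.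
    by rewrite expr0 mul1r.
  have -> : 'X^n - (b%:A)%:P = \prod_(x <- rs) ('X - x%:P) :> {poly L}; last exact: eqpxx.
  rewrite [LHS](@all_roots_prod_XsubC _ _ rs).
  - by rewrite (monicP _) ?scale1r// monicXnsubC.
  - by rewrite size_XnsubC// size_map size_iota.
  - apply/allP => _ /mapP[i _ ->].
    rewrite rootE !hornerE exprMn zn -exprM mulnC exprM (prim_expr_order wP).
    by rewrite expr1n mul1r subrr.
  - rewrite uniq_rootsE map_inj_in_uniq ?seq.iota_uniq// => i j.
    rewrite !mem_iota !add0n /= => iN jN /(mulIf z0)/eqP.
    by rewrite (eq_prim_root_expr wP) !modn_small// => /eqP.
pose L' : splittingFieldType F := HB.pack L (FieldExt_isSplittingField.Build F L Lsplit).
by exists L', z.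
Qed.

(** For L = F(z), z^n = b, the Galois group multiplies z by d-th roots of unity
    with d = |Gal|, all of them, and d divides n; so -b is the norm of the
    product of the - zeta^i z, i < n/d. *)
Lemma kummer_norm (L : splittingFieldType F) (z : L) :
  z ^+ n = b%:A -> <<1; z>>%VS = fullv ->
  abelian_ext L /\ exists2 y : L, y != 0 & galNorm 1 {: L} y = (- b)%:A.
Proof.
move=> zn zL.
pose w := zeta%:A : L.
have wP : n.-primitive_root w by rewrite (fmorph_primitive_root (in_alg L)).
have bA0 : b%:A != 0 :> L by rewrite scaler_eq0 negb_or b0 oner_neq0.
have z0 : z != 0 by apply: contraNneq bA0 => z0; rewrite -zn z0 expr0n eqn0Ngt n_gt0.
have galA (g : gal_of {: L}) c x : g (c%:A * x) = c%:A * g x.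
  by rewrite !mulr_algl linearZ.
have galw (g : gal_of {: L}) i x : g (w ^+ i * x) = w ^+ i * g x.
  by elim: i x => [|i IH] x; rewrite ?mul1r// exprSr -!mulrA IH galA.
have gz (g : gal_of {: L}) : {i : 'I_n | g z = w ^+ i * z}.
  have [|i hi] := prim_rootP wP (x := g z / z).
    rewrite expr_div_n -rmorphXn/= zn -[b%:A]mulr1 galA rmorph1 mulr1.
    by rewrite divff.
  by exists i; rewrite -hi mulfVK.
pose k (g : gal_of {: L}) := sval (gz g).
have kP (g : gal_of {: L}) : g z = w ^+ k g * z by rewrite /k; case: (gz g).
have gal_inj (g h : gal_of {: L}) : g z = h z -> g = h.
  move=> gh; apply/eqP/gal_eqP => x _.
  have xz : x \in <<1; z>>%VS by rewrite zL memvf.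
  have /subvP/(_ x xz) : (<<1; z>> <= fixedField [set (g * h^-1)%g])%VS.
    apply/FadjoinP; split; first exact: sub1v.
    apply/fixedFieldP => [|_ /set1P ->]; first exact: memvf.
    by rewrite galM ?memvf// gh -galM ?memvf// mulgV gal_id.
  move=> /fixedFieldP => /(_ (memvf x) _ (set11 _)).
  rewrite galM ?memvf// => /(congr1 h).
  by rewrite -[h _ in LHS]galM ?memvf// mulVg gal_id.
split.
  apply/centsP => g _ h _; apply: gal_inj.
  by rewrite !galM ?memvf// !kP !galw !kP !mulrA -!exprD addnC.
set Gal := 'Gal({: L} / 1)%g; pose d := #|Gal|.
pose u (g : gal_of {: L}) := w ^+ k g; have uE (g : gal_of {: L}) : g z = u g * z by exact: kP.
have Gal1 (g : gal_of {: L}) : g \in Gal by rewrite gal_kHom ?sub1v ?k1AHom.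
have u_inj : injective u by move=> g h ugh; apply: gal_inj; rewrite !uE ugh.
have uX (g : gal_of {: L}) m : (g ^+ m)%g z = u g ^+ m * z.
  elim: m => [|m IH]; first by rewrite expg0 gal_id mul1r.
  by rewrite expgS galM ?memvf// uE galw IH mulrA -exprS.
have ud (g : gal_of {: L}) : u g ^+ d = 1.
  apply: (mulIf z0); rewrite -uX mul1r (_ : g ^+ d = 1)%g ?gal_id//.
  by apply: cyclic.expg_cardG.
have un (g : gal_of {: L}) : u g ^+ n = 1.
  by rewrite /u -exprM mulnC exprM (prim_expr_order wP) expr1n.
have d0 : (0 < d)%N by rewrite cardG_gt0.
pose rs := [seq u g | g <- enum Gal].
have rs_uniq : uniq rs by rewrite map_inj_uniq ?enum_uniq.
have rs_size : size rs = d by rewrite size_map -cardE.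
have rs_root m : (forall g, u g ^+ m = 1) -> all (root ('X^m - 1)) rs.
  move=> um; apply/allP => _ /mapP[g _ ->].
  by rewrite rootE !hornerE um subrr.
have dn : (d %| n)%N.
  suff dle : (d <= gcdn d n)%N.
    have gE : gcdn d n = d.
      by apply/eqP; rewrite eqn_leq dle dvdn_leq// dvdn_gcdl.
    by have := dvdn_gcdr d n; rewrite gE.
  rewrite -ltnS -{1}rs_size -(size_Xn_sub_1 L (n := gcdn d n)); last first.
    by rewrite gcdn_gt0 d0.
  apply: max_poly_roots => //.
    by rewrite -size_poly_gt0 size_Xn_sub_1 ?gcdn_gt0 ?d0.
  apply: rs_root => g.
  have : (n %| gcdn (k g * d) (k g * n))%N.
    rewrite dvdn_gcd (dvdn_mull _ (dvdnn n)) andbT (prim_order_dvd wP) exprM.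
    exact/eqP/ud.
  by rewrite -muln_gcdr (prim_order_dvd wP) exprM => /eqP.
have prod_u : \prod_(g in Gal) - u g = -1.
  have XE : 'X^d - 1 = \prod_(x <- rs) ('X - x%:P) :> {poly L}.
    rewrite [LHS](@all_roots_prod_XsubC _ _ rs).
    - by rewrite (monicP _) ?scale1r// monicXnsubC.
    - by rewrite size_Xn_sub_1// rs_size.
    - exact: rs_root.
    - by rewrite uniq_rootsE.
  have := congr1 (horner^~ 0) XE.
  rewrite /= hornerD hornerN hornerXn hornerC expr0n eqn0Ngt d0 sub0r => ->.
  rewrite horner_prod big_map big_enum_cond /=; apply: eq_big => [g|g _].
    by rewrite andbT.
  by rewrite hornerXsubC sub0r.
pose m := (n %/ d)%N; have mP : (m * d = n)%N by rewrite divnK.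
have m0 : (0 < m)%N by rewrite divn_gt0// dvdn_leq.
have normE i : galNorm 1 {: L} (- (w ^+ i * z)) = - (w ^+ d) ^+ i * z ^+ d.
  transitivity (\prod_(g in Gal) (- u g * (w ^+ i * z))).
    by apply: eq_bigr => g _; rewrite rmorphN /= galw uE; ring.
  rewrite big_split /= prod_u prodr_const exprMn mulN1r mulNr.
  by rewrite -!exprM mulnC.
have wdP : m.-primitive_root (w ^+ d).
  have -> : d = (n %/ m)%N by rewrite -mP mulKn.
  by apply: dvdn_prim_root => //; rewrite -mP dvdn_mulr.
exists (\prod_(i < m) - (w ^+ i * z)).
  apply/prodf_neq0 => i _; rewrite oppr_eq0 mulf_neq0// expf_neq0//.
  by rewrite scaler_eq0 negb_or oner_neq0 andbT; apply: contra_eq_neq (prim_expr_order zetaP) => ->;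
     rewrite expr0n eqn0Ngt n_gt0 eq_sym oner_neq0.
rewrite galNorm_prod; under eq_bigr => i _ do rewrite normE.
rewrite big_split /=.
rewrite (prod_opp_roots m0 wdP) prodr_const card_ord -exprM mulnC mP zn.
by rewrite scaleNr mulN1r.
Qed.

End Kummer.

(** Skew-symmetry follows from (-b, b) = 1 by bilinearity, and (-b, b) = 1
    because -b is a norm from F(b^(1/n)). *)
Lemma hilbert_skew (F : fieldType) (v : padic_field F) (n : nat)
    (hilb : F -> F -> F) : (0 < n)%N ->
  (exists zeta : F, n.-primitive_root zeta) -> is_hilbert_symbol v n hilb ->
  forall a b, a != 0 -> b != 0 -> hilb a b * hilb b a = 1.
Proof.
move=> n_gt0 [zeta zetaP] [_ hMl hMr [theta [_ theta_norm _ _] thetaE]].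
have hN b : b != 0 -> hilb (- b) b = 1.
  move=> b0; have [L [z [zn zL]]] := kummer_extension n_gt0 zetaP b0.
  have [abL [y y0 Ny]] := kummer_norm n_gt0 zetaP b0 zn zL.
  have Nb0 : - b != 0 by rewrite oppr_eq0.
  have := thetaE L (- b) b z abL Nb0 b0 zn; rewrite (theta_norm L _ y)// gal_id.
  have z0 : z != 0.
    apply: contraNneq b0 => z0; move: zn; rewrite z0 expr0n eqn0Ngt n_gt0 /=.
    by move/esym/eqP; rewrite scaler_eq0 oner_eq0 orbF.
  move=> /eqP; rewrite -{1}[z]scale1r -subr_eq0 -scalerBl scaler_eq0 (negPf z0).
  by rewrite orbF subr_eq0 => /eqP.
move=> a b a0 b0; have ab0 : a * b != 0 by rewrite mulf_neq0.
have Na0 : - a != 0 by rewrite oppr_eq0.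
have Nb0 : - b != 0 by rewrite oppr_eq0.
have := hN _ ab0; rewrite hMr ?oppr_eq0//.
rewrite -{1}mulNr -mulrN hMl// hN// mul1r hMl// [hilb (- b) b]hN// mulr1.
by rewrite mulrC.
Qed.

(** * Quadratic forms and sublattices of a root datum *)

Section RootData.
Variables (r : nat) (RD : root_datum r).
Implicit Types (x y z : 'rV[int]_r) (D : 'M[int]_r).

Lemma pairing_lin x : linear (pairing x : 'rV[int]_r -> int^o).
Proof.
move=> c y z; rewrite /pairing scaler_sumr -big_split; apply: eq_bigr => i _.
by rewrite !mxE mulrDr mulrCA.
Qed.

Lemma pairingC x y : pairing x y = pairing y x.
Proof. by apply: eq_bigr => i _; rewrite mulrC. Qed.

Lemma pairing0 x : pairing x 0 = 0.
Proof. by rewrite /pairing big1// => i _; rewrite mxE mulr0. Qed.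

Lemma pairingDr x y z : pairing x (y + z) = pairing x y + pairing x z.
Proof. by have := pairing_lin x 1 y z; rewrite !scale1r. Qed.

Lemma pairingZr x c y : pairing x (c *: y) = c * pairing x y.
Proof. by have := pairing_lin x c y 0; rewrite pairing0 !addr0. Qed.

Lemma pairingBr x y z : pairing x (y - z) = pairing x y - pairing x z.
Proof. by rewrite pairingDr -scaleN1r pairingZr mulN1r. Qed.

Lemma pairingBl x y z : pairing (x - y) z = pairing x z - pairing y z.
Proof. by rewrite pairingC pairingBr !(pairingC z). Qed.

Lemma pairingZl c x y : pairing (c *: x) y = c * pairing x y.
Proof. by rewrite pairingC pairingZr (pairingC y). Qed.

Lemma pairing_suml (I : Type) (s : seq I) (f : I -> 'rV[int]_r) y :
  pairing (\sum_(i <- s) f i) y = \sum_(i <- s) pairing (f i) y.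
Proof.
elim: s => [|i s IH]; first by rewrite !big_nil pairingC pairing0.
by rewrite !big_cons -IH pairingC pairingDr !(pairingC y).
Qed.

Lemma pairing_delta x i : pairing x (delta_mx 0 i) = x 0 i.
Proof.
rewrite /pairing (bigD1 i)//= mxE !eqxx mulr1 big1 ?addr0// => j /negPf ji.
by rewrite mxE ji andbF mulr0.
Qed.

(** The functional y |-> B_Q(y, z), as an element of X. *)
Definition polar D z : 'rV[int]_r := \row_i \sum_j (D i j + D j i) * z 0 j.

Lemma polar_lin D : linear (polar D).
Proof.
move=> c y z; apply/rowP => i; rewrite !mxE mulr_sumr -big_split.
by apply: eq_bigr => j _; rewrite !mxE mulrDr mulrCA.
Qed.

Lemma pairing_polar D y z : pairing (polar D z) y = bilin D y z + bilin D z y.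
Proof.
rewrite /bilin [X in _ + X]exchange_big -big_split; apply: eq_bigr => i _ /=.
rewrite mxE mulr_suml -big_split; apply: eq_bigr => j _ /=.
by ring.
Qed.

Lemma bilin_linr D y : linear (bilin D y : 'rV[int]_r -> int^o).
Proof.
move=> c u w; rewrite /bilin scaler_sumr -big_split; apply: eq_bigr => i _ /=.
rewrite scaler_sumr -big_split; apply: eq_bigr => j _ /=.
by rewrite !mxE /GRing.scale /=; ring.
Qed.

Lemma bilin_linl D y : linear (bilin D ^~ y : 'rV[int]_r -> int^o).
Proof.
move=> c u w; rewrite /bilin scaler_sumr -big_split; apply: eq_bigr => i _ /=.
rewrite scaler_sumr -big_split; apply: eq_bigr => j _ /=.
by rewrite !mxE /GRing.scale /=; ring.
Qed.

(** Invariance of Q under the reflection in a reads m B(y, a^v) = m^2 Q(a^v) with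
    m = <a, y>; the case m = 0 follows by comparison with y + a^v. *)
Lemma polar_coroot D a : weyl_invariant RD D -> a \in roots RD ->
  polar D (coroot RD a) = bilin D (coroot RD a) (coroot RD a) *: a.
Proof.
move=> Dinv aR; set h := coroot RD a; set q := bilin D h h.
pose B y := bilin D y h + bilin D h y.
have Bh m y : B (y + m *: h) = B y + m * (q + q).
  rewrite /B (addrC y) bilin_linl bilin_linr /GRing.scale /= /q; ring.
have key y : pairing a y * B y = pairing a y * (pairing a y * q).
  have := Dinv a y aR => /=; set m := pairing a y; rewrite -/h.
  have -> : y - m *: h = - m *: h + y by rewrite scaleNr addrC.
  rewrite bilin_linl !bilin_linr /GRing.scale /= -/q /B => E.
  by nia.
have BE y : B y = pairing a y * q.
  have [m0|/mulfI m0] := eqVneq (pairing a y) 0; last exact/m0/key.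
  have := key (y + 1 *: h); rewrite Bh mul1r pairingDr m0 pairingZr.
  by rewrite (root_corootE aR); nia.
apply/rowP => i; rewrite -pairing_delta pairing_polar mxE -(pairing_delta a).
by rewrite -/(B _) BE mulrC.
Qed.

(* a list of roots may have repetitions, which the reflections need not respect *)
Let l := undup (roots RD).

Let inner : 'M[int]_r := \matrix_(i, j) \sum_(a <- l) a 0 i * a 0 j.

Let innerE y z : bilin inner y z = \sum_(a <- l) pairing a y * pairing a z.
Proof.
transitivity (\sum_i \sum_(a <- l) a 0 i * y 0 i * pairing a z).
  apply: eq_bigr => i _.
  transitivity (\sum_j \sum_(a <- l) a 0 i * y 0 i * (a 0 j * z 0 j)).
    apply: eq_bigr => j _; rewrite mxE !mulr_suml; apply: eq_bigr => a _; ring.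
  by rewrite exchange_big; apply: eq_bigr => a _; rewrite -mulr_sumr.
by rewrite exchange_big; apply: eq_bigr => a _; rewrite -mulr_suml.
Qed.

Let inner_invariant : weyl_invariant RD inner.
Proof.
move=> b y bR /=; set h := coroot RD b.
pose s a := a - pairing a h *: b.
have hb : pairing b h = 2 := root_corootE bR.
have sK : involutive s.
  move=> a; rewrite /s pairingBl pairingZl hb.
  have -> : pairing a h - pairing a h * 2 = - pairing a h by ring.
  by rewrite scaleNr opprK subrK.
have sl : perm_eq (map s l) l.
  have su : uniq (map s l) by rewrite (map_inj_uniq (inv_inj sK)) undup_uniq.
  have sub : {subset map s l <= l}.
    move=> _ /mapP[a al ->]; rewrite mem_undup.
    by apply: root_reflect; rewrite // -mem_undup.
  have [|_ sE] := uniq_min_size su sub; first by rewrite size_map.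
  by apply: uniq_perm; rewrite ?undup_uniq.
rewrite !innerE -[RHS](perm_big _ sl) big_map /=; apply: eq_bigr => a _.
by rewrite /s pairingBl pairingBr !pairingZr pairingZl [pairing b y * _]mulrC.
Qed.

(** The form sum_a <a, y><a, z> is Weyl invariant, so that [polar_coroot] applies
    to it; q = sum_a <a, b^v>^2 is positive since <b, b^v> = 2. *)
Let inner_coroot b : b \in roots RD -> exists2 q : int, q != 0 & forall y,
  \sum_(a <- l) (pairing a (coroot RD b) * pairing a y) *+ 2 = q * pairing b y.
Proof.
move=> bR; set h := coroot RD b; exists (bilin inner h h).
  rewrite innerE gt_eqF// (big_rem b) /=; last by rewrite mem_undup.
  apply: ltr_pwDl; first by rewrite (root_corootE bR).
  by apply: sumr_ge0 => a _; rewrite -expr2 sqr_ge0.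
move=> y; rewrite -pairingZl -(polar_coroot inner_invariant)// pairing_polar !innerE -big_split.
by apply: eq_bigr => a _; rewrite mulr2n [X in X + _]mulrC.
Qed.

Lemma common_denominator (I : finType) (c : I -> rat) :
  exists2 N : nat, (0 < N)%N & exists e : I -> int,
    forall i, (e i)%:~R = N%:R * c i :> rat.
Proof.
exists (\prod_i `|denq (c i)|)%N.
  by apply: prodn_gt0 => i; rewrite absz_gt0 denq_neq0.
exists (fun i => (\prod_(j | j != i) `|denq (c j)|)%N%:Z * numq (c i)) => i.
rewrite [in RHS](bigD1 i)//= natrM rmorphM/= numqE -!pmulrn.
have -> : `|denq (c i)|%N%:R = (denq (c i))%:~R :> rat.
  by rewrite pmulrn gez0_abs ?denq_ge0.
by ring.
Qed.

Let k := size l.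
Let root_at (i : 'I_k) := nth 0 l i.
Let P : 'M[rat]_(k, r) := \matrix_(i, j) (root_at i 0 j)%:~R.
Let Q : 'M[rat]_(k, r) := \matrix_(i, j) (coroot RD (root_at i) 0 j)%:~R.

Let root_atR i : root_at i \in roots RD.
Proof. by rewrite -mem_undup mem_nth. Qed.

Let pairing_rat x y :
  \sum_j (x 0 j)%:~R * (y 0 j)%:~R = (pairing x y)%:~R :> rat.
Proof.
by rewrite /pairing rmorph_sum; apply: eq_bigr => j _; rewrite rmorphM.
Qed.

(** The values of the roots on a cocharacter are a rational combination of their
    values on the coroots: by [inner_coroot], Q P^T P = E P with E diagonal and
    invertible, so Q P^T has the rank of P. *)
Let span_coroots : (P^T <= Q *m P^T)%MS.
Proof.
have hq0 i : exists q : int, q != 0 /\ forall y,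
    \sum_(a <- l) (pairing a (coroot RD (root_at i)) * pairing a y) *+ 2 =
    q * pairing (root_at i) y.
  by have [q q0 hq] := inner_coroot (root_atR i); exists q.
have [q hq] := choice hq0.
pose E := diag_mx (\row_i (2 / (q i)%:~R)) : 'M[rat]_k.
have PE : P = E *m (Q *m P^T) *m P.
  apply/matrixP => i j; rewrite -mulmxA mul_diag_mx !mxE.
  have [q0 /(_ (delta_mx 0 j))] := hq i; rewrite pairing_delta => hj.
  transitivity ((2 : rat) / (q i)%:~R * (\sum_(a <- l)
      (pairing a (coroot RD (root_at i)) * a 0 j)%:~R)); last first.
    congr (_ * _); rewrite (big_nth 0) big_mkord; apply: eq_bigr => t _.
    rewrite rmorphM/= !mxE; congr (_ * _); rewrite -pairing_rat.
    by apply: eq_bigr => u _; rewrite !mxE mulrC.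
  have := congr1 (intr : int -> rat) hj; rewrite rmorphM/= => h2.
  have q0' : (q i)%:~R != 0 :> rat by rewrite intr_eq0.
  apply: (mulfI q0'); rewrite -[LHS]h2 rmorph_sum /=.
  rewrite mulrA [_ * (2 / _)]mulrC divfK// mulr_sumr; apply: eq_bigr => a _.
  by rewrite pairing_delta rmorphMn /= mulr_natl.
have QP : (Q *m P^T <= P^T)%MS by exact: submxMl.
have : (\rank P^T <= \rank (Q *m P^T))%N.
  rewrite mxrank_tr {1}PE; apply: leq_trans (mxrankM_maxl _ _) _.
  exact: mxrankM_maxr.
by rewrite (geq_leqif (mxrank_leqif_sup QP)).
Qed.

Lemma derived_cocharD y z : derived_cochar RD y -> derived_cochar RD z ->
  derived_cochar RD (y + z).
Proof.
move=> [i i0 [c yE]] [j j0 [c' zE]]; exists (i * j); first by rewrite mulf_neq0.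
exists (fun a => j * c a + i * c' a).
rewrite scalerDr -{1}(mulrC j) -!scalerA yE zE !scaler_sumr -big_split.
by apply: eq_bigr => a _; rewrite !scalerA scalerDl.
Qed.

Lemma derived_cocharZ c y : derived_cochar RD y -> derived_cochar RD (c *: y).
Proof.
move=> [i i0 [e yE]]; exists i => //; exists (fun a => c * e a).
rewrite scalerA mulrC -scalerA yE scaler_sumr.
by apply: eq_bigr => a _; rewrite scalerA.
Qed.

Let sum_count (f : 'rV[int]_r -> 'rV[int]_r) a (s : seq 'rV[int]_r) :
  \sum_(b <- s) (b == a)%:Z *: f b = (count_mem a s)%:Z *: f a.
Proof.
elim: s => [|b s IH]; first by rewrite big_nil scale0r.
rewrite big_cons IH /= PoszD scalerDl; congr (_ + _).
by case: eqP => [->//|_]; rewrite !scale0r.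
Qed.

Lemma central_cochar_root a y : a \in roots RD -> central_cochar RD y ->
  pairing a y = 0.
Proof.
move=> aR hy; have /eqP : pairing ((count_mem a (roots RD))%:Z *: a) y = 0.
  by apply: hy; exists (fun b => (b == a)%:Z); rewrite (sum_count id).
rewrite pairingZl mulf_eq0 => /orP[|/eqP//].
by rewrite eqz_nat -leqn0 leqNgt -has_count has_pred1 aR.
Qed.

Lemma derived_cochar_coroot a : a \in roots RD -> derived_cochar RD (coroot RD a).
Proof.
move=> aR; exists (count_mem a (roots RD))%:Z.
  by rewrite -lt0n -has_count has_pred1.
by exists (fun b => (b == a)%:Z); rewrite sum_count.
Qed.

Lemma central_cocharP y : (forall a, a \in roots RD -> pairing a y = 0) ->
  central_cochar RD y.
Proof.
move=> h x [c ->]; rewrite pairing_suml big_seq big1// => a aR.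
by rewrite pairingZl h// mulr0.
Qed.

(** By [span_coroots] the roots take the same values on y as on a rational
    combination of coroots; clearing denominators, the difference is a central
    cocharacter. *)
Lemma central_derived_index : exists2 d : nat, (0 < d)%N & forall y,
  exists y1 y2, [/\ central_cochar RD y1, derived_cochar RD y2 & d%:Z *: y = y1 + y2].
Proof.
pose S y := exists y1 y2,
  [/\ central_cochar RD y1, derived_cochar RD y2 & y = y1 + y2].
have S0 : S 0.
  exists 0, 0; split; rewrite ?addr0//; first by move=> x _; rewrite pairing0.
  by exists 1 => //; exists (fun=> 0); rewrite scaler0 big1// => a _; rewrite scale0r.
have SD u w : S u -> S w -> S (u + w).
  move=> [u1 [u2 [hu1 hu2 ->]]] [w1 [w2 [hw1 hw2 ->]]]; exists (u1 + w1), (u2 + w2).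
  split; [|exact: derived_cocharD|by rewrite addrACA].
  by move=> x hx; rewrite pairingDr hu1// hw1.
have SZ c u : S u -> S (c *: u).
  move=> [u1 [u2 [hu1 hu2 ->]]]; exists (c *: u1), (c *: u2).
  split; [|exact: derived_cocharZ|by rewrite scalerDr].
  by move=> x hx; rewrite pairingZr hu1// mulr0.
have each y : exists2 N : nat, (0 < N)%N & S (N%:Z *: y).
  pose yq : 'rV[rat]_r := \row_j (y 0 j)%:~R.
  have /submxP[c hc] : (yq *m P^T <= Q *m P^T)%MS.
    by apply: submx_trans span_coroots; exact: submxMl.
  have [N N0 [e he]] := common_denominator (c 0); exists N => //.
  pose y2 := \sum_i e i *: coroot RD (root_at i).
  exists (N%:Z *: y - y2), y2; split; last by rewrite subrK.
    apply: central_cocharP => a aR; apply/eqP; rewrite pairingBr pairingZr subr_eq0.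
    have [i aE] : exists i : 'I_k, a = root_at i.
      have ia : (index a l < k)%N by rewrite index_mem mem_undup.
      by exists (Ordinal ia); rewrite /root_at nth_index// mem_undup.
    rewrite -(eqr_int rat) rmorphM /= -pmulrn aE; apply/eqP.
    have := congr1 (fun M : 'M_(1, k) => N%:R * M 0 i) hc; rewrite !mxE.
    under eq_bigr => j _ do rewrite !mxE mulrC.
    rewrite pairing_rat => ->.
    rewrite /y2 pairingC pairing_suml rmorph_sum mulr_sumr.
    apply: eq_bigr => j _; rewrite !mxE mulrA -he pairingZl rmorphM /=.
    by congr (_ * _); rewrite -pairing_rat; apply: eq_bigr => t _; rewrite !mxE.
  elim/big_ind : y2 => [||i _].
  - by exists 1 => //; exists (fun=> 0); rewrite scaler0 big1// => a _; rewrite scale0r.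
  - exact: derived_cocharD.
  - by apply: derived_cocharZ; exact: derived_cochar_coroot.
have Nex i : exists N : nat, (0 < N)%N /\ S (N%:Z *: delta_mx 0 i).
  by have [N N0 SN] := each (delta_mx 0 i); exists N.
have [N hN] := choice Nex.
exists (\prod_i N i)%N; first by apply: prodn_gt0 => i; exact: (hN i).1.
move=> y; rewrite [y](row_sum_delta) scaler_sumr.
apply: (big_ind S) => // i _; rewrite scalerA mulrC -scalerA; apply: (SZ _ _).
rewrite (bigD1 i)//= mulnC PoszM -scalerA; apply: SZ; exact: (hN i).2.
Qed.

End RootData.

(** * The derived group and the centre of a split group *)

Section SplitGroup.
Variables (F : fieldType) (r : nat) (RD : root_datum r).
Variable G : split_reductive_group F RD.
Implicit Types (t u : 'rV[F]_r) (a b : F).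

Lemma torus_mulC t u : torus_mul t u = torus_mul u t.
Proof. by apply/rowP => i; rewrite !mxE mulrC. Qed.

Lemma in_torus1 : in_torus (const_mx 1 : 'rV[F]_r).
Proof. by move=> i; rewrite mxE oner_neq0. Qed.

Lemma in_torusM t u : in_torus t -> in_torus u -> in_torus (torus_mul t u).
Proof. by move=> ht hu i; rewrite mxE mulf_neq0. Qed.

Lemma in_torus_cochar (y : 'rV[int]_r) a : a != 0 -> in_torus (cochar y a).
Proof. by move=> a0 i; rewrite mxE expfz_neq0. Qed.

Lemma tor_comm t u : in_torus t -> in_torus u ->
  (tor G t * tor G u = tor G u * tor G t)%g.
Proof. by move=> ht hu; rewrite -!torM// torus_mulC. Qed.

Lemma cocharD (y z : 'rV[int]_r) a : a != 0 ->
  cochar (y + z) a = torus_mul (cochar y a) (cochar z a).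
Proof. by move=> a0; apply/rowP => i; rewrite !mxE expfzDr. Qed.

Lemma char_eval_cochar (x y : 'rV[int]_r) a : a != 0 -> char_eval x (cochar y a) = a ^ pairing x y.
Proof.
move=> a0; rewrite /char_eval /pairing.
transitivity (\prod_i a ^ (x 0 i * y 0 i)).
  by apply: eq_bigr => i _; rewrite mxE exprz_exp mulrC.
rewrite (big_morph (fun k : int => a ^ k) (id1 := 1) (op1 := *%R))//.
by move=> k l; rewrite expfzDr.
Qed.

Lemma char_evalD (x y : 'rV[int]_r) t : in_torus t ->
  char_eval (x + y) t = char_eval x t * char_eval y t.
Proof.
move=> ht; rewrite /char_eval -big_split; apply: eq_bigr => i _.
by rewrite mxE expfzDr.
Qed.

Lemma char_evalZ k (x : 'rV[int]_r) t : in_torus t -> char_eval (k *: x) t = char_eval x t ^ k.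
Proof.
move=> ht; rewrite /char_eval (big_morph (fun c : F => c ^ k) (id1 := 1) (op1 := *%R)).
- by apply: eq_bigr => i _; rewrite mxE exprz_exp mulrC.
- by move=> c d; rewrite expfzMl.
- exact: exp1rz.
Qed.

Lemma char_eval_root_lattice x t : in_torus t ->
  (forall al, al \in roots RD -> char_eval al t = 1) ->
  root_lattice RD x -> char_eval x t = 1.
Proof.
move=> ht ht1 [c ->].
have e0 : char_eval 0 t = 1 by rewrite -(scale0r 0) char_evalZ// expr0z.
elim: (roots RD) ht1 => [|al s IH] h; first by rewrite big_nil.
rewrite big_cons char_evalD// char_evalZ// h ?mem_head// exp1rz mul1r.
by apply: IH => be hbe; apply: h; rewrite in_cons hbe orbT.
Qed.

Lemma tor_central_char t al : in_torus t -> al \in roots RD ->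
  center [set: G] (tor G t) -> char_eval al t = 1.
Proof.
move=> ht hal [_ hc]; apply/eqP; rewrite -subr_eq0; apply/eqP.
apply: (xroot_inj (s := G) hal); rewrite (xrootD G _ _ hal) -[char_eval al t]mulr1.
rewrite -tor_xroot// hc// mulgK -(xrootD G _ _ hal) subrr.
apply: (mulgI (xroot G al 0)); rewrite -(xrootD G _ _ hal) addr0 mulg1.
by [].
Qed.

(** The centralizer of t contains T and the root subgroups, which generate G. *)
Lemma char_tor_central t : in_torus t ->
  (forall al, al \in roots RD -> char_eval al t = 1) ->
  center [set: G] (tor G t).
Proof.
move=> ht ht1; split=> // g _.
pose C := [set g | tor G t * g = g * tor G t]%g.
have C1 : C 1%g by rewrite /C /= mulg1 mul1g.
have CM x y : C x -> C y -> C (x * y)%g.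
  by rewrite /C /= => Cx Cy; rewrite mulgA Cx -mulgA Cy mulgA.
have CV x : C x -> C (x^-1)%g.
  by rewrite /C /= => Cx; apply: (mulgI x); rewrite mulgA -Cx mulgK mulgA mulgV mul1g.
apply: (@points_generated _ _ _ G g (Subgroup C1 CM CV)) => x [[u hu ->]|[al [c [hal ->]]]] /=.
  exact: tor_comm.
have := tor_xroot G c ht hal; rewrite ht1// mul1r => E.
change (tor G t * xroot G al c = xroot G al c * tor G t)%g.
by rewrite -[in RHS]E mulgKV.
Qed.

Lemma tor_cochar_central y a : central_cochar RD y -> a != 0 ->
  center [set: G] (tor G (cochar y a)).
Proof.
move=> hy a0; apply: char_tor_central; first exact: in_torus_cochar.
by move=> al hal; rewrite char_eval_cochar// (central_cochar_root hal).
Qed.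

Let G0 := derived_group G.

Lemma derived_xroot al c : al \in roots RD -> carrier G0 (xroot G al c).
Proof. by move=> hal H; apply; right; exists al, c. Qed.

Lemma derived_tor y a : derived_cochar RD y -> a != 0 -> carrier G0 (tor G (cochar y a)).
Proof. by move=> hy a0 H; apply; left; exists y, a. Qed.

Section Conjugation.
Variable g : G.

Definition conj_set (S : subgroup G) : set G := [set x | carrier S (g * x * g^-1)%g].

Lemma conj_set1 S : conj_set S 1%g.
Proof. by rewrite /conj_set /= mulg1 mulgV; exact: subgroup1. Qed.

Lemma conj_setM S x y : conj_set S x -> conj_set S y -> conj_set S (x * y)%g.
Proof.
rewrite /conj_set /= => hx hy.
have -> : (g * (x * y) * g^-1 = (g * x * g^-1) * (g * y * g^-1))%g.
  by rewrite !mulgA mulgKV.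
exact: subgroupM.
Qed.

Lemma conj_setV S x : conj_set S x -> conj_set S (x^-1)%g.
Proof.
rewrite /conj_set /= => hx.
have -> : (g * x^-1 * g^-1 = (g * x * g^-1)^-1)%g by rewrite !invgM invgK mulgA.
exact: subgroupV.
Qed.

Definition conj_subgroup S := Subgroup (@conj_set1 S) (@conj_setM S) (@conj_setV S).

End Conjugation.

Lemma torus_normalizes_derived t x : in_torus t -> carrier G0 x ->
  carrier G0 (tor G t * x * (tor G t)^-1)%g.
Proof.
move=> ht hx; apply: (hx (conj_subgroup (tor G t) G0)).
move=> _ [[y [a [hy a0 ->]]]|[al [c [hal ->]]]].
  rewrite /= /conj_set /= tor_comm//; last exact: in_torus_cochar.
  by rewrite mulgK; exact: derived_tor.
by rewrite /= /conj_set /= tor_xroot//; exact: derived_xroot.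
Qed.

(** As T normalizes G_0, the products t m form a group; it contains T and the root
    subgroups. *)
Lemma torus_derived_decomposition (g : G) : exists t m,
  [/\ in_torus t, carrier G0 m & g = (tor G t * m)%g].
Proof.
pose S := [set g : G | exists t m,
  [/\ in_torus t, carrier G0 m & g = (tor G t * m)%g]].
have S1 : S 1%g.
  exists (const_mx 1), 1%g; split; [exact: in_torus1|exact: subgroup1|].
  by rewrite tor1 mulg1.
have conjV t x : in_torus t -> carrier G0 x -> carrier G0 ((tor G t)^-1 * x * tor G t)%g.
  move=> ht hx; have [u hu uE] := torusV (ex_intro2 _ _ t ht erefl : torus_set (tor G t)).
  by rewrite uE -[tor G t]invgK uE; exact: torus_normalizes_derived.
have SM x y : S x -> S y -> S (x * y)%g.
  move=> [t [m [ht hm ->]]] [u [k [hu hk ->]]].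
  exists (torus_mul t u), ((tor G u)^-1 * m * tor G u * k)%g; split.
  - exact: in_torusM.
  - by apply: subgroupM => //; exact: conjV.
  - by rewrite torM// !mulgA mulgK.
have SV x : S x -> S (x^-1)%g.
  move=> [t [m [ht hm ->]]].
  have [u hu uE] := torusV (ex_intro2 _ _ t ht erefl : torus_set (tor G t)).
  exists u, (tor G t * m^-1 * (tor G t)^-1)%g; split=> //.
    by apply: torus_normalizes_derived => //; exact: subgroupV.
  by rewrite -uE invgM !mulgA mulVg mul1g.
apply: (@points_generated _ _ _ G g (Subgroup S1 SM SV)) => _ [[t ht ->]|[al [c [hal ->]]]].
  by exists t, 1%g; split; rewrite ?mulg1//; exact: subgroup1.
exists (const_mx 1), (xroot G al c); split; [exact: in_torus1| |by rewrite tor1 mul1g].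
exact: derived_xroot.
Qed.

Lemma derived_normal g x : carrier G0 x -> carrier G0 (g * x * g^-1)%g.
Proof.
move=> hx; have [t [m [ht hm ->]]] := torus_derived_decomposition g.
have -> : (tor G t * m * x * (tor G t * m)^-1 = tor G t * (m * x * m^-1) * (tor G t)^-1)%g.
  by rewrite invgM !mulgA.
apply: torus_normalizes_derived => //; apply: subgroupM; last exact: subgroupV.
exact: subgroupM.
Qed.

Definition central_derived : set G := setmul (center [set: G]) G0.

Lemma central_derived_derived x : carrier G0 x -> central_derived x.
Proof.
by move=> hx; exists 1%g, x; split; rewrite ?mul1g//; split=> // y _; rewrite mul1g mulg1.
Qed.

Lemma central_derived_central x : center [set: G] x -> central_derived x.
Proof. by move=> hx; exists x, 1%g; split; rewrite ?mulg1//; exact: subgroup1. Qed.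

Lemma center_mul x y : center [set: G] x -> center [set: G] y ->
  center [set: G] (x * y)%g.
Proof.
move=> [_ hx] [_ hy]; split=> // z _.
by rewrite -mulgA (hy z I) mulgA (hx z I) -mulgA.
Qed.

Lemma center_inv x : center [set: G] x -> center [set: G] (x^-1)%g.
Proof.
move=> [_ hx]; split=> // z _; apply: (mulgI x).
by rewrite !mulgA mulgV mul1g hx// mulgK.
Qed.

Lemma central_derivedM x y : central_derived x -> central_derived y ->
  central_derived (x * y)%g.
Proof.
move=> [z [m [hz hm ->]]] [w [k [hw hk ->]]]; exists (z * w)%g, (m * k)%g; split.
- exact: center_mul.
- exact: subgroupM.
- by rewrite !mulgA; congr (_ * _)%g; rewrite -!mulgA; congr (_ * _)%g; case: hw => _ ->.
Qed.

Lemma central_derivedV x : central_derived x -> central_derived (x^-1)%g.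
Proof.
move=> [z [m [hz hm ->]]]; have hzV := center_inv hz.
exists (z^-1)%g, (m^-1)%g; split=> //; first exact: subgroupV.
by rewrite invgM; case: hzV => _ ->.
Qed.

Definition central_derived_subgroup : subgroup G :=
  Subgroup (central_derived_derived (subgroup1 G0)) central_derivedM central_derivedV.

Definition torus_exp (t : 'rV[F]_r) (d : nat) : 'rV[F]_r := \row_i t 0 i ^+ d.

Lemma in_torus_exp t d : in_torus t -> in_torus (torus_exp t d).
Proof. by move=> ht i; rewrite mxE expf_neq0. Qed.

Lemma tor_exp t d : in_torus t -> tor G (torus_exp t d) = (tor G t ^+ d)%g.
Proof.
move=> ht; elim: d => [|d IH].
  by rewrite expg0 -tor1; congr tor; apply/rowP => i; rewrite !mxE expr0.
rewrite expgS -IH -torM//; last exact: in_torus_exp.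
by congr tor; apply/rowP => i; rewrite !mxE exprS.
Qed.

(** t^d is the product over i of the (d e_i)(t_i), for the standard basis e_i of Y,
    and d e_i is in Y_c + Y_0. *)
Lemma torus_power_central_derived : exists2 d, (0 < d)%N &
  forall t, in_torus t -> central_derived (tor G (torus_exp t d)).
Proof.
have [d d0 hd] := central_derived_index RD; exists d => // t ht.
pose tm := \big[@torus_mul F r/const_mx 1]_(i < r) cochar (d%:Z *: delta_mx 0 i) (t 0 i).
have -> : torus_exp t d = tm.
  apply/rowP => j; rewrite /tm (big_morph (fun u : 'rV[F]_r => u 0 j) (id1 := 1) (op1 := *%R)).
  - rewrite mxE (bigD1 j)//= big1 => [|i ij].
      by rewrite !mxE !eqxx mulr1 mulr1 exprnP.
    by rewrite !mxE (eq_sym j) (negPf ij) andbF mulr0 expr0z.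
  - by move=> u w; rewrite mxE.
  - by rewrite mxE.
suff [] : in_torus tm /\ central_derived (tor G tm) by [].
apply: (big_ind (fun u => in_torus u /\ central_derived (tor G u))).
- split; first exact: in_torus1.
  by rewrite tor1; apply: central_derived_derived; exact: subgroup1.
- move=> u w [hu cu] [hw cw]; split; first exact: in_torusM.
  by rewrite torM//; exact: central_derivedM.
- move=> i _; have [y1 [y2 [h1 h2 ->]]] := hd (delta_mx 0 i).
  split; first exact: in_torus_cochar.
  rewrite cocharD// torM//; [|exact: in_torus_cochar..].
  apply: central_derivedM.
    by apply: central_derived_central; exact: tor_cochar_central.
  by apply: central_derived_derived; exact: derived_tor.
Qed.

Section Valuation.
Variable v : padic_field F.

Lemma torus_power_classes d : (0 < d)%N ->
  exists (I : finType) (cl : 'rV[F]_r -> I), forall t u, in_torus t -> in_torus u ->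
    cl t = cl u -> exists2 w, in_torus w & u = torus_mul t (torus_exp w d).
Proof.
move=> d0; have [I [cl hcl]] := power_classes_finite v d0.
exists {ffun 'I_r -> I}, (fun t => [ffun i => cl (t 0 i)]) => t u ht hu tu.
have hw i : exists w, w != 0 /\ u 0 i = t 0 i * w ^+ d.
  have /(_ _ _ (ht i) (hu i))[|w w0 wE] := hcl; last by exists w.
  by have := congr1 (fun f : {ffun _} => f i) tu; rewrite !ffunE.
have [w wP] := choice hw; exists (\row_i w i).
  by move=> i; rewrite mxE; case: (wP i).
by apply/rowP => i; rewrite !mxE; case: (wP i).
Qed.

Lemma torus_near1_power d : (0 < d)%N -> exists M : nat, forall t, in_torus t ->
  (forall i, vge v M%:Z (t 0 i - 1)) -> exists2 w, in_torus w & t = torus_exp w d.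
Proof.
move=> d0; have [M hM] := hensel_power v d0; exists M => t ht t1.
have [w wP] := choice (fun i => hM _ (t1 i)); exists (\row_i w i); last first.
  by apply/rowP => i; rewrite !mxE wP.
move=> i; rewrite mxE; apply/eqP => w0; have := ht i.
by rewrite -wP w0 expr0n eqn0Ngt d0 eqxx.
Qed.

End Valuation.

End SplitGroup.

(** X/X^sc is free: the coordinates of k x on a basis are k times those of x. *)
Lemma root_lattice_saturated (r : nat) (RD : root_datum r) (k : int) x :
  connected_center RD -> k != 0 -> root_lattice RD (k *: x) -> root_lattice RD x.
Proof.
move=> [m [b hb]] k0 hkx; have latZ j y : root_lattice RD y -> root_lattice RD (j *: y).
  move=> [c ->]; exists (fun a => j * c a); rewrite scaler_sumr.
  by apply: eq_bigr => a _; rewrite scalerA.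
have [c [hc _]] := hb x; have [c' [_ uniq]] := hb (k *: x).
have e1 : c' = [ffun i => k * c i].
  apply: uniq; have -> : \sum_i [ffun i => k * c i] i *: b i = k *: (\sum_i c i *: b i).
    by rewrite scaler_sumr; apply: eq_bigr => i _; rewrite ffunE scalerA.
  by rewrite -scalerBr; exact: latZ.
have e2 : c' = [ffun=> 0].
  by apply: uniq; rewrite big1 ?subr0// => i _; rewrite ffunE scale0r.
suff c0 : \sum_i c i *: b i = 0 by move: hc; rewrite c0 subr0.
rewrite big1// => i _; have : k * c i = 0.
  by have := congr1 (fun f : {ffun _ -> int} => f i) e1; rewrite e2 !ffunE.
by move=> /eqP; rewrite mulf_eq0 (negPf k0) /= => /eqP ->; rewrite scale0r.
Qed.

Lemma morph_exprz (F : fieldType) (f : F -> F) (a : F) (k : int) :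
  (forall a, a != 0 -> f a != 0) ->
  (forall a b, a != 0 -> b != 0 -> f (a * b) = f a * f b) ->
  a != 0 -> f (a ^ k) = f a ^ k.
Proof.
move=> f0 fM a0.
have f1 : f 1 = 1.
  apply: (mulfI (f0 1 (oner_neq0 F))).
  by rewrite -fM ?oner_neq0// !mulr1.
have fX (m : nat) : f (a ^+ m) = f a ^+ m.
  by elim: m => [//|m IH]; rewrite !exprS fM ?expf_neq0// IH.
case: k => m; first by rewrite -!exprnP.
rewrite NegzE -!exprnN; apply: (mulfI (f0 _ (expf_neq0 m.+1 a0))).
by rewrite -fM ?invr_neq0 ?expf_neq0// divff ?expf_neq0// f1 fX divff// expf_neq0// f0.
Qed.

(** * Commutators in the cover *)

Section Cover.
Variables (F : fieldType) (v : padic_field F) (n : nat) (hilb : F -> F -> F).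
Variables (r : nat) (RD : root_datum r) (G : split_reductive_group F RD).
Variables (D : 'M[int]_r) (eta : 'rV[int]_r -> F).
Variable Gb : bd_cover n hilb G D eta.
Hypothesis n_gt0 : (0 < n)%N.

Local Notation pr := (@proj _ _ _ _ _ _ _ _ Gb).
Local Notation io := (iota Gb).

Lemma proj1g : pr 1%g = 1%g.
Proof. exact: morph_g1 (@projM _ _ _ _ _ _ _ _ Gb). Qed.

Lemma projV x : pr (x^-1)%g = ((pr x)^-1)%g.
Proof. by apply: (mulgI (pr x)); rewrite -projM !mulgV proj1g. Qed.

Lemma projX x m : pr (x ^+ m)%g = (pr x ^+ m)%g.
Proof. by elim: m => [|m IH]; rewrite ?proj1g// !expgS projM IH. Qed.

Lemma iota1 : io 1 = 1%g.
Proof.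
by apply: (mulgI (io 1)); rewrite -iotaM ?expr1n// mulr1 mulg1.
Qed.

Lemma proj_iota z : z ^+ n = 1 -> pr (io z) = 1%g.
Proof. by move=> zn; apply/proj_ker; exists z. Qed.

Lemma proj_eq x y : pr x = pr y -> exists2 z, z ^+ n = 1 & x = (io z * y)%g.
Proof.
move=> xy; have /proj_ker[z zn hz] : pr (x * y^-1)%g = 1%g.
  by rewrite projM projV xy mulgV.
by exists z => //; rewrite -hz mulgKV.
Qed.

Lemma commutator_mu x y : (pr x * pr y = pr y * pr x)%g ->
  exists2 z, z ^+ n = 1 & (x * y = io z * (y * x))%g.
Proof. by move=> xy; apply: proj_eq; rewrite !projM. Qed.

(** From x y = z y x with z central one gets x^m y = z^m y x^m, and z^n = 1. *)
Lemma power_commute x y : (pr x * pr y = pr y * pr x)%g ->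
  (x ^+ n * y = y * x ^+ n)%g.
Proof.
move=> /commutator_mu[z zn xy].
have key m : (x ^+ m * y = io (z ^+ m) * (y * x ^+ m))%g.
  elim: m => [|m IH]; first by rewrite !expg0 iota1 !mul1g mulg1.
  have zmn k : (z ^+ k) ^+ n = 1 by rewrite -exprM mulnC exprM zn expr1n.
  rewrite expgS -mulgA IH mulgA -(iota_central x (zmn m)) -mulgA [(x * _)%g]mulgA xy.
  by rewrite !mulgA -(iotaM Gb (zmn m) zn) -exprSr.
by rewrite key zn iota1 mul1g.
Qed.

Lemma commute_lift x y y' : pr y = pr y' -> (x * y' = y' * x)%g -> (x * y = y * x)%g.
Proof.
move=> /proj_eq[z zn ->] xy; rewrite mulgA -(iota_central x zn) -!mulgA.
by rewrite xy.
Qed.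

Lemma center_torus g : center [set: G] g -> exists2 t, in_torus t & g = tor G t.
Proof. by move=> [_ gc]; apply: tor_centralizer => t _; exact: gc. Qed.

Lemma center_bar1 : center_bar Gb 1%g.
Proof.
by rewrite /center_bar /= /preimage /= proj1g; split=> // y _; rewrite mul1g mulg1.
Qed.

Lemma center_barM x y : center_bar Gb x -> center_bar Gb y -> center_bar Gb (x * y)%g.
Proof. by rewrite /center_bar /preimage /= projM; exact: center_mul. Qed.

Lemma center_barV x : center_bar Gb x -> center_bar Gb (x^-1)%g.
Proof. by rewrite /center_bar /preimage /= projV; exact: center_inv. Qed.

Definition center_bar_subgroup : subgroup Gb :=
  Subgroup center_bar1 center_barM center_barV.

Lemma center_bar_torus x : center_bar Gb x -> carrier (torus_bar Gb) x.
Proof. by move=> /center_torus[t ht hx]; exists t. Qed.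

Lemma torus_bar_comm x y : carrier (torus_bar Gb) x -> carrier (torus_bar Gb) y ->
  (pr x * pr y = pr y * pr x)%g.
Proof. by move=> [t ht ->] [u hu ->]; exact: tor_comm. Qed.

Lemma iota_center_bar z : z ^+ n = 1 -> center_bar Gb (io z).
Proof.
move=> zn; rewrite /center_bar /preimage /= proj_iota//.
by split=> // y _; rewrite mul1g mulg1.
Qed.

Section CentralCommutes.
Hypothesis ZG_connected : connected_center RD.
Hypothesis D_inv : weyl_invariant RD D.
Hypothesis skew : forall a b, a != 0 -> b != 0 -> hilb a b * hilb b a = 1.
Hypothesis hilbX : forall a b, a != 0 -> b != 0 -> hilb a b ^+ n = 1.
Hypothesis hilbMl : forall a b c, a != 0 -> b != 0 -> c != 0 ->
  hilb (a * b) c = hilb a c * hilb b c.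
Hypothesis hilbMr : forall a b c, a != 0 -> b != 0 -> c != 0 ->
  hilb a (b * c) = hilb a b * hilb a c.

Let hilb0 a b : a != 0 -> b != 0 -> hilb a b != 0.
Proof.
move=> a0 b0; apply/eqP => h; have := hilbX a0 b0.
by rewrite h expr0n eqn0Ngt n_gt0 => /esym/eqP; rewrite oner_eq0.
Qed.

Let hilb_expl a b k : a != 0 -> b != 0 -> hilb (a ^ k) b = hilb a b ^ k.
Proof.
move=> a0 b0; apply: (morph_exprz (f := hilb^~ b)) => // [c c0|c d c0 d0].
  exact: hilb0.
exact: hilbMl.
Qed.

Let hilb_expr a b k : a != 0 -> b != 0 -> hilb a (b ^ k) = hilb a b ^ k.
Proof.
move=> a0 b0; apply: (morph_exprz (f := hilb a)) => // [c c0|c d c0 d0].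
  exact: hilb0.
exact: hilbMr.
Qed.

(** B_Q(-, y) is a combination of roots when y lies in the coroot lattice; by
    saturation of the root lattice this persists on the derived cocharacters. *)
Lemma polar_derived y : derived_cochar RD y -> root_lattice RD (polar D y).
Proof.
move=> [k k0 [c hc]]; apply: (root_lattice_saturated ZG_connected k0).
have -> : k *: polar D y = polar D (k *: y) by rewrite (linZ (@polar_lin r D)).
rewrite hc; exists (fun a => c a * bilin D (coroot RD a) (coroot RD a)).
rewrite (lin_sum (@polar_lin r D)) big_seq [RHS]big_seq; apply: eq_bigr => a aR.
by rewrite (linZ (@polar_lin r D)) polar_coroot// scalerA.
Qed.

(** By skew-symmetry the commutator of t and y(a) is the Hilbert symbol of a with
    the value at t of the character B_Q(-, y), a combination of roots. *)
Lemma sec_commute t y a : in_torus t ->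
  (forall al, al \in roots RD -> char_eval al t = 1) ->
  derived_cochar RD y -> a != 0 ->
  (sec Gb t * sec Gb (cochar y a) = sec Gb (cochar y a) * sec Gb t)%g.
Proof.
move=> ht ht1 hy a0; have hu := in_torus_cochar y a0; set u := cochar y a.
rewrite !secM// torus_mulC; congr (_ * iota Gb _)%g.
have uE j : u 0 j = a ^ y 0 j by rewrite mxE.
transitivity ((\prod_i \prod_j hilb (t 0 i) (u 0 j) ^ (- D j i)) *
    \prod_i \prod_j hilb (t 0 i) (u 0 j) ^ (D i j + D j i)).
  rewrite -big_split; apply: eq_bigr => i _; rewrite -big_split; apply: eq_bigr => j _.
  by rewrite /= -expfzDr ?hilb0//; congr (_ ^ _); ring.
have -> : \prod_i \prod_j hilb (t 0 i) (u 0 j) ^ (D i j + D j i) = 1.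
  transitivity (hilb (char_eval (polar D y) t) a).
    rewrite /char_eval.
    have -> : hilb (\prod_i t 0 i ^ polar D y 0 i) a =
        \prod_i hilb (t 0 i) a ^ polar D y 0 i.
      suff [] : \prod_i t 0 i ^ polar D y 0 i != 0 /\
        hilb (\prod_i t 0 i ^ polar D y 0 i) a = \prod_i hilb (t 0 i) a ^ polar D y 0 i by [].
      elim/big_ind2 : _ => [|c c' d d' [c0 cE] [d0 dE]|i _].
      - by split; rewrite ?oner_neq0//; have := hilb_expl 0 a0 a0; rewrite !expr0z.
      - by split; rewrite ?mulf_neq0// hilbMl// cE dE.
      - by rewrite expfz_neq0// hilb_expl.
    apply: eq_bigr => i _; rewrite mxE.
    rewrite (big_morph (fun k : int => hilb (t 0 i) a ^ k) (id1 := 1) (op1 := *%R))//.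
      by apply: eq_bigr => j _; rewrite uE hilb_expr// exprz_exp mulrC.
    by move=> k l; rewrite expfzDr// hilb0.
  rewrite (char_eval_root_lattice ht ht1 (polar_derived hy)).
  by have := hilb_expl 0 a0 a0; rewrite !expr0z.
rewrite mulr1 exchange_big; apply: eq_bigr => j _; apply: eq_bigr => i _ /=.
rewrite -exprz_inv; congr (_ ^ _).
have ti := ht i; have uj := hu j; have h0 := hilb0 ti uj.
by apply: (mulfI h0); rewrite divff// skew.
Qed.

(** The elements of G with a lift commuting with x form a group, so it is enough to
    look at generators of G_0: [sec_commute] deals with the torus, and the lift of
    a root subgroup is divisible, hence consists of n-th powers. *)
Lemma center_bar_derived_commute x y : center_bar Gb x ->
  carrier (derived_group G) (pr y) -> (x * y = y * x)%g.
Proof.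
move=> xc hy; have [t ht xt] := center_torus xc.
have ht1 al : al \in roots RD -> char_eval al t = 1.
  by move=> hal; apply: (tor_central_char (G := G)) => //; rewrite -xt.
pose S := [set g : G | exists2 y, pr y = g & (x * y = y * x)%g].
have S1 : S 1%g by exists 1%g; rewrite ?proj1g// mulg1 mul1g.
have SM g h : S g -> S h -> S (g * h)%g.
  move=> [a <- xa] [b <- xb]; exists (a * b)%g; first by rewrite projM.
  by rewrite mulgA xa -mulgA xb mulgA.
have SV g : S g -> S (g^-1)%g.
  move=> [a <- xa]; exists (a^-1)%g; first by rewrite projV.
  by apply: (mulgI a); rewrite mulgA -xa mulgK mulgA mulgV mul1g.
suff [y' yy' xy'] : S (pr y) by exact: commute_lift (esym yy') xy'.
apply: (hy (Subgroup S1 SM SV)) => _ [[z [a [hz a0 ->]]]|[al [c [hal ->]]]].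
  exists (sec Gb (cochar z a)).
    by rewrite proj_sec//; exact: in_torus_cochar.
  have /commute_lift h : pr x = pr (sec Gb t) by rewrite proj_sec.
  by apply/esym/h/esym; exact: sec_commute.
have xl0 : xlift Gb al 0 = 1%g.
  apply: (mulgI (xlift Gb al 0)).
  by rewrite -xliftD// addr0 mulg1.
have xl_mulrn m w : xlift Gb al (w *+ m) = (xlift Gb al w ^+ m)%g.
  elim: m => [|m IH]; first by rewrite mulr0n xl0 expg0.
  by rewrite mulrS xliftD// IH expgS.
exists (xlift Gb al c); first by rewrite proj_xlift.
have nF := padic_natr_neq0 v n_gt0.
have -> : xlift Gb al c = (xlift Gb al (c / n%:R) ^+ n)%g.
  rewrite -[c in LHS](divfK nF) mulr_natr.
  exact: xl_mulrn.
by apply/esym/power_commute; case: xc => _ /(_ (pr (xlift Gb al (c / n%:R))) I) ->.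
Qed.

End CentralCommutes.
End Cover.

(** * The subgroup generated by the centre and the derived group *)

Section Dagger.
Variables (F : fieldType) (v : padic_field F) (n : nat) (hilb : F -> F -> F).
Variables (r : nat) (RD : root_datum r) (G : split_reductive_group F RD).
Variables (D : 'M[int]_r) (eta : 'rV[int]_r -> F).
Variable Gb : bd_cover n hilb G D eta.
Hypothesis n_gt0 : (0 < n)%N.

Local Notation pr := (@proj _ _ _ _ _ _ _ _ Gb).
Local Notation io := (iota Gb).
Local Notation Tb := (torus_bar Gb).

(** Elements are labelled by the class of their image in T modulo n-th powers,
    which are central by [power_commute]. *)
Lemma torus_bar_center_index : fin_index Tb (center Tb).
Proof.
have [I [cl hcl]] := torus_power_classes r v n_gt0.
pose tt (x : Gb) := xget (const_mx 1) [set t | in_torus t /\ pr x = tor G t].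
have ttP x : carrier Tb x -> in_torus (tt x) /\ pr x = tor G (tt x).
  move=> [t ht hx]; rewrite /tt.
  by case: xgetP => [y -> //|/(_ t)/(_ (conj ht hx))].
exists I, (fun x => cl (tt x)) => x y Tx Ty xy.
have [hx px] := ttP x Tx; have [hy py] := ttP y Ty.
split; first by apply: subgroupM => //; exact: subgroupV.
have [w hw tyE] := hcl _ _ hx hy xy; have [wb pwb] := proj_surj Gb (tor G w).
move=> g Tg; have [g' hg' pg'] := Tg.
have pwn : pr (x^-1 * y)%g = pr (wb ^+ n)%g.
  rewrite projX pwb -tor_exp// projM projV py tyE torM -?px ?mulKg//.
  exact: in_torus_exp.
apply/esym; apply: (commute_lift pwn); apply/esym; apply: power_commute => //.
by rewrite pwb pg' tor_comm.
Qed.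

Section LeviSubgroup.
Variable M : subgroup G.
Hypothesis TM : forall g, carrier (torus G) g -> carrier M g.

Definition derived_bar : set Gb := @proj _ _ _ _ _ _ _ _ Gb @^-1` (M `&` derived_group G).

(** M^dag, for a Levi subgroup M as well as for M = T. *)
Definition dagger : set Gb := setmul (center_bar Gb) derived_bar.

Lemma derived_bar1 : derived_bar 1%g.
Proof. rewrite /derived_bar /preimage /= proj1g.
by split; [exact: (subgroup1 M)|exact: (subgroup1 (derived_group G))]. Qed.

Lemma derived_barM x y : derived_bar x -> derived_bar y -> derived_bar (x * y)%g.
Proof.
rewrite /derived_bar /preimage /= projM => -[hx hx'] [hy hy'].
by split; [exact: (subgroupM (s := M))|exact: (subgroupM (s := derived_group G))].
Qed.

Lemma derived_barV x : derived_bar x -> derived_bar (x^-1)%g.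
Proof.
rewrite /derived_bar /preimage /= projV => -[hx hx'].
by split; [exact: (subgroupV (s := M))|exact: (subgroupV (s := derived_group G))].
Qed.

Definition derived_bar_subgroup : subgroup Gb :=
  Subgroup derived_bar1 derived_barM derived_barV.

Lemma center_M g : center [set: G] g -> carrier M g.
Proof. by move=> /center_torus[t ht ->]; apply: TM; exists t. Qed.

Lemma daggerP x : dagger x <-> carrier M (pr x) /\ central_derived (pr x).
Proof.
split=> [[z [m [zc [Mm Gm] ->]]]|[Mx [c [k [hc hk xck]]]]].
  rewrite projM; split; first by apply: subgroupM => //; exact: center_M.
  by exists (pr z), (pr m).
have [z zc] := proj_surj Gb c; exists z, (z^-1 * x)%g.
have kE : pr (z^-1 * x)%g = k by rewrite projM projV zc xck mulKg.
split; rewrite ?mulgA ?mulgV ?mul1g//; first by rewrite /center_bar /preimage /= zc.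
rewrite /derived_bar /preimage /= kE; split=> //.
have -> : k = (c^-1 * pr x)%g by rewrite xck mulKg.
by apply: subgroupM => //; apply: subgroupV; exact: center_M.
Qed.

Lemma dagger_bar x : dagger x -> carrier (preim Gb M) x.
Proof. by move=> /daggerP[]. Qed.

Lemma center_dagger x : center_bar Gb x -> dagger x.
Proof. by exists x, 1%g; split; rewrite ?mulg1//; exact: derived_bar1. Qed.

Lemma derived_dagger x : derived_bar x -> dagger x.
Proof. by exists 1%g, x; split; rewrite ?mul1g//; exact: center_bar1. Qed.

Lemma dagger1 : dagger 1%g.
Proof. exact/center_dagger/center_bar1. Qed.

Lemma daggerM x y : dagger x -> dagger y -> dagger (x * y)%g.
Proof.
move=> /daggerP[Mx cx] /daggerP[My cy]; apply/daggerP; rewrite projM.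
by split; [exact: subgroupM|exact: central_derivedM].
Qed.

Lemma daggerV x : dagger x -> dagger (x^-1)%g.
Proof.
move=> /daggerP[Mx cx]; apply/daggerP; rewrite projV.
by split; [exact: subgroupV|exact: central_derivedV].
Qed.

Definition dagger_subgroup : subgroup Gb := Subgroup dagger1 daggerM daggerV.

Lemma bar_conj (H : subgroup G) x y : carrier (preim Gb H) x ->
  carrier (preim Gb H) y -> carrier (preim Gb H) (x * y * x^-1)%g.
Proof.
move=> hx hy; apply: subgroupM; first exact: subgroupM.
exact: subgroupV.
Qed.

Lemma proj_conj x y : pr (x * y * x^-1)%g = (pr x * pr y * (pr x)^-1)%g.
Proof. by rewrite !projM projV. Qed.

Lemma derived_bar_normal x k : carrier (preim Gb M) x -> derived_bar k ->
  derived_bar (x * k * x^-1)%g.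
Proof.
move=> Mx [Mk Gk]; split; first exact: (bar_conj Mx Mk).
by rewrite proj_conj; exact: derived_normal.
Qed.

Lemma center_bar_normal x k : center_bar Gb k -> center_bar Gb (x * k * x^-1)%g.
Proof.
rewrite /center_bar /preimage /= proj_conj => kc.
by case: (kc) => _ /(_ (pr x) I) <-; rewrite mulgK.
Qed.

Lemma dagger_normal x k : carrier (preim Gb M) x -> dagger k ->
  dagger (x * k * x^-1)%g.
Proof.
move=> Mx [z [m [zc hm ->]]]; exists (x * z * x^-1)%g, (x * m * x^-1)%g; split.
- exact: center_bar_normal.
- exact: derived_bar_normal.
- by rewrite !mulgA mulgKV.
Qed.

(** From G = T G_0.  The actions of the theorem are only defined on the preimage of
    T, and this lets them control all cosets. *)
Lemma dagger_torus_coset g : carrier (preim Gb M) g ->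
  exists k t, [/\ dagger k, carrier Tb t & g = (k * t)%g].
Proof.
move=> Mg; have [t [m [ht hm pg]]] := torus_derived_decomposition (pr g).
have pt := proj_sec Gb ht; have Tt : carrier Tb (sec Gb t) by exists t.
have Mt : carrier (preim Gb M) (sec Gb t) by apply: TM.
exists (g * (sec Gb t)^-1)%g, (sec Gb t); split; rewrite ?mulgKV//.
apply: derived_dagger; split.
  by apply: (subgroupM (s := preim Gb M)) => //; exact: subgroupV.
by rewrite projM projV pg pt; exact: derived_normal.
Qed.

(** The T-components of two elements of G = T G_0 differ by a d-th power, hence by
    an element of Z(G) G_0, once they are in the same class modulo d-th powers. *)
Lemma dagger_index : fin_index (preim Gb M) dagger_subgroup.
Proof.
have [d d0 hd] := torus_power_central_derived G.
have [I [cl hcl]] := torus_power_classes r v d0.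
have hx x : exists t, in_torus t /\
    exists2 m, carrier (derived_group G) m & pr x = (tor G t * m)%g.
  by have [t [m [ht hm xE]]] := torus_derived_decomposition (pr x); exists t; split=> //; exists m.
have [tt ttP] := choice hx.
exists I, (fun x => cl (tt x)) => x y Mx My xy.
have [tx [m hm px]] := ttP x; have [ty [k hk py]] := ttP y.
have [w hw tyE] := hcl _ _ tx ty xy.
have hwd := in_torus_exp d hw.
apply/daggerP; rewrite projM projV; split.
  by apply: subgroupM => //; exact: subgroupV.
rewrite px py tyE torM//.
have -> : ((tor G (tt x) * m)^-1 * (tor G (tt x) * tor G (torus_exp w d) * k) =
           m^-1 * (tor G (torus_exp w d) * k))%g.
  by rewrite invgM -!mulgA mulKg.
apply: central_derivedM.
  by apply: central_derived_derived; exact: subgroupV.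
by apply: central_derivedM; [exact: hd|exact: central_derived_derived].
Qed.

(** Deep congruence subgroups meet T in d-th powers, so the dagger subgroup is
    open. *)
Lemma dagger_open : exists2 N, nbhd1 (cover_topology v Gb) N &
  forall x, carrier (preim Gb M) x -> N x -> carrier dagger_subgroup x.
Proof.
clear n_gt0; have [d d0 hd] := torus_power_central_derived G.
have [m hm] := torus_near1_power r v d0.
exists [set x | forall gm, gm \in [:: (1%g : Gb, m)] ->
  carrier (congruence_set v Gb gm.2) (gm.1^-1 * x * gm.1)%g].
  by exists [:: (1%g : Gb, m)].
move=> x Mx /(_ (1%g, m)); rewrite mem_head => /(_ isT) /=.
rewrite invg1 mul1g mulg1 => cx; apply/daggerP; split=> //.
apply: (cx (preim Gb (central_derived_subgroup G))).
move=> _ [[a [u [ha _ ->]]]|[t [ht t1 ->]]].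
  rewrite /= /preimage /= proj_xlift//; apply: central_derived_derived.
  exact: derived_xroot.
rewrite /= /preimage /= proj_sec//.
have [|w hw ->] := hm t ht; last exact: hd.
by move=> i; apply: vge_le (t1 i); lia.
Qed.

End LeviSubgroup.
End Dagger.

Arguments derived_bar {F n hilb r RD G D eta} Gb M _.
Arguments dagger {F n hilb r RD G D eta} Gb M _.

(** * Genuine representations *)

(** The uniqueness half of the universal property, for bare linear maps. *)
Lemma tensor_ext (C : fieldType) (V U W Z : lmodType C) (t : V -> U -> W)
    (f g : W -> Z) : is_tensor t -> linear f -> linear g ->
  (forall v u, f (t v u) = g (t v u)) -> forall w, f w = g w.
Proof.
move=> [tl tr univ] f_lin g_lin fg w.
have [|v c u u'|h [_ huniq]] := univ Z (fun v u => f (t v u)).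
- by move=> u c v v' /=; rewrite tl f_lin.
- by rewrite tr f_lin.
pose f' : {linear W -> Z} := HB.pack f (GRing.isLinear.Build _ _ _ _ f f_lin).
pose g' : {linear W -> Z} := HB.pack g (GRing.isLinear.Build _ _ _ _ g g_lin).
have hf : h = f' by apply: huniq.
have hg : h = g' by apply: huniq => v u; rewrite fg.
by rewrite -[f w]/(f' w) -hf hg.
Qed.

Section CenterSubgroup.
Variables (G : groupType) (L : subgroup G).

Lemma center1 : center L 1%g.
Proof. by split=> [|y _]; [exact: subgroup1|rewrite mul1g mulg1]. Qed.

Lemma centerM x y : center L x -> center L y -> center L (x * y)%g.
Proof.
move=> [Lx xc] [Ly yc]; split; first exact: subgroupM.
by move=> z Lz; rewrite -mulgA (yc z Lz) mulgA (xc z Lz) -mulgA.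
Qed.

Lemma centerV x : center L x -> center L (x^-1)%g.
Proof.
move=> [Lx xc]; split; first exact: subgroupV.
by move=> z Lz; apply: (mulgI x); rewrite !mulgA mulgV mul1g xc// mulgK.
Qed.

Definition center_subgroup : subgroup G := Subgroup center1 centerM centerV.

Lemma center_normal (H : subgroup G) x z :
  (forall x k, carrier H x -> carrier L k -> carrier L (x * k * x^-1)%g) ->
  carrier H x -> center L z -> center L (x * z * x^-1)%g.
Proof.
move=> nLH Hx [Lz zc]; split; first exact: nLH.
move=> y Ly; have := zc _ (nLH _ _ (subgroupV Hx) Ly); rewrite invgK => E.
apply: (mulgI (x^-1)%g); apply: (mulIg x).
by rewrite !mulgA mulVg mul1g mulgKV; move: E; rewrite !mulgA.
Qed.

End CenterSubgroup.

Section Genuine.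
Variables (F : fieldType) (v : padic_field F) (n : nat) (hilb : F -> F -> F).
Variables (r : nat) (RD : root_datum r) (G : split_reductive_group F RD).
Variables (D : 'M[int]_r) (eta : 'rV[int]_r -> F).
Variable Gb : bd_cover n hilb G D eta.
Hypothesis n_gt0 : (0 < n)%N.
Variables (C : numClosedFieldType) (eps : F -> C).
Hypothesis eps_emb : is_mu_embedding n eps.

Local Notation pr := (@proj _ _ _ _ _ _ _ _ Gb).
Local Notation io := (iota Gb).
Local Notation Tb := (torus_bar Gb).

Lemma eps1 : eps 1 = 1. Proof. by case: eps_emb. Qed.

Lemma eps_eq1 z : z ^+ n = 1 -> eps z = 1 -> z = 1.
Proof.
move=> zn ez; have [_ _ eps_inj] := eps_emb.
by apply: eps_inj; rewrite ?expr1n// eps1.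
Qed.

Lemma iota_inj_mu z w : z ^+ n = 1 -> w ^+ n = 1 -> io z = io w -> z = w.
Proof.
move=> zn wn zw; have w0 : w != 0.
  by apply/eqP => w0; move: wn; rewrite w0 expr0n eqn0Ngt n_gt0 => /esym/eqP; rewrite oner_eq0.
have wVn : w^-1 ^+ n = 1 by rewrite exprVn wn invr1.
have zwn : (z / w) ^+ n = 1 by rewrite exprMn zn wVn mulr1.
suff : z / w = 1 by move=> h; rewrite -(divfK w0 z) h mul1r.
apply: (iota_inj (b := Gb)) => //.
by rewrite iotaM// zw -iotaM// divff// iota1.
Qed.

(** The commutator [x, y] read in C; the default value 1 is only taken when the
    images of x and y in G do not commute. *)
Definition comm_scalar (x y : Gb) : C :=
  eps (xget 1 [set z | z ^+ n = 1 /\ (x * y = io z * (y * x))%g]).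

Lemma comm_scalarE x y z : z ^+ n = 1 -> (x * y = io z * (y * x))%g ->
  comm_scalar x y = eps z.
Proof.
move=> zn xy; rewrite /comm_scalar; congr eps.
case: xgetP => [w _ [wn xyw]|/(_ z)/(_ (conj zn xy))//].
by apply: iota_inj_mu => //; apply: (mulIg (y * x)%g); rewrite -xy -xyw.
Qed.

(** Stone-von Neumann: over a subgroup of the preimage of T, the genuine
    representations with a given central character are multiples of one
    irreducible representation. *)
Lemma isotypic_genuine (L : subgroup Gb) (V W : rep C L) :
  (forall x, carrier L x -> carrier Tb x) ->
  genuine eps V -> fin_dim V -> irreducible W ->
  (forall z, center L z -> exists a,
    (forall u, rep_act V z u = a *: u) /\ (forall w, rep_act W z w = a *: w)) ->
  exists e, rep_iso V (multiple e W).
Proof.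
move=> LT gen fd irr cent.
have fin : fin_index L (center_subgroup L).
  have [I [cl hcl]] := torus_bar_center_index v Gb n_gt0.
  exists I, cl => x y Lx Ly xy; have [_ hc] := hcl x y (LT x Lx) (LT y Ly) xy.
  split; first by apply: subgroupM => //; exact: subgroupV.
  by move=> z Lz; apply: hc; exact: LT.
have [I [s tr]] := fin_index_transversal fin (fun x xc => proj1 xc).
have comm x y : carrier L x -> carrier L y ->
    exists2 z, z ^+ n = 1 & (x * y = io z * (y * x))%g.
  by move=> Lx Ly; apply: commutator_mu; apply: torus_bar_comm; exact: LT.
have [_ epsM _] := eps_emb.
have c1 x y : (x * y = y * x)%g -> comm_scalar x y = 1.
  by move=> xy; rewrite (@comm_scalarE x y 1) ?expr1n ?eps1// iota1 mul1g.
apply: (isotypic (s := s) (c := comm_scalar) tr) => //.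
- by move=> z [].
- move=> x y u Lx Ly; have [z zn xy] := comm x y Lx Ly.
  have Lyx : carrier L (y * x)%g by exact: subgroupM.
  have Lz : carrier L (io z).
    rewrite -(mulgK (y * x)%g (io z)) -xy; apply: subgroupM; last exact: subgroupV.
    exact: subgroupM.
  by rewrite (comm_scalarE zn xy) -!rep_actM// xy rep_actM// gen.
- move=> x y g Lx Ly Lg; have [z zn xg] := comm x g Lx Lg; have [w wn yg] := comm y g Ly Lg.
  rewrite (comm_scalarE zn xg) (comm_scalarE wn yg) -epsM//.
  apply: comm_scalarE; first by rewrite exprMn zn wn mulr1.
  rewrite -mulgA yg mulgA -(iota_central x wn) -mulgA [(x * (g * y))%g]mulgA xg.
  by rewrite mulrC iotaM// !mulgA.
- by move=> x z Lx [Lz zc]; split; apply: c1; rewrite zc.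
- move=> g Lg h; split=> // x Lx; have [z zn xg] := comm x g Lx Lg.
  have := h x Lx; rewrite (comm_scalarE zn xg) => /(eps_eq1 zn) z1.
  by rewrite xg z1 iota1 mul1g.
Qed.

Lemma genuine_sub (H K : subgroup Gb) (pi : rep C H) (W : rep C K) (j : W -> pi) :
  (forall z, z ^+ n = 1 -> carrier K (io z)) -> linear j -> injective j ->
  (forall h w, carrier K h -> j (rep_act W h w) = rep_act pi h (j w)) ->
  genuine eps pi -> genuine eps W.
Proof.
move=> Kmu j_lin j_inj j_hom gen z w zn; apply: j_inj.
by rewrite j_hom ?gen ?linZ//; exact: Kmu.
Qed.

Section InducedFromDagger.
Variable M : subgroup G.
Hypothesis TM : forall g, carrier (torus G) g -> carrier M g.
Variables (tau : rep C (center_bar Gb)) (rho : rep C (derived_bar Gb M)).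
Variable sigma : rep C (dagger Gb M).
Hypothesis tau_irr : irr_gen v eps tau.
Hypothesis rho_irr : irr_gen v eps rho.
Hypothesis sigma_box : is_boxtimes tau rho sigma.
Hypothesis sigma_irr : irr_gen v eps sigma.

Let K : subgroup Gb := dagger_subgroup Gb TM.
Let sigmaK : rep C K := sigma.

Lemma boxtimes_center_bar h : center (center_bar Gb) h ->
  exists a, forall w, rep_act sigma h w = a *: w.
Proof.
move=> hc; have [irr adm _] := tau_irr.
have [a ha] := @center_scalar C _ (center_bar_subgroup Gb) tau _ h irr adm hc.
have [t tt thom] := sigma_box; exists a; have Zh := proj1 hc.
have [t_lin _ _] := tt.
apply: (tensor_ext tt).
- by apply: (rep_linear sigma); exact: (center_dagger M).
- by move=> c u w; rewrite scalerDr !scalerA mulrC.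
move=> x u; rewrite -[h in LHS]mulg1 thom//; last exact: derived_bar1.
by rewrite ha rep_act1 (linZ (t_lin u)).
Qed.

Lemma boxtimes_center_derived h : center (derived_bar Gb M) h ->
  exists a, forall w, rep_act sigma h w = a *: w.
Proof.
move=> hc; have [irr adm _] := rho_irr.
have [a ha] := @center_scalar C _ (derived_bar_subgroup Gb M) rho _ h irr adm hc.
have [t tt thom] := sigma_box; exists a; have Zh := proj1 hc.
have [_ t_lin _] := tt.
apply: (tensor_ext tt).
- by apply: (rep_linear sigma); exact: (derived_dagger (Gb := Gb)).
- by move=> c u w; rewrite scalerDr !scalerA mulrC.
move=> x u; rewrite -[h in LHS]mul1g thom//; last exact: center_bar1.
by rewrite ha rep_act1 (linZ (t_lin x)).
Qed.

(** A set A of elements acting by scalars on sigma separates the conjugates of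
    sigma as soon as the characters chi_t, t outside the dagger subgroup, are
    nontrivial on it. *)
Lemma separated_irreducible (A : set Gb) :
  (forall h, A h -> dagger Gb M h) ->
  (forall x h, carrier (preim Gb M) x -> A h -> A (x * h * x^-1)%g) ->
  (forall h, A h -> exists a, forall w, rep_act sigma h w = a *: w) ->
  (forall t, carrier Tb t -> (forall h, A h -> chi eps t h = 1) -> dagger Gb M t) ->
  irreducible (Ind (cover_topology v Gb) (preim Gb M) sigma).
Proof.
move=> AK nA Asc Asep; have [irr [sm _] gen] := sigma_irr.
have wex h : exists a, A h -> forall u, rep_act sigma h u = a *: u.
  have [Ah|nAh] := pselect (A h); last by exists 0.
  by have [a ha] := Asc h Ah; exists a.
have [w wP] := choice wex.
apply: (@mackey_irreducible _ _ (cover_topology v Gb) K (preim Gb M) sigmaK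
  _ _ _ _ sm irr A AK nA w (fun h u Ah => wP h Ah u) _).
- exact: dagger_bar.
- exact: dagger_normal.
- exact: (dagger_index v).
- exact: dagger_open.
move=> g Mg nKg; have [k [t [Kk Tt gE]]] := dagger_torus_coset TM Mg.
have nKt : ~ dagger Gb M t.
  by move=> Kt; apply: nKg; rewrite gE; exact: (daggerM TM).
have Mt : carrier (preim Gb M) t by exact: TM.
apply: contrapT => hno; apply: nKt; rewrite -(invgK t); apply: (daggerV TM).
apply: Asep => [|h Ah]; first exact: subgroupV.
have wh : w (t * h * t^-1)%g = w h.
  by apply: contrapT => whne; apply: hno; exists k, t, h.
rewrite /chi invgK; case: xgetP => [z _ [zn zE]|_]; last exact: eps1.
have [[u u0] _] := irr.
have Kh := AK h Ah; have Kz : dagger Gb M (io z).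
  by apply: (center_dagger M); exact: iota_center_bar.
have tht : (t * h * t^-1 = io z * h)%g by rewrite zE mulgKV.
have wh0 : w h != 0.
  apply/eqP => wh0; apply: u0; have hu : rep_act sigmaK h u = 0.
    by rewrite [LHS](wP h Ah) wh0 scale0r.
  rewrite -(@rep_actVK _ _ K sigmaK h u Kh) hu (@rep_act0 _ _ K sigmaK)//.
  exact: (daggerV TM).
have : rep_act sigma (t * h * t^-1)%g u = eps z *: (w h *: u).
  by rewrite tht rep_actM// (wP h Ah) gen.
rewrite (wP _ (nA _ _ Mt Ah)).
rewrite wh scalerA => /eqP; rewrite -subr_eq0 -scalerBl scaler_eq0.
move=> /orP[|/eqP//]; rewrite -{1}[w h]mul1r -mulrBl mulf_eq0 (negPf wh0) orbF.
by rewrite subr_eq0 => /eqP.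
Qed.

(** Freeness is applied to the trivial character of A, the centre of one of the two
    factors: t fixes it exactly when chi_t is trivial on A. *)
Lemma free_irreducible :
  free_action eps (center (center_bar Gb)) (center [set: Gb]) \/
  free_action eps (center (derived_bar Gb M))
    (derived_bar Gb M `&` center (preim Gb M)) ->
  irreducible (Ind (cover_topology v Gb) (preim Gb M) sigma).
Proof.
have torus_dagger t : torus_dag Gb t -> dagger Gb M t.
  move=> [z [m [zc [Tm Gm] ->]]]; exists z, m; split=> //; split=> //.
  exact: TM.
have char1 (A B : set Gb) : quotient_char A B (fun=> 1 : C).
  by split=> // x y _ _; rewrite mulr1.
case=> free.
- apply: (@separated_irreducible (center (center_bar Gb))).
  + by move=> h [hc _]; exact: (center_dagger M).
  + move=> x h Mx hc; apply: (@center_normal _ (center_bar_subgroup Gb) (preim Gb M)) => //.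
    by move=> y k _ kc; exact: center_bar_normal.
  + exact: boxtimes_center_bar.
  + move=> t Tt ht; apply: torus_dagger.
    by apply: (free t (fun=> 1)) => // x Ax; rewrite ht// mulr1.
- apply: (@separated_irreducible (center (derived_bar Gb M))).
  + by move=> h [hc _]; exact: (derived_dagger (Gb := Gb)).
  + move=> x h Mx hc; apply: (@center_normal _ (derived_bar_subgroup Gb M) (preim Gb M)) => //.
    by move=> y k My kc; exact: derived_bar_normal.
  + exact: boxtimes_center_derived.
  + move=> t Tt ht; apply: torus_dagger.
    by apply: (free t (fun=> 1)) => // x Ax; rewrite ht// mulr1.
Qed.

End InducedFromDagger.
End Genuine.

(** * Isotypic induction and restriction for the torus *)

Section TorusParts.
Variables (F : fieldType) (v : padic_field F) (n : nat) (hilb : F -> F -> F).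
Variables (r : nat) (RD : root_datum r) (G : split_reductive_group F RD).
Variables (D : 'M[int]_r) (eta : 'rV[int]_r -> F).
Variable Gb : bd_cover n hilb G D eta.
Hypothesis n_gt0 : (0 < n)%N.
Variables (C : numClosedFieldType) (eps : F -> C).
Hypothesis eps_emb : is_mu_embedding n eps.

Local Notation pr := (@proj _ _ _ _ _ _ _ _ Gb).
Local Notation io := (iota Gb).
Local Notation Tb := (torus_bar Gb).
Local Notation T0 := (derived_bar Gb (torus G)).
Local Notation Tdag := (dagger Gb (torus G)).
Local Notation top := (cover_topology v Gb).

Let TT (g : G) (h : carrier (torus G) g) : carrier (torus G) g := h.
Let K : subgroup Gb := dagger_subgroup Gb TT.

Let K_mu z : z ^+ n = 1 -> carrier K (io z).
Proof. by move=> zn; apply: center_dagger; exact: iota_center_bar. Qed.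

Let KT x : carrier K x -> carrier Tb x.
Proof. exact: dagger_bar. Qed.

Lemma sub_torus_index (L : subgroup Gb) : (forall x, carrier L x -> carrier Tb x) ->
  fin_index L (center Tb).
Proof.
move=> LT; have [I [cl hcl]] := torus_bar_center_index v Gb n_gt0.
by exists I, cl => x y /LT Tx /LT Ty; exact: hcl.
Qed.

Lemma scalar_act_eq (L L' : set Gb) (pi : rep C L) (W : rep C L') (j : W -> pi) z a :
  linear j -> injective j -> (forall w, j (rep_act W z w) = rep_act pi z (j w)) ->
  (forall u, rep_act pi z u = a *: u) -> forall w, rep_act W z w = a *: w.
Proof. by move=> jl ji jh ha w; apply: ji; rewrite jh ha (linZ jl). Qed.

Section Induced.
Variables (tau : rep C (center_bar Gb)) (rho : rep C T0) (sigma : rep C Tdag).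
Hypothesis tau_irr : irr_gen v eps tau.
Hypothesis rho_irr : irr_gen v eps rho.
Hypothesis sigma_box : is_boxtimes tau rho sigma.
Hypothesis sigma_irr : irr_gen v eps sigma.
Hypothesis center_sub :
  center Tb `<=` setmul (center (center_bar Gb)) (center T0).

Let sigmaK : rep C K := sigma.
Let V := Ind top Tb sigmaK.

Let zK z : center Tb z -> carrier K z.
Proof. by move=> /center_sub[a [b [[Za _] [Tb0 _] ->]]]; exists a, b. Qed.

Let sigma_scalar z : center Tb z -> exists a, forall w, rep_act sigmaK z w = a *: w.
Proof.
move=> /center_sub[a [b [ac bc ->]]].
have [al hal] := boxtimes_center_bar (M := torus G) tau_irr sigma_box ac.
have [be hbe] := boxtimes_center_derived (M := torus G) rho_irr sigma_box bc.
exists (al * be) => w; have [Za _] := ac; have [T0b _] := bc.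
rewrite (rep_actM sigmaK); [|exact: center_dagger|exact: derived_dagger].
by rewrite [rep_act _ b _]hbe [rep_act _ a _]hal scalerA.
Qed.

(** The centre of the preimage of T acts on the induced representation through the
    scalars by which it acts on sigma, so that [isotypic_genuine] applies with any
    irreducible subrepresentation. *)
Lemma induced_isotypic : exists (pi : rep C Tb) (e : nat),
  irr_gen v eps pi /\ rep_iso V (multiple e pi).
Proof.
have [sirr [ssm _] sgen] := sigma_irr.
have K_open := dagger_open v Gb TT.
have sfd : fin_dim sigmaK.
  apply: (irreducible_fin_dim (Z := center_subgroup Tb)) => //.
  exact: (sub_torus_index KT).
have Vfd : fin_dim V.
  apply: fin_dim_ind => //; first exact: (dagger_index v Gb TT).
  by move=> x k; exact: dagger_normal.
have V0 : exists f : V, f <> 0.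
  have [[w w0] _] := sirr.
  have [f [fK _]] := ind_extend (H := Tb) (sigma := sigmaK) KT K_open ssm w.
  exists f => f0; apply: w0; have := fK _ (subgroup1 K).
  by rewrite f0 ind_ev0 (rep_act1 sigmaK) => <-.
have Vgen : genuine eps V.
  move=> z f zn; apply: ind_central_scalar => //; first exact: K_mu.
    by move=> x _; rewrite iota_central.
  by move=> w; exact: sgen.
have [W [j [Wirr Wfd jl ji jh]]] := irreducible_sub Vfd V0.
have Wsc z : center Tb z -> exists a,
    (forall f, rep_act V z f = a *: f) /\ (forall w, rep_act W z w = a *: w).
  move=> zc; have [a ha] := sigma_scalar zc; exists a.
  have Tz := proj1 zc.
  have hV f : rep_act V z f = a *: f.
    apply: ind_central_scalar => //; first exact: zK.
    by move=> x Tx; case: zc => _ ->.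
  split=> //; apply: (scalar_act_eq jl ji) => // w; exact: jh.
exists W; have [e hW] := isotypic_genuine v n_gt0 eps_emb (fun x h => h) Vgen Vfd Wirr Wsc.
exists e; split=> //; split=> //.
  apply: admissible_fin_dim => //; apply: (smooth_sub ji jh); exact: ind_smooth.
apply: (genuine_sub _ jl ji jh Vgen) => z zn; apply: KT; exact: K_mu.
Qed.

End Induced.
(** At the trivial character, triviality of the action says that chi_g(h) = 1, that
    is that h commutes with g. *)
Lemma trivial_action_central (A B : set Gb) : trivial_action eps A B ->
  forall h, A h -> carrier Tb h -> center Tb h.
Proof.
move=> triv h Ah Th; split=> // g Tg.
have [z zn hg] := commutator_mu (torus_bar_comm Th Tg).
have conjE : (g^-1 * h * g * h^-1 = io z)%g.
  apply: (mulIg h); rewrite mulgKV -mulgA hg mulgA -(iota_central (g^-1)%g zn).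
  by rewrite -mulgA mulKg.
have /(_ h Ah) : forall x, A x -> 1 * chi eps g x = 1.
  by apply: (triv g (fun=> 1)) => //; split=> // x y _ _; rewrite mulr1.
rewrite mul1r /chi; case: xgetP => [w _ [wn wE]|/(_ z)/(_ (conj zn (esym conjE)))//].
move/(eps_eq1 eps_emb wn) => w1; have z1 : io z = 1%g.
  by rewrite -conjE -wE w1 iota1.
by rewrite hg z1 mul1g.
Qed.

(** The centre of T^dag is the product of the centres of its two commuting factors,
    so it is central in the preimage of T and acts on pi by scalars; the same holds
    for the centre of the first factor, whence the tensor factorization. *)
Lemma restricted_isotypic (pi : rep C Tb) (sKT : Tdag `<=` Tb) :
  (forall x y, center_bar Gb x -> T0 y -> x * y = y * x)%g ->
  trivial_action eps (center (center_bar Gb)) (center [set: Gb]) ->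
  trivial_action eps (center T0) (T0 `&` center Tb) ->
  irr_gen v eps pi ->
  exists (tau : rep C (center_bar Gb)) (rho : rep C T0) (sigma : rep C Tdag) (e : nat),
    [/\ irr_gen v eps tau, irr_gen v eps rho, is_boxtimes tau rho sigma,
        irr_gen v eps sigma & rep_iso (res sKT pi) (multiple e sigma)].
Proof.
move=> comm trivZ trivT0 [pirr padm pgen]; have [psm _] := padm.
have psc z : center Tb z -> exists a, forall u, rep_act pi z u = a *: u.
  exact: (center_scalar pirr padm).
have pfd : fin_dim pi.
  apply: (irreducible_fin_dim (Z := center_subgroup Tb)) => //.
    exact: sub_torus_index.
  by move=> z [].
pose pK : rep C K := res sKT pi.
have zZ z : center (center_bar Gb) z -> center Tb z.
  by move=> zc; apply: (trivial_action_central trivZ) => //; apply: center_bar_torus; case: zc.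
have zT0 z : center T0 z -> center Tb z.
  by move=> zc; apply: (trivial_action_central trivT0) => //; case: zc => -[].
have zK z : center K z -> center Tb z.
  move=> [[a [b [Za Tb0 ->]]] abc]; apply: centerM; [apply: zZ|apply: zT0]; split=> // y hy.
    have := abc y (center_dagger (torus G) hy).
    by rewrite -mulgA -(comm y b hy Tb0) !mulgA => /mulIg.
  have := abc y (derived_dagger hy).
  by rewrite !mulgA -(comm a y Za hy) -!mulgA => /mulgI.
have pKfd : fin_dim pK by exact: pfd.
have [sigma [j [sirr sfd jl ji jh]]] := irreducible_sub pKfd (proj1 pirr).
have ssm : smooth top sigma.
  apply: (smooth_sub ji jh) => u; have [N nN Nu] := psm u.
  by exists N => // h Kh Nh; exact: (Nu h (KT Kh) Nh).
have pKgen : genuine eps pK by exact: pgen.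
have sgen : genuine eps sigma by exact: (genuine_sub K_mu jl ji jh pKgen).
have [|e he] := isotypic_genuine v n_gt0 eps_emb KT pKgen pKfd sirr.
  move=> z zc; have [a ha] := psc z (zK z zc); exists a; split; first exact: ha.
  by apply: (scalar_act_eq (pi := pK) jl ji) => // w; apply: jh; case: zc.
pose Z := center_bar_subgroup Gb.
have ZK : center_bar Gb `<=` Tdag by move=> x; exact: center_dagger.
pose sZ : rep C Z := res ZK sigma.
have sZfd : fin_dim sZ by exact: sfd.
have [tau [j2 [tirr tfd j2l j2i j2h]]] := irreducible_sub sZfd (proj1 sirr).
have Z_mu z : z ^+ n = 1 -> carrier Z (io z) by exact: iota_center_bar.
have sZgen : genuine eps sZ by exact: sgen.
have tsm : smooth top tau.
  apply: (smooth_sub j2i j2h) => u; have [N nN Nu] := ssm u.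
  by exists N => // h Zh Nh; exact: (Nu h (ZK h Zh) Nh).
have [|m [phi [phi_bij phi_hom]]] := isotypic_genuine v n_gt0 eps_emb
    (@center_bar_torus _ _ _ _ _ _ _ _ Gb : forall x, carrier Z x -> _) sZgen sZfd tirr.
  move=> z zc; have [a ha] := psc z (zZ z zc); have Zz := proj1 zc.
  have sa : forall w, rep_act sigma z w = a *: w.
    by apply: (scalar_act_eq (pi := pK) jl ji) => // w; apply: jh; exact: (ZK z Zz).
  exists a; split; first exact: sa.
  by apply: (scalar_act_eq (pi := sZ) j2l j2i) => // w; exact: j2h.
have [//|rho [rfd rirr box [j3 [j3l j3i j3h]]]] := @tensor_factor _ _ Z
  (derived_bar_subgroup Gb (torus G)) tau sigma m comm tirr tfd sirr phi (linearP phi) phi_bij.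
exists tau, rho, sigma, e; split=> //.
- split=> //; first exact: (admissible_fin_dim (L := Z)).
  exact: (genuine_sub Z_mu j2l j2i j2h sZgen).
- pose s0 : rep C (derived_bar_subgroup Gb (torus G)) :=
    res (fun x hx => derived_dagger hx : carrier K x) (sigma : rep C K).
  split=> //; last first.
    apply: (genuine_sub (pi := s0) _ j3l j3i j3h sgen) => z zn.
    rewrite /= /derived_bar /preimage /= proj_iota//.
    by split; [exact: subgroup1 (torus G)|exact: subgroup1 (derived_group G)].
  apply: (admissible_fin_dim (L := derived_bar_subgroup Gb (torus G))) => //.
  apply: (smooth_sub (pi := s0) j3i j3h) => u.
  have [N nN Nu] := ssm u.
  by exists N => // h Bh Nh; exact: (Nu h (derived_dagger Bh) Nh).
- by split=> //; exact: (admissible_fin_dim (L := K)).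
Qed.

End TorusParts.

Theorem theorem1p1
  (R : realType)
  (F : fieldType) (v : padic_field F)
  (n : nat) (n_gt0 : (0 < n)%N)
  (mu_n_sub : exists zeta : F, n.-primitive_root zeta)
  (hilb : F -> F -> F) (hilbP : is_hilbert_symbol v n hilb)
  (r : nat) (RD : root_datum r) (G : split_reductive_group F RD)
  (D : 'M[int]_r) (D_inv : weyl_invariant RD D)
  (eta : 'rV[int]_r -> F) (eta_hom : is_coroot_hom RD eta)
  (Gb : bd_cover n hilb G D eta)
  (eps : F -> R[i]) (eps_emb : is_mu_embedding n eps)
  (ZG_connected : connected_center RD)
  (e_c : 'rV[int]_r)
  (Y_c : forall y, central_cochar RD y <-> exists k : int, y = k *: e_c) :
  (forall lam : 'rV[int]_r,
     free_on_QZ Gb eps \/ free_on_QM0 Gb eps lam ->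
     forall (tau : rep R[i] (center_bar Gb))
            (rho : rep R[i] (levi0_bar Gb lam))
            (sigma : rep R[i] (levi_dag Gb lam)),
       irr_gen v eps tau -> irr_gen v eps rho ->
       is_boxtimes tau rho sigma -> irr_gen v eps sigma ->
       irreducible (Ind (cover_topology v Gb) (levi_bar Gb lam) sigma))
  /\
  (trivial_on_QZ Gb eps -> trivial_on_QT0 Gb eps ->
   forall pi : rep R[i] (torus_bar Gb), irr_gen v eps pi ->
     exists (tau : rep R[i] (center_bar Gb))
            (rho : rep R[i] (torus0_bar Gb))
            (sigma : rep R[i] (torus_dag Gb)) (e : nat),
       [/\ irr_gen v eps tau, irr_gen v eps rho, is_boxtimes tau rho sigma,
           irr_gen v eps sigma &
           rep_iso (res (torus_dag_sub Gb) pi)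
             (multiple e sigma)])
  /\
  (center (torus_bar Gb) `<=`
     setmul (center (center_bar Gb)) (center (torus0_bar Gb)) ->
   forall (tau : rep R[i] (center_bar Gb))
          (rho : rep R[i] (torus0_bar Gb))
          (sigma : rep R[i] (torus_dag Gb)),
     irr_gen v eps tau -> irr_gen v eps rho ->
     is_boxtimes tau rho sigma -> irr_gen v eps sigma ->
     exists (pi : rep R[i] (torus_bar Gb)) (e : nat),
       irr_gen v eps pi /\
       rep_iso (Ind (cover_topology v Gb) (torus_bar Gb) sigma)
         (multiple e pi)).
Proof.
have [hX hMl hMr _] := hilbP.
have skew := hilbert_skew n_gt0 mu_n_sub hilbP.
have comm x y : center_bar Gb x -> derived_bar Gb (torus G) y -> (x * y = y * x)%g.
  move=> xc [_ hy]; exact: (center_bar_derived_commute v n_gt0 ZG_connected D_inv skew).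
split=> [lam free tau rho sigma tau_irr rho_irr box sigma_irr|].
  have TM g : carrier (torus G) g -> carrier (levi G lam) g.
    by move=> Tg H; apply; left.
  exact: (free_irreducible eps_emb TM tau_irr rho_irr box sigma_irr free).
split=> [trivZ trivT0 pi pi_irr|sub tau rho sigma tau_irr rho_irr box sigma_irr].
  exact: (restricted_isotypic n_gt0 eps_emb (torus_dag_sub Gb) comm trivZ trivT0 pi_irr).
exact: (induced_isotypic n_gt0 eps_emb tau_irr rho_irr box sigma_irr sub).
Qed.
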